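(* Suppose that $A$ and $B$ are simultaneously strictly upper triangular $d\times d$ matrices over $\mathbf k$. Define matrices $L_m(A,B)$, $m\ge1$, by $$\log\Big(1+\sum_{m\ge1}B(B-A)^{m-1}t^m\Big)=\sum_{m\ge1}L_m(A,B)\,t^m ,$$ and let $\mathfrak g_{A,B}\subset\mathfrak{gl}_d(\mathbf k)$ be the Lie subalgebra generated by $L_1(A,B),\ldots,L_{d-1}(A,B)$. Then the difference Galois groups over $\mathbf k(s)$ of the two systems $$(s+1+A-B)\,F(s+1)=(s+A)\,F(s)$$ and $$U(s+1)=D(s)\,U(s),\qquad D(s)=(s+1+A)(s+1+A-B)^{-1},$$ are both $$\exp(\mathfrak g_{A,B})\subset\operatorname{GL}_d(\mathbf k).$$
   Context: $\mathbf k$ is an algebraically closed field of characteristic zero; the base difference field is $\mathbf k(s)$ with $\sigma(s)=s+1$. Scalars in matrix expressions denote scalar multiples of the identity matrix. The two systems are related by the rational gauge transformation $F(s)=(s+A)^{-1}U(s)$. A Picard--Vessiot ring for a system $\sigma(Y)=\mathcal A Y$, $\mathcal A\in\operatorname{GL}_d(\mathbf k(s))$, is a difference ring extension $R$ of $\mathbf k(s)$ with no nontrivial $\sigma$-ideals that is generated over $\mathbf k(s)$ by the entries of a fundamental solution matrix $Z\in\operatorname{GL}_d(R)$, $\sigma(Z)=\mathcal A Z$, and by $\det(Z)^{-1}$. The difference Galois group is the group of $\sigma$-automorphisms of $R$ over $\mathbf k(s)$, regarded as a closed algebraic subgroup of $\operatorname{GL}_d$ over $\mathbf k$ via $Z\mapsto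 Zc$ (as usual, as a subgroup of $\operatorname{GL}_d$ it depends on the choice of fundamental matrix up to conjugation). *)

(* Defs.v *)
From HB Require Import structures.
From mathcomp Require Import all_boot all_order all_algebra.
From mathcomp Require Import classical_sets.

Set Implicit Arguments.
Unset Strict Implicit.
Unset Printing Implicit Defensive.

Import GRing.Theory.

Local Open Scope ring_scope.
Local Open Scope classical_set_scope.

Notation ratfun k := {fraction {poly k}}.

Section RationalFunctions.
Variable k : fieldType.

Definition fracP : {poly k} -> ratfun k := @FracField.tofrac {poly k}.

Definition ratC (c : k) : ratfun k := fracP c%:P.

Definition ratX : ratfun k := fracP 'X.

Definition shiftp (p : {poly k}) : {poly k} := p \Po ('X + 1).

(* The automorphism s |-> s + 1 of k(s), computed on representatives;
   [shift_fracP] and [shift_div] show that the choice does not matter. *)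
Definition shift (f : ratfun k) : ratfun k :=
  fracP (shiftp \n_(repr f)) / fracP (shiftp \d_(repr f)).

Lemma fracP_eq0 p : (fracP p == 0) = (p == 0).
Proof. exact: tofrac_eq0. Qed.

Lemma fracPM : {morph fracP : p q / p * q}.
Proof. exact: tofracM. Qed.

Lemma fracPD : {morph fracP : p q / p + q}.
Proof. exact: tofracD. Qed.

Lemma fracP1 : fracP 1 = 1.
Proof. exact: tofrac1. Qed.

Lemma shiftpD : {morph shiftp : p q / p + q}.
Proof. by move=> p q; rewrite /shiftp comp_polyD. Qed.

Lemma shiftpM : {morph shiftp : p q / p * q}.
Proof. by move=> p q; rewrite /shiftp comp_polyM. Qed.

Lemma shiftp_eq0 p : (shiftp p == 0) = (p == 0).
Proof. by rewrite /shiftp comp_poly2_eq0 // size_XaddC. Qed.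

Lemma fracP_repr (f : ratfun k) : f = fracP \n_(repr f) / fracP \d_(repr f).
Proof.
have d0 : fracP \d_(repr f) != 0 by rewrite fracP_eq0 denom_ratioP.
apply/(canRL (mulfK d0)); rewrite -{1}[f]reprK /fracP; unlock FracField.tofrac.
rewrite -[LHS]FracField.pi_mul; apply/eqmodP => /=.
rewrite FracField.equivfE /FracField.mulf /=.
by rewrite !numden_Ratio ?mulf_neq0 ?oner_neq0 ?denom_ratioP // !mulr1 mulrC.
Qed.

Lemma shift_div (p q : {poly k}) : q != 0 ->
  shift (fracP p / fracP q) = fracP (shiftp p) / fracP (shiftp q).
Proof.
move=> q0; rewrite /shift.
have d0 : \d_(repr (fracP p / fracP q)) != 0 by exact: denom_ratioP.
have /eqP := fracP_repr (fracP p / fracP q).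
move: d0; set n := \n_(_); set d := \d_(_) => d0.
rewrite eqr_div ?fracP_eq0 // -!fracPM tofrac_eq => /eqP e.
apply/eqP; rewrite eqr_div ?fracP_eq0 ?shiftp_eq0 // -!fracPM -!shiftpM.
by rewrite e mulrC.
Qed.

Lemma shift_fracP p : shift (fracP p) = fracP (shiftp p).
Proof.
rewrite -[fracP p]divr1 -fracP1 shift_div ?oner_neq0 //.
by rewrite /shiftp -[1 \Po _]/(1%:P \Po _) comp_polyC fracP1 divr1.
Qed.

Lemma shift_is_zmod_morphism : zmod_morphism shift.
Proof.
move=> f g; rewrite (fracP_repr f) (fracP_repr g).
have: \d_(repr f) != 0 /\ \d_(repr g) != 0 by split; exact: denom_ratioP.
move: \n_(repr f) \d_(repr f) \n_(repr g) \d_(repr g) => a b c d [b0 d0].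
have fB (p q r t : {poly k}) : q != 0 -> t != 0 ->
    fracP p / fracP q - fracP r / fracP t = fracP (p * t - r * q) / fracP (q * t).
  move=> q0 t0; have fN u : fracP (- u) = - fracP u by exact: tofracN.
  rewrite fracPD fN !fracPM -mulNr addf_div ?fracP_eq0 //.
  by rewrite mulNr.
rewrite fB // !shift_div ?mulf_neq0 // fB ?shiftp_eq0 //.
by rewrite -!shiftpM /shiftp raddfB.
Qed.

Lemma shift_is_monoid_morphism : monoid_morphism shift.
Proof.
split; first by rewrite -fracP1 shift_fracP /shiftp -[1 \Po _]/(1%:P \Po _) comp_polyC.
move=> f g; rewrite (fracP_repr f) (fracP_repr g).
have b0 : \d_(repr f) != 0 by exact: denom_ratioP.
have d0 : \d_(repr g) != 0 by exact: denom_ratioP.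
rewrite mulf_div -!fracPM !shift_div ?mulf_neq0 // mulf_div -!fracPM.
by rewrite !shiftpM.
Qed.

HB.instance Definition _ :=
  GRing.isZmodMorphism.Build (ratfun k) (ratfun k) shift shift_is_zmod_morphism.
HB.instance Definition _ :=
  GRing.isMonoidMorphism.Build (ratfun k) (ratfun k) shift
    shift_is_monoid_morphism.

Lemma shift_ratC c : shift (ratC c) = ratC c.
Proof. by rewrite shift_fracP /shiftp comp_polyC. Qed.

Lemma shift_ratX : shift ratX = ratX + 1.
Proof. by rewrite shift_fracP /shiftp comp_polyX fracPD fracP1. Qed.

End RationalFunctions.

Section DifferenceGalois.
Variable k : fieldType.

Section DifferenceRing.
Variables (R : comUnitAlgType (ratfun k)) (sigma : {rmorphism R -> R}).

(* k(s) embeds in the nonzero ring R through a |-> a%:A. *)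
Definition difference_extension : Prop :=
  bijective sigma /\ forall a : ratfun k, sigma a%:A = (shift a)%:A.

(* [idealr_closed] only holds of ideals that do not contain 1. *)
Definition sigma_simple : Prop :=
  forall I : {pred R}, idealr_closed I ->
    (forall x, x \in I -> sigma x \in I) -> forall x, x \in I -> x = 0.

Definition fundamental_matrix d (M : 'M[ratfun k]_d) (Z : 'M[R]_d) : Prop :=
  Z \in unitmx /\
  map_mx sigma Z = map_mx (fun a : ratfun k => a%:A : R) M *m Z.

Definition generated_by_solution d (Z : 'M[R]_d) : Prop :=
  forall S : {pred R}, subalg_closed S ->
    (forall i j, Z i j \in S) -> (\det Z)^-1 \in S -> forall x, x \in S.

Definition picard_vessiot d (M : 'M[ratfun k]_d) (Z : 'M[R]_d) : Prop :=
  [/\ difference_extension, sigma_simple, fundamental_matrix M Z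
    & generated_by_solution Z].

Definition const_mx_in d (c : 'M[k]_d) : 'M[R]_d :=
  map_mx (fun x : k => (ratC x)%:A : R) c.

(* [f : {lrmorphism R -> R}] makes f the identity on k(s). *)
Definition sigma_automorphism (f : {lrmorphism R -> R}) : Prop :=
  bijective f /\ forall x, f (sigma x) = sigma (f x).

Definition galois_group d (Z : 'M[R]_d) : set 'M[k]_d :=
  [set c | c \in unitmx /\ exists f : {lrmorphism R -> R},
     sigma_automorphism f /\ map_mx f Z = Z *m const_mx_in c].

End DifferenceRing.

(* Fundamental matrices of one Picard-Vessiot ring differ by an element P of
   GL_d(k), which conjugates the group; hence the choice of P below.  For k
   algebraically closed of characteristic 0 the Picard-Vessiot ring exists and
   is unique up to isomorphism, so it does not matter which R is taken. *)
Definition has_galois_group d (M : 'M[ratfun k]_d) (G : set 'M[k]_d) : Prop :=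
  forall (R : comUnitAlgType (ratfun k)) (sigma : {rmorphism R -> R})
    (Z : 'M[R]_d),
  picard_vessiot sigma M Z ->
  exists2 P : 'M[k]_d, P \in unitmx &
    galois_group sigma (Z *m const_mx_in R P) = G.

End DifferenceGalois.

Section PowerSeries.
Variables (k : fieldType) (d : nat).

(* A formal power series over 'M[k]_d is its sequence of coefficients. *)
Implicit Types f g : nat -> 'M[k]_d.

Definition fps_one : nat -> 'M[k]_d := fun m => (m == 0%N)%:R%:M.

Definition fps_mul f g : nat -> 'M[k]_d :=
  fun m => \sum_(i < m.+1) f i *m g (m - i)%N.

Definition fps_exp f n : nat -> 'M[k]_d := iter n (fps_mul f) fps_one.

(* log (1 + f) = \sum_(n >= 1) (-1)^(n-1) f^n / n for f with f 0 = 0; then f^n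
   has no terms of degree < n, so n <= m suffices for the coefficient of t^m. *)
Definition fps_log1 f : nat -> 'M[k]_d :=
  fun m => \sum_(1 <= n < m.+1) ((-1) ^+ n.-1 / n%:R) *: fps_exp f n m.

End PowerSeries.

Section LieAlgebra.
Variables (k : fieldType) (d : nat).

Definition strictly_upper_triangular (A : 'M[k]_d) : Prop :=
  forall i j : 'I_d, (j <= i)%N -> A i j = 0.

Definition lie_subalgebra (g : set 'M[k]_d) : Prop :=
  [/\ g 0, forall (a : k) x y, g x -> g y -> g (a *: x + y)
    & forall x y, g x -> g y -> g (x *m y - y *m x)].

Definition L_series (A B : 'M[k]_d) (m : nat) : 'M[k]_d :=
  fps_log1 (fun m => if m is m'.+1 then B *m (B - A) ^+ m' else 0) m.

Definition lie_alg (A B : 'M[k]_d) : set 'M[k]_d :=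
  smallest lie_subalgebra
    [set L_series A B m | m in [set m : nat | (1 <= m < d)%N]].

(* The exponential of a nilpotent d x d matrix x, for which x ^+ d = 0. *)
Definition nilp_exp (x : 'M[k]_d) : 'M[k]_d :=
  \sum_(n < d) (n`!%:R)^-1 *: x ^+ n.

Definition ratC_mx (A : 'M[k]_d) : 'M[ratfun k]_d := map_mx (@ratC k) A.

(* (s + 1 + A - B) F(s+1) = (s + A) F(s), solved for F(s+1); the matrix on the
   left is invertible over k(s) because its determinant is monic in s. *)
Definition system_F (A B : 'M[k]_d) : 'M[ratfun k]_d :=
  invmx ((ratX k + 1)%:M + ratC_mx A - ratC_mx B) *m ((ratX k)%:M + ratC_mx A).

Definition system_U (A B : 'M[k]_d) : 'M[ratfun k]_d :=
  ((ratX k + 1)%:M + ratC_mx A) *m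
  invmx ((ratX k + 1)%:M + ratC_mx A - ratC_mx B).

End LieAlgebra.

(* Main.v *)
Require Import Defs.
From mathcomp Require Import all_boot all_order all_algebra.
From mathcomp Require Import classical_sets.
From HB Require Import structures.
From mathcomp Require Import ring.
From mathcomp Require Import boolp functions.

Set Implicit Arguments.
Unset Strict Implicit.
Unset Printing Implicit Defensive.

Import GRing.Theory.

Local Open Scope ring_scope.

(** Write [K] for [k(s)], [g] for the Lie algebra and [D] for the matrix of the
    second system.

    Expanding [D] in [t = 1 / (s + 1)] gives [1 + \sum_m B (B - A)^(m-1) t^m], so
    that [D = exp l] with [l = \sum_m t^m L_m] in [g (x) K] (mexp_gauge_log).  By
    the Campbell-Hausdorff theorem the exponentials of [g (x) K] form a group [G]
    (exp_groupM), unipotent and containing [D].  The polynomial functions on [G]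
    are a difference ring over [K]: the twist sends [f] to
    [x |-> sigma (f (sigma^-1 (D x)))], so the tautological matrix of coordinate
    functions, [Y], satisfies [twist Y = D Y].

    This ring has no nontrivial ideal stable under the twist; indeed every nonzero
    stable [K]-subspace contains [1] (twist_simple).  Since [D] is unipotent,
    the twist fixes each coordinate function modulo later ones, so a stable
    subspace contains an invariant function [f], and it suffices that [f] be a
    constant of [k] (twist_fixed).  Right translations by [exp y], [y] in [g],
    commute with the twist and are unipotent as well; a nonconstant [f] of minimal
    height for them satisfies [f (x exp y) = f x + phi y].  The polynomial nature
    of [f] and the Campbell-Hausdorff formula make [phi] a linear form that
    vanishes on brackets and whose [K]-linear extension describes [f] on all of
    [G] (additive_scalar_ext).  At the inverse of [D], invariance of [f] reads
    [sigma a - a = - \sum_m phi (L_m) / (s + 1)^m] with [a = f 1] in [K].  A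
    rational function whose difference has its poles at a single point is a
    polynomial (shift_sub_poly), hence all [phi (L_m)] are zero (shift_sub_pole);
    as the [L_m] generate [g], [phi] is zero and [f] is constant.

    Let now [R] be any Picard-Vessiot ring of the second system, with solution
    [Z].  The functions [W = Y^-1 Z] from [G] to [R] are invariant under the
    twist.  By the previous paragraph, invariants independent over [k] remain
    independent over the coordinate ring, so a [k]-algebra morphism
    [k[W, W^-1] -> k], which the Nullstellensatz provides, extends to the subring
    they generate together with the coordinate ring.  Restricted to [R] this is
    an equivariant morphism that sends [Z] to [Y P], with [P] an invertible
    constant matrix (specialization); it is injective because [R] is simple.
    So [Y] may stand for the solution [Z P^-1] of [R].  Right translation by an
    element of [exp g] preserves the image of [R] and gives an automorphism
    (exp_in_galois).  Conversely, a linear form on matrices over [k] that vanishes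
    on [g] vanishes on [log Y], a relation with coefficients in [k] that every
    automorphism preserves; evaluated at the identity of [G] it says that
    [log c] is in [g] when the automorphism is [Y |-> Y c] (galois_in_exp).

    The first system is gauge equivalent to the second one by [s + A], which
    transports Picard-Vessiot rings and their automorphisms. *)

(** * Exponential and logarithm of nilpotent matrices *)

Section TruncatedSeries.
Variables (S : comUnitRingType) (m : nat).
Hypothesis QS : forall n, n.+1%:R \is a @GRing.unit S.

(** The exponential of a nilpotent matrix of size [m.+1] is the value of this
    polynomial; identities between power series are needed modulo ['X^m.+1] only,
    since such a matrix is a root of ['X^m.+1]. *)
Definition exp_poly : {poly S} := \poly_(i < m.+1) (i`!%:R)^-1.

Definition log_poly : {poly S} :=
  \sum_(1 <= n < m.+1) ((-1) ^+ n.-1 / n%:R) *: 'X^n.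

Lemma fact_unit n : n`!%:R \is a @GRing.unit S.
Proof.
elim: n => [|n IH]; first by rewrite fact0 unitr1.
by rewrite factS natrM unitrM QS IH.
Qed.

Lemma invf_factS n : (n.+1`!%:R)^-1 * n.+1%:R = (n`!%:R)^-1 :> S.
Proof. by rewrite factS natrM invrM ?QS ?fact_unit // mulrVK ?QS. Qed.

Lemma coef_log_poly i :
  log_poly`_i = if (0 < i < m.+1)%N then (-1) ^+ i.-1 / i%:R else 0.
Proof.
rewrite /log_poly coef_sum.
under eq_bigr do rewrite coefZ coefXn.
case: ifP => [/andP[i0 im] | /negbT out].
  rewrite (bigD1_seq i) ?mem_index_iota ?iota_uniq ?i0 //= eqxx mulr1 big1 ?addr0 //.
  by move=> j /negbTE; rewrite eq_sym => ->; rewrite mulr0.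
rewrite big1_seq // => j; rewrite mem_index_iota /= => jm.
by case: eqP => [ij|_]; [rewrite ij jm in out | rewrite mulr0].
Qed.

Lemma deriv_exp_poly : exists c, exp_poly^`() = exp_poly - c *: 'X^m.
Proof.
exists (m`!%:R)^-1; apply/polyP => i; rewrite coef_deriv coefB coefZ coefXn !coef_poly.
rewrite ltnS -[_ *+ _]mulr_natr; case: (ltngtP i m) => [im|im|->].
- by rewrite invf_factS ltnW //= mulr0 subr0.
- by rewrite ltnS leqNgt im mul0r /= mulr0 subr0.
- by rewrite ltnSn mul0r mulr1 subrr.
Qed.

Lemma deriv_log_poly : (1 + 'X) * log_poly^`() = 1 - (- 'X) ^+ m.
Proof.
have -> : log_poly^`() = \sum_(i < m) (- 'X) ^+ i.
  apply/polyP => i; rewrite coef_deriv coef_log_poly /= ltnS coef_sum.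
  under eq_bigr do rewrite exprNn -signr_odd.
  case: ltnP => im; last first.
    rewrite mul0rn big1 // => j _.
    by case: (odd j); rewrite ?expr1 ?expr0 ?mulNr ?mul1r ?coefN coefXn gtn_eqF ?oppr0 // (leq_trans (ltn_ord j)).
  rewrite (bigD1 (Ordinal im)) //= big1 ?addr0.
    rewrite -[_ *+ _]mulr_natr mulrVK ?QS // -signr_odd.
    by case: (odd i); rewrite ?expr1 ?expr0 ?mulNr ?mul1r ?coefN coefXn eqxx.
  move=> j; rewrite -val_eqE /= => ji.
  case: (odd j); rewrite ?expr1 ?expr0 ?mulNr ?mul1r ?coefN coefXn eq_sym (negbTE ji) ?oppr0 //.
rewrite -[LHS]opprK -mulNr opprD [- 1 - _]addrC -subrX1 opprB //.
Qed.

Lemma low_coefs0 (R : nzRingType) n (p : {poly R}) :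
  (forall i, (i < n)%N -> p`_i = 0) -> exists q, p = q * 'X^n.
Proof.
move=> p0; exists (drop_poly n p); rewrite -[LHS](poly_take_drop n).
suff -> : take_poly n p = 0 by rewrite add0r.
by apply/polyP => i; rewrite coef_take_poly coef0; case: ifP => // /p0.
Qed.

Lemma coefMXn_low (R : nzRingType) n (q : {poly R}) i :
  (i < n)%N -> (q * 'X^n)`_i = 0.
Proof. by move=> im; rewrite coefMXn im. Qed.

Lemma log_polyX : exists l, log_poly = l * 'X.
Proof.
have [|l ->] := @low_coefs0 _ 1 log_poly; last by exists l; rewrite expr1.
by move=> [|i] //; rewrite coef_log_poly.
Qed.

Lemma exp_polyX : exists e, exp_poly - 1 = e * 'X.
Proof.
have [|l ->] := @low_coefs0 _ 1 (exp_poly - 1); last by exists l; rewrite expr1.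
by move=> [|i] //; rewrite coefB coef_poly coef1 /= fact0 invr1 subrr.
Qed.

Lemma mulSn_eq0 n (x : S) : x * n.+1%:R = 0 -> x = 0.
Proof. by move=> /(canRL (mulrK (QS n))); rewrite mul0r. Qed.

(** In degree [i] the equation reads [(i + 1) Q_(i+1) = (1 - i) Q_i]. *)
Lemma euler_ode_eq0 (Q r : {poly S}) :
    Q`_0 = 0 -> (1 + 'X) * Q^`() = Q + r * 'X^m ->
  exists q, Q = q * 'X^(m.+1).
Proof.
move=> Q0 ode; apply: low_coefs0; elim=> [|i IH] // im.
apply: (@mulSn_eq0 i); move/(congr1 (fun p : {poly S} => p`_i)): ode.
rewrite mulrDl mul1r !coefD coefMXn_low // coefXM IH ?(ltnW im) // coef_deriv.
case: i IH im => [|i] IH im /=; rewrite !addr0 mulr_natr // coef_deriv.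
by rewrite IH ?(ltnW im) // mul0rn addr0.
Qed.

(** Both series solve a linear differential equation to the order considered,
    which determines all coefficients in degree at most [m] from the constant
    one. *)
Lemma exp_log_poly : exists r : {poly S}, exp_poly \Po log_poly = 1 + 'X + r * 'X^(m.+1).
Proof.
set P := _ \Po _; pose Q := P - (1 + 'X).
have [l lE] := log_polyX; have [c ex'] := deriv_exp_poly.
have [r Hr] : exists r : {poly S}, (1 + 'X) * Q^`() = Q + r * 'X^m.
  exists (- (c%:P * l ^+ m) - (P - c%:P * log_poly ^+ m) * (- 1) ^+ m).
  have eP : (1 + 'X) * P^`() = (P - c%:P * log_poly ^+ m) * (1 - (- 'X) ^+ m).
    rewrite /P deriv_comp mulrCA deriv_log_poly // ex' comp_polyB comp_polyZ.
    by rewrite comp_Xn_poly mul_polyC.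
  rewrite /Q derivB derivD derivC derivX add0r mulrBr mulr1 eP {}/Q.
  rewrite [(- 'X) ^+ m]exprNn {1 2}lE exprMn.
  ring.
have [|q HQ] := euler_ode_eq0 _ Hr; last by exists q; rewrite -HQ /Q addrC subrK.
rewrite /Q coefB -horner_coef0 /P horner_comp lE !hornerE ?mulr0 horner_coef0.
by rewrite coef_poly /= fact0 invr1 coefD coef1 coefX addr0 subrr.
Qed.

Lemma mul_unit_low (u v : {poly S}) n :
  u`_0 = 1 -> (forall i, (i < n)%N -> (u * v)`_i = 0) ->
  forall i, (i < n)%N -> v`_i = 0.
Proof.
move=> u0 uv i; elim/ltn_ind: i => i IH im.
have := uv i im; rewrite coefM big_ord_recl u0 mul1r subn0 big1 ?addr0 // => j _.
have ji : (i - bump 0 j < i)%N.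
  by rewrite ltn_subrL /bump /= (leq_trans _ (ltn_ord j)).
by rewrite IH ?mulr0 // (ltn_trans ji).
Qed.

Lemma log_exp_poly :
  exists r : {poly S}, log_poly \Po (exp_poly - 1) = 'X + r * 'X^(m.+1).
Proof.
set P := _ \Po _; have [e eE] := exp_polyX; have [c ex'] := deriv_exp_poly.
have eP : exp_poly * P^`() = (1 - (- (exp_poly - 1)) ^+ m) * exp_poly^`().
  have -> : (1 - (- (exp_poly - 1)) ^+ m)
     = ((1 + 'X) * log_poly^`()) \Po (exp_poly - 1).
    rewrite deriv_log_poly // comp_polyB rmorphXn /= rmorphN /= comp_polyX.
    by rewrite -[1 \Po _]/(1%:P \Po _) comp_polyC.
  rewrite rmorphM /= comp_polyD comp_polyX -[1 \Po _]/(1%:P \Po _) comp_polyC.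
  by rewrite addrCA subrr addr0 /P deriv_comp derivB derivC subr0 mulrA.
have P1 i : (i < m)%N -> (P^`() - 1)`_i = 0.
  apply: (@mul_unit_low exp_poly); first by rewrite coef_poly /= fact0 invr1.
  move=> {}i im; rewrite mulrBr mulr1 eP ex' eE -mulNr exprMn -mul_polyC.
  rewrite (_ : _ - _ = (- c%:P - (- e) ^+ m * (exp_poly - c%:P * 'X^m)) * 'X^m);
    last ring.
  exact: coefMXn_low.
have [|q Hq] := @low_coefs0 _ m.+1 (P - 'X); last by exists q; rewrite -Hq addrC subrK.
move=> [|i] im.
  have [l lE] := log_polyX.
  by rewrite coefB coefX subr0 -horner_coef0 /P horner_comp lE eE !hornerE.
apply: (@mulSn_eq0 i); rewrite coefB coefX mulr_natr mulrnBl -[RHS](P1 i im).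
rewrite coefB coef_deriv coef1 eqSS; congr (_ - _).
by case: i im => [|i] _; rewrite ?mulr1n //= mul0rn.
Qed.

End TruncatedSeries.

Definition mexp (S : comUnitRingType) d (x : 'M[S]_d) : 'M[S]_d :=
  \sum_(n < d) (n`!%:R)^-1 *: x ^+ n.

Definition mlog (S : comUnitRingType) d (x : 'M[S]_d) : 'M[S]_d :=
  \sum_(1 <= n < d) ((-1) ^+ n.-1 / n%:R) *: (x - 1) ^+ n.

(** The filtration by superdiagonals: it is multiplicative and ends at [d],
    which is how all series become finite sums. *)
Definition band (S : nzRingType) d n (x : 'M[S]_d) : bool :=
  [forall i : 'I_d, forall j : 'I_d, (j < i + n)%N ==> (x i j == 0)].

Lemma bandP (S : nzRingType) d n (x : 'M[S]_d) :
  reflect (forall i j : 'I_d, (j < i + n)%N -> x i j = 0) (band n x).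
Proof.
apply: (iffP forallP) => [h i j ij|h i].
  by have /forallP/(_ j)/implyP/(_ ij)/eqP := h i.
by apply/forallP => j; apply/implyP => ij; rewrite h.
Qed.

Section Band.
Variables (S : comNzRingType) (m : nat).
Implicit Types x y : 'M[S]_m.+1.

Lemma band0 n : band n (0 : 'M[S]_m.+1).
Proof. by apply/bandP => i j _; rewrite mxE. Qed.

Lemma bandD n x y : band n x -> band n y -> band n (x + y).
Proof.
by move=> /bandP hx /bandP hy; apply/bandP => i j ij; rewrite mxE hx ?hy ?addr0.
Qed.

Lemma bandN n x : band n x -> band n (- x).
Proof. by move=> /bandP hx; apply/bandP => i j ij; rewrite mxE hx ?oppr0. Qed.

Lemma bandB n x y : band n x -> band n y -> band n (x - y).
Proof. by move=> hx hy; apply: bandD => //; apply: bandN. Qed.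

Lemma bandZ n a x : band n x -> band n (a *: x).
Proof. by move=> /bandP hx; apply/bandP => i j ij; rewrite mxE hx ?mulr0. Qed.

Lemma band_sum n I (r : seq I) (P : pred I) (F : I -> 'M[S]_m.+1) :
  (forall i, P i -> band n (F i)) -> band n (\sum_(i <- r | P i) F i).
Proof. by move=> h; elim/big_rec: _ => [|i x /h ? ?]; [apply: band0|apply: bandD]. Qed.

Lemma band_le n p x : (p <= n)%N -> band n x -> band p x.
Proof.
move=> pn /bandP hx; apply/bandP => i j ij.
by rewrite hx // (leq_trans ij) ?leq_add2l.
Qed.

Lemma bandM n p x y : band n x -> band p y -> band (n + p) (x * y).
Proof.
move=> /bandP hx /bandP hy; apply/bandP => i j ij; rewrite mxE big1 // => l _.
have [li|il] := ltnP l (i + n); first by rewrite hx ?mul0r.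
by rewrite hy ?mulr0 // (leq_trans ij) // addnA leq_add2r.
Qed.

Lemma band_mul1 n x y : band 1 x -> band n y -> band n (x * y).
Proof. by move=> hx hy; apply: band_le (bandM hx hy); rewrite leq_addl. Qed.

Lemma bandX x n : band 1 x -> band n (x ^+ n).
Proof.
move=> hx; elim: n => [|n IH]; last by rewrite exprS -[n.+1]add1n; apply: bandM.
by apply/bandP => i j; rewrite addn0 expr0 mxE => ij; case: eqP ij => // ->; rewrite ltnn.
Qed.

Lemma band_full n x : (m < n)%N -> band n x -> x = 0.
Proof.
move=> dn /bandP hx; apply/matrixP => i j; rewrite hx ?mxE //.
by rewrite (leq_trans (ltn_ord j)) // (leq_trans dn) ?leq_addl.
Qed.

(** The Cauchy product of two finite sums, all terms of weight beyond the size
    of the matrices being zero. *)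
Lemma cauchy_band (a b : nat -> 'M[S]_m.+1) :
  (forall i, band i (a i)) -> (forall i, band i (b i)) ->
  (\sum_(i < m.+1) a i) * (\sum_(j < m.+1) b j) =
  \sum_(n < m.+1) \sum_(i < n.+1) a i * b (n - i)%N.
Proof.
move=> ha hb; rewrite -!(big_mkord xpredT) mulr_suml.
have -> : \sum_(n < m.+1) \sum_(i < n.+1) a i * b (n - i)%N =
    \sum_(0 <= n < m.+1) \sum_(0 <= i < m.+1 | (i <= n)%N) a i * b (n - i)%N.
  rewrite big_mkord; apply: eq_bigr => n _.
  rewrite -(big_mkord xpredT (fun i => a i * b (n - i)%N)).
  rewrite [RHS](big_cat_nat (n := n.+1)) ?ltn_ord //= [X in _ = _ + X]big1_seq ?addr0.
    rewrite big_nat_cond [RHS]big_nat_cond; apply: eq_bigl => i.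
    by rewrite andbT andbC; case: ltnP => //; rewrite ltnS andbT => ->.
  by move=> i /andP[le]; rewrite mem_index_iota ltnNge le.
rewrite [RHS](exchange_big_dep xpredT) //=; apply: eq_big_nat => i /andP[_ im].
rewrite mulr_sumr (big_cat_nat (n := (m.+1 - i)%N)) ?leq_subr //=.
rewrite [X in _ + X]big1_seq ?addr0; last first.
  move=> j /andP[_]; rewrite mem_index_iota => /andP[ji _].
  by apply: (@band_full (i + j)); [rewrite -leq_subLR | apply: bandM].
rewrite [RHS](big_cat_nat (n := i)) ?(ltnW im) //= [X in _ = X + _]big1_seq ?add0r.
  rewrite -{3}[i]add0n [RHS]big_addn big_nat_cond [RHS]big_nat_cond.
  apply: eq_big => j; first by rewrite leq_addl.
  by rewrite addnK.
by move=> j /andP[ij]; rewrite mem_index_iota ltnNge ij.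
Qed.

End Band.

Section MatrixExpLog.
Variables (S : comUnitRingType) (m : nat).
Hypothesis QS : forall n, n.+1%:R \is a @GRing.unit S.
Implicit Types x y z w : 'M[S]_m.+1.

Lemma mexp_horner x : mexp x = horner_mx x (exp_poly S m).
Proof.
rewrite /exp_poly poly_def rmorph_sum; apply: eq_bigr => i _.
by rewrite /= horner_mxZ rmorphXn /= horner_mx_X.
Qed.

Lemma mlog_horner x : mlog x = horner_mx (x - 1) (log_poly S m).
Proof.
rewrite /log_poly rmorph_sum; apply: eq_bigr => i _.
by rewrite /= horner_mxZ rmorphXn /= horner_mx_X.
Qed.

Lemma horner_mx_comp x (p q : {poly S}) :
  horner_mx (horner_mx x q) p = horner_mx x (p \Po q).
Proof.
rewrite comp_polyE -[in LHS](coefK p) poly_def !rmorph_sum; apply: eq_bigr => i _.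
by rewrite /= !horner_mxZ !rmorphXn /= horner_mx_X.
Qed.

Lemma band1_nilp x : band 1 x -> x ^+ m.+1 = 0.
Proof. by move=> hx; apply: (@band_full _ _ m.+1) => //; apply: bandX. Qed.

Lemma mexp_mlog x : band 1 (x - 1) -> mexp (mlog x) = x.
Proof.
move=> hx; rewrite mexp_horner mlog_horner horner_mx_comp.
have [r ->] := exp_log_poly m QS.
rewrite !rmorphD rmorph1 /= rmorphM rmorphXn /= horner_mx_X band1_nilp //.
by rewrite mulr0 addr0 addrC subrK.
Qed.

Lemma mlog_mexp x : band 1 x -> mlog (mexp x) = x.
Proof.
move=> hx; rewrite mlog_horner mexp_horner -[1](rmorph1 (horner_mx x)) -rmorphB /=.
rewrite horner_mx_comp; have [r ->] := log_exp_poly m QS.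
by rewrite rmorphD rmorphM rmorphXn /= horner_mx_X band1_nilp // mulr0 addr0.
Qed.

Lemma band_mlog x : band 1 (x - 1) -> band 1 (mlog x).
Proof.
move=> hx; rewrite /mlog big_seq_cond; apply: band_sum => i.
rewrite mem_index_iota andbT => /andP[i0 _]; apply: bandZ.
exact: (band_le i0 (bandX _ hx)).
Qed.

Lemma mexp_rest x :
  mexp x = 1 + \sum_(i < m) (i.+1`!%:R)^-1 *: x ^+ i.+1.
Proof. by rewrite /mexp big_ord_recl fact0 invr1 scale1r expr0. Qed.

Lemma band_mexp x : band 1 x -> band 1 (mexp x - 1).
Proof.
move=> hx; rewrite mexp_rest addrC addKr; apply: band_sum => i _; apply: bandZ.
exact: (@band_le _ _ i.+1 1 _ isT (bandX _ hx)).
Qed.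

Lemma band_unip_mul x y : band 1 (x - 1) -> band 1 (y - 1) -> band 1 (x * y - 1).
Proof.
move=> hx hy; rewrite (_ : _ - 1 = (x - 1) * (y - 1) + (x - 1) + (y - 1)).
  by apply: bandD => //; apply: bandD => //; apply: band_mul1.
by rewrite mulrBl mul1r mulrBr mulr1 addrAC subrK addrA subrK.
Qed.

Lemma band_mlog_mul x y : band 1 x -> band 1 y -> band 1 (mlog (mexp x * mexp y)).
Proof. by move=> hx hy; apply/band_mlog/band_unip_mul; apply: band_mexp. Qed.

Lemma mexp_mlog_mul x y : band 1 x -> band 1 y ->
  mexp (mlog (mexp x * mexp y)) = mexp x * mexp y.
Proof. by move=> hx hy; apply/mexp_mlog/band_unip_mul; apply: band_mexp. Qed.

Lemma band_expterm x n : band 1 x -> band n ((n`!%:R)^-1 *: x ^+ n).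
Proof. by move=> hx; apply: bandZ; apply: bandX. Qed.

Lemma bin_fact_inv n i : (i <= n)%N ->
  (n`!%:R)^-1 * 'C(n, i)%:R = (i`!%:R)^-1 * ((n - i)`!%:R)^-1 :> S.
Proof.
move=> im; have F := fact_unit QS.
apply: (mulIr (F i)); apply: (mulIr (F (n - i)%N)).
rewrite -!mulrA -!natrM (bin_fact im) mulVr // natrM.
by rewrite [X in _ * X]mulrCA mulVr // mulr1 mulVr.
Qed.

Lemma mexpD x y : band 1 x -> band 1 y -> x * y = y * x ->
  mexp (x + y) = mexp x * mexp y.
Proof.
move=> hx hy cxy.
rewrite [RHS](cauchy_band (fun i => band_expterm i hx) (fun i => band_expterm i hy)).
apply: eq_bigr => n _; rewrite addrC exprDn_comm // scaler_sumr.
apply: eq_bigr => i _; rewrite -scaler_nat scalerA bin_fact_inv -1?ltnS //.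
have -> : y ^+ (n - i) * x ^+ i = x ^+ i * y ^+ (n - i).
  by apply: commrX; apply: commr_sym; apply: commrX.
by rewrite -scalerAl -scalerAr scalerA.
Qed.

Lemma mexp0 : mexp (0 : 'M[S]_m.+1) = 1.
Proof.
by rewrite mexp_rest big1 ?addr0 // => i _; rewrite exprS mul0r scaler0.
Qed.

Lemma mexpN x : band 1 x -> mexp x * mexp (- x) = 1.
Proof.
move=> hx; rewrite -mexpD ?subrr ?mexp0 //; first exact: bandN.
by rewrite mulrN mulNr.
Qed.

Lemma mexpI x y z : band 1 x -> mexp x * y = mexp x * z -> y = z.
Proof.
move=> hx; have e : mexp (- x) * mexp x = 1.
  by rewrite -[X in _ * mexp X]opprK mexpN //; apply: bandN.
by move=> /(congr1 ( *%R (mexp (- x)))); rewrite !mulrA e !mul1r.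
Qed.

Lemma mexp_unit x : band 1 x -> mexp x \in unitmx.
Proof. by move=> hx; case: (mulmx1_unit (mexpN hx)). Qed.

Definition ad z x := z * x - x * z.

Lemma adDr z x y : ad z (x + y) = ad z x + ad z y.
Proof. by rewrite /ad mulrDr mulrDl opprD addrACA. Qed.

Lemma adZr a z x : ad z (a *: x) = a *: ad z x.
Proof. by rewrite /ad -scalerAl -scalerAr scalerBr. Qed.

Lemma adZl a z x : ad (a *: z) x = a *: ad z x.
Proof. by rewrite /ad -scalerAl -scalerAr scalerBr. Qed.

Lemma ad_antisym x z : ad x z = - ad z x.
Proof. by rewrite /ad opprB. Qed.

Lemma ad0r z : ad z 0 = 0.
Proof. by rewrite /ad mulr0 mul0r subrr. Qed.

Lemma band_ad n z x : band 1 z -> band n x -> band n.+1 (ad z x).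
Proof.
move=> hz hx; apply: bandB; first exact: (bandM hz hx).
by have := bandM hx hz; rewrite addn1.
Qed.

Lemma band_iter_ad n z x i : band 1 z -> band n x -> band (i + n) (iter i (ad z) x).
Proof. by move=> hz hx; elim: i => //= i IH; apply: band_ad. Qed.

(** Moving one factor [z] from the right of the iterated brackets to their left
    follows the rule of Pascal's triangle, here with coefficients [c]. *)
Lemma ad_pascal z x n (c : nat -> nat) : c n.+2 = 0 ->
  (c 0)%:R *: (z ^+ n.+1 * x) +
  (\sum_(a < n.+1) ((-1) ^+ a * (c a.+1)%:R) *: (z ^+ (n - a) * iter a (ad z) x)) * z
  = \sum_(a < n.+2) ((-1) ^+ a * (c a.+1 + c a)%:R) *:
       (z ^+ (n.+1 - a) * iter a (ad z) x).
Proof.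
have step a X : (z ^+ a * X) * z = z ^+ a.+1 * X - z ^+ a * ad z X.
  by rewrite /ad mulrBr !mulrA -exprSr opprB addrC subrK.
move=> cn; pose s a : S := (-1) ^+ a; pose Z a := z ^+ (n.+1 - a) * iter a (ad z) x.
have -> : \sum_(a < n.+2) (s a * (c a.+1 + c a)%:R) *: Z a =
    \sum_(a < n.+1) (s a * (c a.+1)%:R) *: Z a + \sum_(a < n.+2) (s a * (c a)%:R) *: Z a.
  rewrite [X in _ = X + _](_ : _ = \sum_(a < n.+2) (s a * (c a.+1)%:R) *: Z a).
    by rewrite -big_split; apply: eq_bigr => a _; rewrite natrD mulrDr scalerDl.
  by rewrite [RHS]big_ord_recr /= cn mulr0 scale0r addr0.
rewrite [X in _ = _ + X]big_ord_recl /= [s 0]expr0 mul1r [in RHS]addrCA.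
congr (_ + _); rewrite mulr_suml -big_split; apply: eq_bigr => a _ /=.
rewrite -scalerAl step /Z /s /bump leq0n add1n subSn -1?ltnS // subSS scalerBr.
by rewrite [(-1) ^+ a.+1]exprS mulN1r mulNr scaleNr.
Qed.

(** By induction on [n], each step being an instance of Pascal's rule. *)
Lemma mul_expr_ad x z n :
  x * z ^+ n = \sum_(a < n.+1) ((-1) ^+ a * 'C(n, a)%:R) *:
                  (z ^+ (n - a) * iter a (ad z) x).
Proof.
elim: n => [|n IH].
  by rewrite big_ord_recl big_ord0 addr0 /= subnn !expr0 bin0 !mul1r scale1r mulr1.
have := @ad_pascal z x n (fun a => if a is a'.+1 then 'C(n, a') else 0).
rewrite scale0r add0r bin_small // => /(_ erefl); rewrite -IH -mulrA -exprSr => ->.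
apply: eq_bigr => a _; congr (_ * _%:R *: _).
by case: (val a) => [|b]; rewrite ?bin0 ?addn0 // binS.
Qed.

(** Dividing the commutation rule of [x] and [z ^+ n] by [n!] turns the binomial
    coefficient into a product of inverse factorials, and the sum over [n] into a
    Cauchy product. *)
Lemma mul_mexp_ad x z : band 1 x -> band 1 z ->
  x * mexp z =
  mexp z * \sum_(a < m.+1) ((-1) ^+ a * (a`!%:R)^-1) *: iter a (ad z) x.
Proof.
move=> hx hz; have hb a : band a (((-1) ^+ a * (a`!%:R)^-1) *: iter a (ad z) x).
  by apply: bandZ; apply: band_le (band_iter_ad a hz hx); rewrite leq_addr.
rewrite [RHS](cauchy_band (fun i => band_expterm i hz) hb) mulr_sumr.
apply: eq_bigr => n _; rewrite -scalerAr mul_expr_ad scaler_sumr.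
rewrite [RHS](reindex_inj rev_ord_inj); apply: eq_bigr => a _ /=.
rewrite subSS subKn -1?ltnS // -scalerAl -scalerAr !scalerA mulrCA.
by rewrite bin_fact_inv -1?ltnS // [in RHS]mulrCA [X in _ = (_ * X) *: _]mulrC.
Qed.

Section Derivation.
Variable D : {additive 'M[S]_m.+1 -> 'M[S]_m.+1}.
Hypothesis DM : forall x y, D (x * y) = D x * y + x * D y.

Lemma derivation_expr z n :
  D (z ^+ n.+1) = \sum_(a < n.+1) ((-1) ^+ a * 'C(n.+1, a.+1)%:R) *:
                  (z ^+ (n - a) * iter a (ad z) (D z)).
Proof.
elim: n => [|n IH].
  by rewrite big_ord_recl big_ord0 addr0 /= subnn !expr0 bin1 !mul1r scale1r expr1.
rewrite exprSr DM IH addrC.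
have := @ad_pascal z (D z) n (fun a => 'C(n.+1, a)).
rewrite bin_small // bin0 scale1r => /(_ erefl) ->.
by apply: eq_bigr => a _; rewrite -binS.
Qed.

Lemma derivation_divfact n x : D ((n`!%:R)^-1 *: x) = (n`!%:R)^-1 *: D x.
Proof.
have F := fact_unit QS n.
have -> : D x = n`!%:R *: D ((n`!%:R)^-1 *: x).
  by rewrite scaler_nat -raddfMn -scaler_nat scalerA divrr // scale1r.
by rewrite scalerA mulVr // scale1r.
Qed.

(** By the same Cauchy product as for [mul_mexp_ad], now for [D (z ^+ n)].  The
    second factor is [(1 - exp (- ad z)) / ad z] applied to [D z]. *)
Lemma derivation_mexp z : band 1 z -> band 1 (D z) ->
  D (mexp z) =
  mexp z * \sum_(a < m.+1) ((-1) ^+ a * (a.+1`!%:R)^-1) *: iter a (ad z) (D z).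
Proof.
move=> hz hD.
have hb a : band a.+1 (((-1) ^+ a * (a.+1`!%:R)^-1) *: iter a (ad z) (D z)).
  by apply: bandZ; have := band_iter_ad a hz hD; rewrite addn1.
have hb' a := band_le (leqnSn a) (hb a).
rewrite [RHS](cauchy_band (fun i => band_expterm i hz) hb').
have D1 : D 1 = 0.
  by apply: (addrI (D 1)); rewrite addr0 -[in RHS](mul1r 1) DM mulr1 mul1r.
rewrite /mexp raddf_sum /= big_ord_recl fact0 invr1 scale1r expr0 D1 add0r.
rewrite [RHS]big_ord_recr /= [X in _ = _ + X]big1 ?addr0; last first.
  move=> i _; apply: (@band_full _ _ (i + (m - i).+1)).
    by rewrite addnS subnKC -1?ltnS.
  by apply: bandM => //; apply: band_expterm.
apply: eq_bigr => n _ /=; rewrite derivation_divfact derivation_expr scaler_sumr.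
rewrite [RHS](reindex_inj rev_ord_inj); apply: eq_bigr => a _ /=.
rewrite subSS subKn -1?ltnS // -scalerAl -scalerAr !scalerA mulrCA.
rewrite bin_fact_inv ?ltn_ord // subSS.
by rewrite [in RHS]mulrCA [X in _ = (_ * X) *: _]mulrC.
Qed.

End Derivation.

End MatrixExpLog.

Section Base.
Variables (S S' : comUnitRingType) (f : {rmorphism S -> S'}) (m : nat).
Hypothesis QS : forall n, n.+1%:R \is a @GRing.unit S.
Implicit Types x : 'M[S]_m.+1.

Lemma map_mexp x : map_mx f (mexp x) = mexp (map_mx f x).
Proof.
rewrite /mexp raddf_sum; apply: eq_bigr => i _ /=.
by rewrite map_mxZ rmorphXn rmorphV ?rmorph_nat // fact_unit.
Qed.

Lemma map_mlog x : map_mx f (mlog x) = mlog (map_mx f x).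
Proof.
rewrite /mlog raddf_sum [LHS]big_seq_cond [RHS]big_seq_cond.
apply: eq_bigr => -[|i] /=; first by rewrite mem_index_iota.
move=> _; rewrite map_mxZ rmorphM rmorphXn rmorphXn rmorphN1 /=.
by rewrite rmorphV ?rmorph_nat // rmorphB rmorph1.
Qed.

End Base.

(** * The Campbell-Hausdorff theorem for nilpotent matrices *)

Section CampbellHausdorff.
Variables (F : fieldType) (m : nat).
Hypothesis char0 : forall n, n.+1%:R != 0 :> F.
Variable g : set 'M[F]_m.+1.
Hypotheses (g_lie : lie_subalgebra g) (g_band : forall x, g x -> band 1 x).
Local Notation P := {poly F}.

Lemma lie0 : g 0. Proof. by case: g_lie. Qed.
Lemma lieZ a x : g x -> g (a *: x).
Proof. by case: g_lie => g0 gL _ gx; rewrite -[_ *: _]addr0; apply: gL. Qed.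
Lemma lieD x y : g x -> g y -> g (x + y).
Proof. by case: g_lie => g0 gL _ gx gy; rewrite -[x]scale1r; apply: gL. Qed.
Lemma lieN x : g x -> g (- x).
Proof. by move=> gx; rewrite -scaleN1r; apply: lieZ. Qed.
Lemma lie_ad x y : g x -> g y -> g (ad x y).
Proof. by case: g_lie => _ _; apply. Qed.
Lemma lie_sum I (r : seq I) (p : pred I) (f : I -> 'M[F]_m.+1) :
  (forall i, p i -> g (f i)) -> g (\sum_(i <- r | p i) f i).
Proof. by move=> h; elim/big_rec: _ => [|i x /h ? ?]; [apply: lie0|apply: lieD]. Qed.

Lemma char0_unit n : n.+1%:R \is a @GRing.unit F.
Proof. by rewrite unitfE char0. Qed.

Lemma char0_poly_unit n : n.+1%:R \is a @GRing.unit {poly F}.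
Proof. by rewrite -polyC_natr rmorph_unit ?char0_unit. Qed.

Definition coefmx j (z : 'M[P]_m.+1) : 'M[F]_m.+1 := map_mx (coefp j) z.

Lemma coefmxM j z w :
  coefmx j (z * w) = \sum_(i < j.+1) coefmx i z * coefmx (j - i) w.
Proof.
apply/matrixP => a b; rewrite !mxE summxE /coefp coef_sum.
under [RHS]eq_bigr do rewrite !mxE.
rewrite exchange_big; apply: eq_bigr => c _; rewrite coefM.
by apply: eq_bigr => i _; rewrite !mxE.
Qed.

Lemma coefmx_ad j z w :
  coefmx j (ad z w) = \sum_(i < j.+1) ad (coefmx i z) (coefmx (j - i) w).
Proof.
rewrite /ad sumrB -coefmxM [coefmx j _]raddfB /=; congr (_ - _).
rewrite -/(coefmx j _) coefmxM (reindex_inj rev_ord_inj); apply: eq_bigr => i _ /=.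
by rewrite subSS subKn // -ltnS.
Qed.

(** Congruence modulo ['X^n] to an element of the Lie algebra [g[X]]. *)
Definition lie_upto n z := forall j, (j < n)%N -> g (coefmx j z).

Lemma lie_uptoD n z w : lie_upto n z -> lie_upto n w -> lie_upto n (z + w).
Proof. by move=> hz hw j jn; rewrite /coefmx raddfD; apply: lieD; [apply: hz|apply: hw]. Qed.

Lemma lie_uptoN n z : lie_upto n z -> lie_upto n (- z).
Proof. by move=> hz j jn; rewrite /coefmx raddfN; apply: lieN; apply: hz. Qed.

Lemma lie_uptoZ n c z : lie_upto n z -> lie_upto n (c%:P *: z).
Proof.
move=> hz j jn; rewrite (_ : coefmx _ _ = c *: coefmx j z); first exact/lieZ/hz.
by apply/matrixP => a b; rewrite !mxE /coefp coefCM.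
Qed.

Lemma lie_upto_sum n I (r : seq I) (p : pred I) (f : I -> 'M[P]_m.+1) :
  (forall i, p i -> lie_upto n (f i)) -> lie_upto n (\sum_(i <- r | p i) f i).
Proof.
by move=> h j jn; rewrite /coefmx raddf_sum; apply: lie_sum => i /h; apply.
Qed.

Lemma lie_upto_ad n z w : lie_upto n z -> lie_upto n w -> lie_upto n (ad z w).
Proof.
move=> hz hw j jn; rewrite coefmx_ad; apply: lie_sum => i _; apply: lie_ad.
  by apply: hz; rewrite (leq_ltn_trans _ jn) // -ltnS.
by apply: hw; rewrite (leq_ltn_trans _ jn) // leq_subr.
Qed.

(** A bracket with an element divisible by ['X] gains one order. This is what
    makes the induction in [campbell_hausdorff] progress. *)
Lemma lie_upto_adS n z w :
  coefmx 0 z = 0 -> lie_upto n.+1 z -> lie_upto n w -> lie_upto n.+1 (ad z w).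
Proof.
move=> z0 hz hw j jn; rewrite coefmx_ad; apply: lie_sum => -[[|i] /= ij] _.
  by rewrite z0 /ad mul0r mulr0 subrr; apply: lie0.
apply: lie_ad; first by apply: hz; rewrite (leq_ltn_trans _ jn) // -ltnS.
apply: hw; rewrite -(ltn_add2l i.+1) subnKC // addSn.
by rewrite (leq_trans jn) // ltnS leq_addl.
Qed.

Lemma lie_upto_coef n (c : F) (s : P) z :
  s = c%:P -> lie_upto n z -> lie_upto n (s *: z).
Proof. by move=> ->; apply: lie_uptoZ. Qed.

Lemma sign_fact_polyC a p : (-1) ^+ a * (p`!%:R)^-1 = ((-1) ^+ a * (p`!%:R)^-1)%:P :> P.
Proof. by rewrite rmorphM rmorphXn rmorphN1 /= fmorphV rmorph_nat. Qed.

Local Notation derivmx := (map_mx (@deriv F)).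

Lemma derivmxM (z w : 'M[P]_m.+1) : derivmx (z * w) = derivmx z * w + z * derivmx w.
Proof.
apply/matrixP => a b; rewrite !mxE raddf_sum -big_split /=.
by apply: eq_bigr => i _; rewrite !mxE derivM.
Qed.

Lemma band_map n (S S' : comNzRingType) (f : {additive S -> S'}) (x : 'M[S]_m.+1) :
  band n x -> band n (map_mx f x).
Proof. by move=> /bandP h; apply/bandP => i j ij; rewrite mxE h // raddf0. Qed.

Lemma coefmx_deriv j z : coefmx j (derivmx z) = j.+1%:R *: coefmx j.+1 z.
Proof. by apply/matrixP => a b; rewrite !mxE /coefp coef_deriv mulr_natl. Qed.

(** Evaluation of a matrix of polynomials at [t]. *)
Definition hornmx (t : F) (z : 'M[P]_m.+1) : 'M[F]_m.+1 := map_mx (horner_eval t) z.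

Lemma hornmx0 z : hornmx 0 z = coefmx 0 z.
Proof. by apply/matrixP => a b; rewrite !mxE /horner_eval horner_coef0. Qed.

Lemma hornmx_sum t z : exists N, hornmx t z = \sum_(j < N) t ^+ j *: coefmx j z.
Proof.
exists (\max_(ab : 'I_m.+1 * 'I_m.+1) size (z ab.1 ab.2)).
apply/matrixP => a b; rewrite !mxE summxE /horner_eval.
rewrite (@horner_coef_wide _ (\max_(ab : 'I_m.+1 * 'I_m.+1) size (z ab.1 ab.2))).
  by apply: eq_bigr => j _; rewrite !mxE mulrC.
exact: (leq_bigmax (a, b)).
Qed.

Lemma lie_hornmx t z : (forall j, g (coefmx j z)) -> g (hornmx t z).
Proof.
by move=> hz; have [N ->] := hornmx_sum t z; apply: lie_sum => i _; apply: lieZ.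
Qed.

Lemma lie_upto_const n (x : 'M[F]_m.+1) : g x -> lie_upto n (map_mx polyC x).
Proof.
move=> gx [|j] _.
  by rewrite (_ : coefmx 0 _ = x) //; apply/matrixP => a b; rewrite !mxE /coefp coefC.
rewrite (_ : coefmx _ _ = 0); first exact: lie0.
by apply/matrixP => a b; rewrite !mxE /coefp coefC.
Qed.

Lemma lie_upto_X n (x : 'M[F]_m.+1) : g x -> lie_upto n ('X *: map_mx polyC x).
Proof.
move=> gx [|j] jn.
  rewrite (_ : coefmx 0 _ = 0); first exact: lie0.
  by apply/matrixP => a b; rewrite !mxE /coefp coefXM.
rewrite (_ : coefmx _ _ = coefmx j (map_mx polyC x)).
  exact: (lie_upto_const gx (ltnSn j)).
by apply/matrixP => a b; rewrite !mxE /coefp coefXM.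
Qed.

Lemma hornmx_X t (x : 'M[F]_m.+1) : hornmx t ('X *: map_mx polyC x) = t *: x.
Proof.
by apply/matrixP => a b; rewrite !mxE /horner_eval hornerM hornerX hornerC.
Qed.

Lemma band_X n (x : 'M[P]_m.+1) : band n x -> band n ('X *: x).
Proof. by move=> /bandP h; apply/bandP => a b ab; rewrite mxE h ?mulr0. Qed.

Lemma derivmx_X (x : 'M[F]_m.+1) : derivmx ('X *: map_mx polyC x) = map_mx polyC x.
Proof.
apply/matrixP => a b; rewrite !mxE derivM derivX derivC mulr0 addr0 mul1r //.
Qed.

Lemma lie_upto_iter_ad n z w i :
  lie_upto n z -> lie_upto n w -> lie_upto n (iter i (ad z) w).
Proof. by move=> hz hw; elim: i => //= i IH; apply: lie_upto_ad. Qed.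

(** The logarithm [z] of [exp (t x) exp (t y)] satisfies a differential equation
    which expresses each coefficient of [z] in [t] by brackets of earlier ones
    with [x] and [y]. *)
Theorem campbell_hausdorff x y : g x -> g y ->
  exists V : 'M[P]_m.+1, [/\ forall j, g (coefmx j V), coefmx 0 V = x + y
    & forall t, mexp (t *: x) * mexp (t *: y) = mexp (t *: hornmx t V)].
Proof.
move=> gx gy; have QF := char0_unit; have QP := char0_poly_unit.
pose X : 'M[P]_m.+1 := map_mx polyC x; pose Y : 'M[P]_m.+1 := map_mx polyC y.
have bX : band 1 X by apply: band_map; apply: g_band.
have bY : band 1 Y by apply: band_map; apply: g_band.
pose e1 := mexp ('X *: X); pose e2 := mexp ('X *: Y); pose h := e1 * e2.
have btX : band 1 ('X *: X) by apply: band_X.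
have btY : band 1 ('X *: Y) by apply: band_X.
pose z := mlog h; have bz : band 1 z := band_mlog_mul btX btY.
have zh : mexp z = h := mexp_mlog_mul QP btX btY.
have horn_h t : hornmx t h = mexp (t *: x) * mexp (t *: y).
  by rewrite /hornmx rmorphM /= !map_mexp // -!/(hornmx _ _) !hornmx_X.
have z0 : coefmx 0 z = 0.
  rewrite -hornmx0 /hornmx map_mlog // -/(hornmx _ _) horn_h !scale0r mexp0 // mulr1.
  by rewrite -[1]mexp0 // mlog_mexp // band0.
clearbody z; have ad0' (u : 'M[P]_m.+1) : ad u 0 = 0 by rewrite /ad mulr0 mul0r subrr.
have adX0 (w : 'M[P]_m.+1) j : iter j.+1 (ad ('X *: w)) w = 0.
  elim: j => [|j /= ->]; last exact: ad0'.
  by rewrite /= /ad -scalerAl -scalerAr subrr.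
have dexp (w : 'M[F]_m.+1) : band 1 (map_mx polyC w : 'M[P]_m.+1) ->
    derivmx (mexp ('X *: map_mx polyC w)) =
    mexp ('X *: map_mx polyC w) * map_mx polyC w.
  move=> bw; have bd : band 1 (derivmx ('X *: map_mx polyC w)) by rewrite derivmx_X.
  have := derivation_mexp QP derivmxM (band_X bw) bd; rewrite /= derivmx_X => ->.
  congr (_ * _); rewrite big_ord_recl /= expr0 invr1 mulr1 scale1r big1 ?addr0 //.
  by move=> i _; rewrite [X in _ *: X](adX0 _ i) scaler0.
have dh : derivmx h = h * ((\sum_(a < m.+1)
    ((-1) ^+ a * (a`!%:R)^-1) *: iter a (ad ('X *: Y)) X) + Y).
  have d1 : derivmx e1 = e1 * X := dexp x bX.
  have d2 : derivmx e2 = e2 * Y := dexp y bY.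
  have c12 := mul_mexp_ad QP bX btY; rewrite -/e2 in c12.
  rewrite [LHS]derivmxM d1 d2.
  rewrite -[e1 * X * e2]mulrA c12.
  rewrite /h.
  rewrite mulrDr.
  rewrite !mulrA.
  by [].
have dz : band 1 (derivmx z) by apply: band_map.
have ode : derivmx z = (\sum_(a < m.+1)
      ((-1) ^+ a * (a`!%:R)^-1) *: iter a (ad ('X *: Y)) X) + Y -
    \sum_(a < m) ((-1) ^+ a.+1 * (a.+2`!%:R)^-1) *: iter a.+1 (ad z) (derivmx z).
  have : derivmx (mexp z) = mexp z * _ := derivation_mexp QP derivmxM bz dz.
  rewrite {1}zh dh -zh => /(mexpI QP bz) ->.
  by rewrite big_ord_recl expr0 invr1 mulr1 scale1r addrK.
have low n : lie_upto n.+1 z.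
  elim: n => [|n IH]; first by case=> // _; rewrite z0; apply: lie0.
  have ldz0 : lie_upto n (derivmx z).
    by move=> j jn; rewrite coefmx_deriv; apply: lieZ; apply: IH.
  have ldz : lie_upto n.+1 (derivmx z).
    rewrite ode; apply: lie_uptoD; first apply: lie_uptoD.
    - apply: lie_upto_sum => a _; apply: lie_upto_coef (sign_fact_polyC _ _) _.
      by apply: lie_upto_iter_ad; [apply: lie_upto_X|apply: lie_upto_const].
    - exact: lie_upto_const.
    - apply: lie_uptoN; apply: lie_upto_sum => a _.
      apply: lie_upto_coef (sign_fact_polyC _ _) _.
      by elim: (val a) => [|b IHb] /=; apply: lie_upto_adS => // j jn; apply: IHb; rewrite ltnW.
  case=> [|j] jn; first by rewrite z0; apply: lie0.
  rewrite -[coefmx _ _]scale1r -(mulVf (char0 j)) -scalerA -coefmx_deriv.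
  by apply: lieZ; apply: ldz.
pose V : 'M[P]_m.+1 := map_mx (drop_poly 1) z.
have cV j : coefmx j V = coefmx j.+1 z.
  by apply/matrixP => a b; rewrite !mxE /coefp coef_drop_poly addn1.
exists V; split.
- by move=> j; rewrite cV; apply: (low j.+1).
- have : coefmx 0 (derivmx z) = x + y.
    have c0 (u v : 'M[P]_m.+1) : coefmx 0 u = 0 -> coefmx 0 (ad u v) = 0.
      by move=> u0; rewrite coefmx_ad big_ord_recl big_ord0 u0 addr0 /ad mul0r mulr0 subrr.
    have cz (s : P) (u : 'M[P]_m.+1) : coefmx 0 u = 0 -> coefmx 0 (s *: u) = 0.
      rewrite -!hornmx0 /hornmx map_mxZ => ->; exact: scaler0.
    have tY0 : coefmx 0 ('X *: Y) = 0 by rewrite -hornmx0 hornmx_X scale0r.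
    have cC (w : 'M[F]_m.+1) : coefmx 0 (map_mx polyC w : 'M[P]_m.+1) = w.
      by apply/matrixP => a b; rewrite !mxE /coefp coefC.
    rewrite ode /coefmx raddfB raddfD !raddf_sum /= -/(coefmx 0 Y) cC.
    rewrite [\sum_(i < m) _]big1 ?addr0; last first.
      by move=> a _; rewrite [X in - X](cz _ _ (c0 _ _ z0)) oppr0.
    rewrite big_ord_recl big1 ?addr0; last first.
      by move=> a _; exact: (cz _ _ (c0 _ _ tY0)).
    by rewrite expr0 fact0 invr1 mulr1 scale1r -/(coefmx 0 X) cC.
  by rewrite coefmx_deriv scale1r -cV.
- move=> t; rewrite -horn_h -zh /hornmx map_mexp //; congr mexp.
  have -> : z = 'X *: V.
    apply/matrixP => a b; rewrite !mxE; apply/polyP => -[|i].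
      rewrite coefXM; have /matrixP/(_ a b) := z0.
      by rewrite !mxE /coefp.
    by rewrite coefXM coef_drop_poly addn1.
  by apply/matrixP => a b; rewrite !mxE rmorphM /= {1}/horner_eval hornerX.
Qed.

End CampbellHausdorff.

(** * Rational functions and the shift *)

Section FractionMorphism.
Variable k : fieldType.

Lemma fracP_zmod_morphism : zmod_morphism (@fracP k).
Proof. exact: rmorphB. Qed.

Lemma fracP_monoid_morphism : monoid_morphism (@fracP k).
Proof. by split; [exact: rmorph1 | exact: rmorphM]. Qed.

HB.instance Definition _ :=
  GRing.isZmodMorphism.Build {poly k} (ratfun k) (@fracP k) fracP_zmod_morphism.
HB.instance Definition _ :=
  GRing.isMonoidMorphism.Build {poly k} (ratfun k) (@fracP k) fracP_monoid_morphism.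

Lemma fracP_inj : injective (@fracP k).
Proof. by move=> p q /eqP; rewrite /fracP tofrac_eq => /eqP. Qed.

Lemma ratC_zmod_morphism : zmod_morphism (@ratC k).
Proof. by move=> a b; rewrite /ratC !rmorphB. Qed.

Lemma ratC_monoid_morphism : monoid_morphism (@ratC k).
Proof. by split=> [|a b]; rewrite /ratC ?rmorph1 // !rmorphM. Qed.

HB.instance Definition _ :=
  GRing.isZmodMorphism.Build k (ratfun k) (@ratC k) ratC_zmod_morphism.
HB.instance Definition _ :=
  GRing.isMonoidMorphism.Build k (ratfun k) (@ratC k) ratC_monoid_morphism.

End FractionMorphism.

Section RationalShift.
Variable k : closedFieldType.
Hypothesis char0 : [pchar k] =i pred0.
Local Notation K := (ratfun k).

Lemma natS_neq0 n : n.+1%:R != 0 :> k.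
Proof. by rewrite ((pcharf0P k).1 char0). Qed.

Lemma ratnatS_neq0 n : n.+1%:R != 0 :> K.
Proof. by rewrite -(rmorph_nat (@ratC k)) fmorph_eq0 natS_neq0. Qed.

Lemma poly_many_roots (F : fieldType) (u : nat -> F) (p : {poly F}) :
  injective u -> (forall n, p.[u n] = 0) -> p = 0.
Proof.
move=> ui pu; apply/eqP/negPn/negP => p0.
suff: (size [seq u n | n <- iota 0 (size p)] < size p)%N.
  by rewrite size_map size_iota ltnn.
apply: max_poly_roots => //; last by rewrite map_inj_uniq // iota_uniq.
by apply/allP => _ /mapP[n _ ->]; apply/rootP.
Qed.

Lemma nat_inj (F : fieldType) : (forall n, n.+1%:R != 0 :> F) ->
  injective (fun n => n%:R : F).
Proof.
move=> F0 a b; wlog ab : a b / (a <= b)%N.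
  by move=> H e; case/orP: (leq_total a b) => ?; [|symmetry]; apply: H.
move=> /eqP; rewrite eq_sym -subr_eq0 -natrB //; case E: (b - a)%N => [|n].
  by move=> _; apply/eqP; rewrite eqn_leq ab -subn_eq0 E.
by rewrite (negbTE (F0 n)).
Qed.

Lemma horner_shiftp (p : {poly k}) x : (shiftp p).[x] = p.[x + 1].
Proof. by rewrite /shiftp horner_comp !hornerE. Qed.

Lemma clear_denominators (F : fieldType) (a b a' b' c w : F) :
  b != 0 -> b' != 0 -> w != 0 -> a' / b' - a / b = c / w ->
  (a' * b - a * b') * w = c * (b * b').
Proof.
move=> b0 b'0 w0 e; transitivity ((a' / b' - a / b) * (b * b' * w)).
  by field; rewrite b0.
by rewrite e; field.
Qed.

Lemma expfV_sub (F : fieldType) (x : F) i N :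
  x != 0 -> (i <= N)%N -> x^-1 ^+ i = x ^+ (N - i) / x ^+ N.
Proof.
move=> x0 iN; apply/(canRL (mulfK _)); first exact: expf_neq0.
by rewrite -[in X in _ * X = _](subnKC iN) exprD exprVn mulKf // expf_neq0.
Qed.

(** A pole of [a] propagates along integer translates until it meets the only
    pole [-1] of [shift a - a]; as that can happen on one side only, the poles
    of [a] would form an infinite set. *)
Lemma shift_sub_poly (a : K) (r : {poly k}) n :
  shift a - a = fracP r / (ratX k + 1) ^+ n -> exists p, a = fracP p.
Proof.
set w : {poly k} := ('X + 1) ^+ n.
have -> : (ratX k + 1) ^+ n = fracP w by rewrite rmorphXn rmorphD rmorph1.
have [p [q [cpq q0 ->]]] : exists p q : {poly k},
    [/\ coprimep p q, q != 0 & a = fracP p / fracP q].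
  have d0 : \d_(repr a) != 0 by exact: denom_ratioP.
  set N := \n_(repr a); set d := \d_(repr a) in d0 *.
  have g0 : gcdp N d != 0 by rewrite gcdp_eq0 negb_and d0 orbT.
  exists (N %/ gcdp N d), (d %/ gcdp N d); split.
  - by rewrite coprimep_div_gcd // d0 orbT.
  - by rewrite dvdp_div_eq0 ?dvdp_gcdr.
  - have eN := esym (divpK (dvdp_gcdl N d)); have ed := esym (divpK (dvdp_gcdr N d)).
    have : d %/ gcdp N d != 0 by rewrite dvdp_div_eq0 ?dvdp_gcdr.
    move: eN ed; set N1 := N %/ _; set d1 := d %/ _ => eN ed d10.
    rewrite [LHS]fracP_repr -/N -/d; apply/eqP.
    rewrite eqr_div ?fracP_eq0 // -!fracPM {1}eN {2}ed.
    by rewrite mulrAC mulrA.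
rewrite shift_div // => e.
have q'0 : shiftp q != 0 by rewrite shiftp_eq0.
have w0 : w != 0 by rewrite expf_neq0 // -size_poly_eq0 size_XaddC.
have {}e : (shiftp p * q - p * shiftp q) * w = r * (q * shiftp q).
  have f0 (u : {poly k}) : u != 0 -> fracP u != 0 by rewrite fracP_eq0.
  apply: fracP_inj; rewrite !(rmorphM, rmorphB) /=.
  exact: (clear_denominators (f0 _ q0) (f0 _ q'0) (f0 _ w0) e).
have wx x : x != -1 -> w.[x] != 0.
  by move=> x1; rewrite horner_exp !hornerE expf_neq0 // addr_eq0.
have p0 x : root q x -> p.[x] != 0.
  by move=> qx; rewrite -rootE (coprimep_root _ qx) // coprimep_sym.
have up x : root q x -> x != -1 -> root q (x + 1).
  move=> qx x1; move/(congr1 (fun u => u.[x])): e.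
  rewrite !hornerM hornerD hornerN !hornerM (rootP qx) !mulr0 sub0r mul0r mulr0.
  move/eqP; rewrite mulf_eq0 (negbTE (wx _ x1)) orbF oppr_eq0 mulf_eq0.
  by rewrite (negbTE (p0 _ qx)) horner_shiftp.
have down x : root q (x + 1) -> x != -1 -> root q x.
  move=> qx x1; move/(congr1 (fun u => u.[x])): e.
  rewrite !hornerM hornerD hornerN !hornerM !horner_shiftp (rootP qx) !mulr0 subr0.
  move/eqP; rewrite !mulf_eq0 (negbTE (wx _ x1)) orbF.
  by rewrite (negbTE (p0 _ qx)).
have [|q1] := boolP (size q == 1).
  move/size_poly1P => [c c0 ->]; exists (c^-1 *: p).
  apply/(canLR (mulfK _)); first by rewrite fracP_eq0 polyC_eq0.
  by rewrite -[RHS]fracPM [_ * c%:P]mulrC mul_polyC scalerA divff // scale1r.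
have [x qx] := closed_rootP _ q1; exfalso; move/eqP: q0; apply.
have natI := nat_inj natS_neq0.
have [[n0 x0]|nx] := pselect (exists n0 : nat, x = -1 - n0%:R).
  apply: (@poly_many_roots _ (fun i => x - i%:R)).
    by move=> i j /addrI/oppr_inj/natI.
  elim=> [|i IH]; first by rewrite subr0; apply/rootP.
  apply/rootP/down; first by rewrite -natr1 opprD addrA subrK; apply/rootP.
  rewrite x0 -addrA -opprD -natrD addnS -[X in _ != X]addr0.
  by rewrite (inj_eq (addrI _)) oppr_eq0; exact: natS_neq0.
apply: (@poly_many_roots _ (fun i => x + i%:R)); first by move=> i j /addrI/natI.
elim=> [|i IH]; first by rewrite addr0; apply/rootP.
apply/rootP; rewrite -natr1 addrA; apply: up; first exact/rootP.
by apply/eqP => xi; apply: nx; exists i; rewrite -xi addrK.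
Qed.

(** An invariant rational function has no poles, and an invariant polynomial
    takes the value [p.[0]] at every natural number. *)
Lemma shift_fixed (a : K) : shift a = a -> exists c, a = ratC c.
Proof.
move=> ea; have [|p ap] := @shift_sub_poly a 0 0.
  by rewrite ea subrr rmorph0 mul0r.
exists p.[0]; rewrite ap /ratC; congr (fracP _); apply/eqP; rewrite -subr_eq0.
apply/eqP/(poly_many_roots (nat_inj natS_neq0)) => n.
rewrite hornerD hornerN hornerC; apply/eqP; rewrite subr_eq0; apply/eqP.
have ep : shiftp p = p by apply: fracP_inj; rewrite -shift_fracP -ap.
by elim: n => [|n IH] //; rewrite -natr1 -horner_shiftp ep.
Qed.

Definition tinv : K := (ratX k + 1)^-1.

Lemma ratX1_neq0 : ratX k + 1 != 0.
Proof.
by rewrite /ratX -(fracP1 k) -fracPD fracP_eq0 -size_poly_eq0 size_XaddC.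
Qed.

(** By [shift_sub_poly], [a] and hence the right-hand side is a polynomial; being
    a fraction of negative degree it is zero, and the powers of [s + 1] are
    linearly independent. *)
Lemma shift_sub_pole (a : K) N (c : nat -> k) :
  shift a - a = \sum_(i < N) ratC (c i) * tinv ^+ i.+1 ->
  forall i, (i < N)%N -> c i = 0.
Proof.
have x0 := ratX1_neq0; pose w : {poly k} := 'X + 1.
have wE : fracP w = ratX k + 1 by rewrite rmorphD rmorph1.
pose r : {poly k} := \sum_(i < N) c i *: w ^+ (N - i.+1).
have -> : \sum_(i < N) ratC (c i) * tinv ^+ i.+1 = fracP r / (ratX k + 1) ^+ N.
  rewrite /r rmorph_sum mulr_suml; apply: eq_bigr => i _ /=.
  rewrite -mul_polyC rmorphM rmorphXn /= wE.
  by rewrite -mulrA -expfV_sub.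
move=> ea; have [p ap] := shift_sub_poly ea.
have wN0 : w != 0 by rewrite -size_poly_eq0 size_XaddC.
have er : (shiftp p - p) * w ^+ N = r.
  apply: fracP_inj; rewrite rmorphM rmorphB rmorphXn /= -shift_fracP -ap ea wE.
  exact: (mulfVK (expf_neq0 N x0)).
have wm : w \is monic by apply: monicXaddC.
have sw i : size (w ^+ i) = i.+1.
  by rewrite -[LHS]prednK ?size_poly_gt0 ?expf_neq0 // size_exp size_XaddC mul1n.
have sr : (size r <= N)%N.
  rewrite (leq_trans (size_sum _ _ _)) //; apply/bigmax_leqP => i _.
  by rewrite (leq_trans (size_scale_leq _ _)) // sw subnSK // leq_subr.
have r0 : r = 0.
  have [q0|q0] := eqVneq (shiftp p - p) 0; first by rewrite -er q0 mul0r.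
  move: sr; rewrite -er size_Mmonic ?monic_exp //.
  rewrite sw addnS /= -size_poly_gt0 in q0 *.
  by rewrite leqNgt -{1}[N]add0n ltn_add2r q0.
have rX : \sum_(i < N) c i *: 'X^(N - i.+1) = 0.
  have : r \Po ('X - 1) = 0 by rewrite r0 comp_poly0.
  rewrite /r rmorph_sum /= => e; rewrite -[RHS]e; apply: eq_bigr => i _.
  rewrite comp_polyZ rmorphXn /= /w comp_polyD comp_polyX.
  by rewrite -[1 \Po _]/(1%:P \Po _) comp_polyC subrK.
move=> i iN; move/(congr1 (fun u : {poly k} => u`_(N - i.+1))): rX.
rewrite coef0 coef_sum (bigD1 (Ordinal iN)) //= coefZ coefXn eqxx mulr1.
rewrite big1 ?addr0 // => j ji; rewrite coefZ coefXn.
case: eqP => [e|_]; last by rewrite mulr0.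
case/eqP: ji; apply: val_inj => /=.
have := congr1 (fun x => N - x)%N e; by rewrite !subKn // => -[].
Qed.

Definition unshift (f : K) : K :=
  fracP (\n_(repr f) \Po ('X - 1)) / fracP (\d_(repr f) \Po ('X - 1)).

Lemma unshiftK : cancel unshift (@shift k).
Proof.
have e (p : {poly k}) : shiftp (p \Po ('X - 1)) = p.
  rewrite /shiftp -comp_polyA comp_polyB comp_polyX -[1 \Po _]/(1%:P \Po _).
  by rewrite comp_polyC addrK comp_polyXr.
move=> f; rewrite /unshift shift_div ?e -?fracP_repr //.
by rewrite comp_poly2_eq0 ?size_XsubC // denom_ratioP.
Qed.

Lemma shiftK : cancel (@shift k) unshift.
Proof. by move=> f; apply: (fmorph_inj (@shift k)); exact: unshiftK. Qed.

Lemma unshift_zmod_morphism : zmod_morphism unshift.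
Proof. by move=> f g; apply: (can_inj shiftK); rewrite unshiftK rmorphB /= !unshiftK. Qed.

Lemma unshift_monoid_morphism : monoid_morphism unshift.
Proof.
split=> [|f g]; apply: (can_inj shiftK); first by rewrite unshiftK rmorph1.
by rewrite unshiftK rmorphM /= !unshiftK.
Qed.

HB.instance Definition _ :=
  GRing.isZmodMorphism.Build K K unshift unshift_zmod_morphism.
HB.instance Definition _ :=
  GRing.isMonoidMorphism.Build K K unshift unshift_monoid_morphism.

End RationalShift.

(** * The gauge matrix as an exponential over the Lie algebra *)

Section GaugeMatrix.
Variables (k K : fieldType) (iota : {rmorphism k -> K}) (m : nat).
Hypothesis char0 : forall n, n.+1%:R != 0 :> k.
Local Notation "x %:K" := (map_mx iota x) (at level 2, format "x %:K").

Lemma char0_ext n : n.+1%:R != 0 :> K.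
Proof. by rewrite -(rmorph_nat iota) fmorph_eq0. Qed.

Lemma strictly_upper_band (A : 'M[k]_m.+1) :
  strictly_upper_triangular A <-> band 1 A.
Proof.
split=> [h|/bandP h i j ij]; last by apply: h; rewrite addn1 ltnS.
by apply/bandP => i j; rewrite addn1 ltnS; apply: h.
Qed.

(** The extension of scalars [g (x)_k K], realized inside the matrices over [K]. *)
Inductive scalar_ext (g : set 'M[k]_m.+1) : set 'M[K]_m.+1 :=
| scalar_ext0 : scalar_ext g 0
| scalar_extD a x v : g x -> scalar_ext g v -> scalar_ext g (a *: x%:K + v).

Section ScalarExt.
Variable g : set 'M[k]_m.+1.
Hypothesis g_lie : lie_subalgebra g.

Lemma scalar_ext_add u v : scalar_ext g u -> scalar_ext g v -> scalar_ext g (u + v).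
Proof.
by move=> hu hv; elim: hu => [|a x w gx _ IH]; rewrite ?add0r // -addrA; constructor.
Qed.

Lemma scalar_ext_scale a v : scalar_ext g v -> scalar_ext g (a *: v).
Proof.
by elim=> [|b x w gx _ IH]; rewrite ?scaler0 ?scalerDr ?scalerA; constructor.
Qed.

Lemma scalar_ext_emb x : g x -> scalar_ext g x%:K.
Proof.
by move=> gx; rewrite -[_%:K]scale1r -[_ *: _]addr0; do 2?constructor.
Qed.

Lemma scalar_ext_ad_emb x v : g x -> scalar_ext g v -> scalar_ext g (ad x%:K v).
Proof.
move=> gx; elim=> [|b y w gy _ IH]; first by rewrite ad0r; constructor.
rewrite adDr adZr (_ : ad x%:K y%:K = (ad x y)%:K).
  by constructor => //; apply: lie_ad.
by rewrite /ad rmorphB !rmorphM.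
Qed.

Lemma scalar_ext_lie : lie_subalgebra (scalar_ext g).
Proof.
split=> [|a x y hx hy|x y hx hy]; first by constructor.
  by apply: scalar_ext_add => //; apply: scalar_ext_scale.
rewrite -[_ - _]/(ad x y) ad_antisym -scaleN1r; apply: scalar_ext_scale.
elim: hx => [|a u v gu _ IH]; first by rewrite ad0r; constructor.
rewrite adDr adZr; apply: scalar_ext_add => //; apply: scalar_ext_scale.
by rewrite ad_antisym -scaleN1r; apply/scalar_ext_scale/scalar_ext_ad_emb.
Qed.

Lemma band_emb n (x : 'M[k]_m.+1) : band n x -> band n x%:K.
Proof. by move=> /bandP h; apply/bandP => i j ij; rewrite mxE h // rmorph0. Qed.

Lemma scalar_ext_band n v :
  (forall x, g x -> band n x) -> scalar_ext g v -> band n v.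
Proof.
move=> gb; elim=> [|a x w gx _ IH]; first exact: band0.
by apply: bandD => //; apply/bandZ/band_emb/gb.
Qed.

Lemma scalar_ext_map (f : {rmorphism K -> K}) v : (forall c, f (iota c) = iota c) ->
  scalar_ext g v -> scalar_ext g (map_mx f v).
Proof.
move=> f_iota; elim=> [|a x w gx _ IH]; first by rewrite raddf0; constructor.
rewrite raddfD /= map_mxZ (_ : map_mx _ x%:K = x%:K); first by constructor.
by apply/matrixP => i j; rewrite !mxE f_iota.
Qed.

End ScalarExt.

Variables (A B : 'M[k]_m.+1) (s : K).
Hypothesis s0 : s != 0.
Hypotheses (bA : band 1 A) (bB : band 1 B).

Lemma lie_alg_lie : lie_subalgebra (lie_alg A B).
Proof.
split=> [|a x y hx hy|x y hx hy] h hh; have [h0 hL hb] := hh.1 => //.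
  by apply: hL; [apply: hx|apply: hy].
by apply: hb; [apply: hx|apply: hy].
Qed.

Lemma lie_alg_gen i : (i < m)%N -> lie_alg A B (L_series A B i.+1).
Proof. by move=> im h [_]; apply; exists i.+1. Qed.

Lemma lie_alg_ind (h : set 'M[k]_m.+1) : lie_subalgebra h ->
  (forall i, (i < m)%N -> h (L_series A B i.+1)) -> forall x, lie_alg A B x -> h x.
Proof.
move=> hh hL x; apply; split => // _ [[|i] /= im <-] //; apply: hL.
by rewrite ltnS in im.
Qed.

Definition Bseries n : 'M[k]_m.+1 := if n is i.+1 then B *m (B - A) ^+ i else 0.

Lemma band_Bseries n : band n (Bseries n).
Proof.
case: n => [|n]; first exact: band0.
exact: (bandM bB (bandX n (bandB bB bA))).
Qed.

Lemma band_fps_mul (f h : nat -> 'M[k]_m.+1) :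
  (forall n, band n (f n)) -> (forall n, band n (h n)) ->
  forall n, band n (fps_mul f h n).
Proof.
move=> hf hh n; apply: band_sum => i _.
by have := bandM (hf i) (hh (n - i)%N); rewrite subnKC // -ltnS.
Qed.

Lemma band_fps_exp p n : band n (fps_exp Bseries p n).
Proof.
elim: p n => [|p IH] n /=; last by apply: band_fps_mul => //; apply: band_Bseries.
rewrite /fps_one; case: n => [|n] /=; last by rewrite raddf0; apply: band0.
exact: (bandX 0 bA).
Qed.

(** This lets the sum that defines [L_series] be taken over a range that does not
    depend on the index. *)
Lemma fps_exp_low p n : (n < p)%N -> fps_exp Bseries p n = 0.
Proof.
elim: p n => [//|p IH] n np /=; rewrite /fps_mul big1 // => -[[|i] /= ij] _.
  by rewrite mul0mx.
rewrite IH ?mulmx0 // (@leq_trans n) -1?ltnS // ltnS ltn_subrL /=.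
by case: n ij {np}.
Qed.

Lemma band_L_series n : band n (L_series A B n).
Proof. by apply: band_sum => i _; apply/bandZ/band_fps_exp. Qed.

Lemma lie_alg_band x : lie_alg A B x -> band 1 x.
Proof.
apply: (@lie_alg_ind (fun x => band 1 x)); last by move=> i _; apply: band_le (band_L_series _).
split; first exact: band0.
  by move=> a u v hu hv; apply: bandD => //; apply: bandZ.
by move=> u v hu hv; apply: bandB; apply: band_mul1.
Qed.

Definition fps_eval (f : nat -> 'M[k]_m.+1) : 'M[K]_m.+1 :=
  \sum_(n < m.+1) s^-1 ^+ n *: (f n)%:K.

(** Evaluation at [t = s^-1] is defined on truncations, and multiplicative when
    the coefficient of [t^n] has weight [n], so that the omitted terms vanish. *)
Lemma fps_eval_mul f h : (forall n, band n (f n)) -> (forall n, band n (h n)) ->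
  fps_eval (fps_mul f h) = fps_eval f * fps_eval h.
Proof.
move=> hf hh; have b (f' : nat -> 'M[k]_m.+1) (hf' : forall n, band n (f' n)) n :
    band n (s^-1 ^+ n *: (f' n)%:K) by apply: bandZ; apply: band_emb.
rewrite [RHS](cauchy_band (b _ hf) (b _ hh)); apply: eq_bigr => n _.
rewrite /fps_mul raddf_sum scaler_sumr; apply: eq_bigr => i _ /=.
by rewrite -scalerAl -scalerAr scalerA -exprD subnKC -1?ltnS // rmorphM.
Qed.

Lemma fps_eval_exp p : fps_eval (fps_exp Bseries p) = fps_eval Bseries ^+ p.
Proof.
elim: p => [|p IH]; last first.
  rewrite exprS -IH [LHS]fps_eval_mul //; first exact: band_Bseries.
  exact: band_fps_exp.
rewrite /fps_eval big_ord_recl /fps_one /= big1 ?addr0 => [|i _]; last first.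
  rewrite [X in map_mx _ X](_ : _ = 0) ?raddf0 ?scaler0 //.
  by apply/matrixP => a b; rewrite !mxE mul0rn.
by rewrite scale1r; exact: rmorph1.
Qed.

Definition gauge_log : 'M[K]_m.+1 :=
  \sum_(i < m) s^-1 ^+ i.+1 *: (L_series A B i.+1)%:K.

Lemma fps_eval_L : fps_eval (L_series A B) = gauge_log.
Proof.
rewrite /fps_eval big_ord_recl /= [L_series A B 0]big_nil.
by rewrite raddf0 scaler0 add0r.
Qed.

Lemma mlog_fps_eval : mlog (1 + fps_eval Bseries) = gauge_log.
Proof.
rewrite -fps_eval_L /mlog [1 + _]addrC addrK {2}/fps_eval.
have e n : (n < m.+1)%N -> L_series A B n =
    \sum_(1 <= p < m.+1) ((-1) ^+ p.-1 / p%:R) *: fps_exp Bseries p n.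
  move=> nm; rewrite [RHS](big_cat_nat (n := n.+1)) //=.
  rewrite [X in _ + X]big1_seq ?addr0 // => p; rewrite mem_index_iota => /andP[_ /andP[np _]].
  by rewrite fps_exp_low // scaler0.
under [RHS]eq_bigr => n _ do rewrite e // raddf_sum scaler_sumr /=.
rewrite exchange_big; apply: eq_bigr => p _; rewrite -fps_eval_exp scaler_sumr.
apply: eq_bigr => n _; rewrite map_mxZ !scalerA mulrC; congr (_ * _ *: _).
by rewrite rmorphM rmorphXn rmorphN1 fmorphV rmorph_nat.
Qed.

(** The matrix of the second system, where [s] stands for [s + 1] in [k(s)]. *)
Definition rational_gauge : 'M[K]_m.+1 :=
  (s%:M + A%:K) *m invmx (s%:M + A%:K - B%:K).

(** With [t] the inverse of [s], the gauge matrix is [1 + B t / (1 - (B - A) t)]. *)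
Lemma rational_gauge_fps : rational_gauge = 1 + fps_eval Bseries.
Proof.
pose t := s^-1; pose E := (B - A)%:K; pose G := \sum_(i < m.+1) (t *: E) ^+ i.
pose M' := s%:M + A%:K - B%:K.
have bE : band 1 E by apply: band_emb; apply: bandB.
have btE : band 1 (t *: E) by apply: bandZ.
have M'E : M' = s *: (1 - t *: E).
  rewrite scalerBr scalerA divff ?s0 // scale1r /M' -scalemx1 -addrA.
  by rewrite /E rmorphB opprB.
have M'G : M' * (t *: G) = 1.
  rewrite M'E -scalerAl -scalerAr scalerA divff ?s0 // scale1r.
  by rewrite -[1 - _]opprB mulNr -subrX1 band1_nilp // sub0r opprK.
have [uM _] := mulmx1_unit M'G.
have invM : invmx M' = t *: G.
  have e : M' *m (t *: G) = 1%:M := M'G.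
  by rewrite -[RHS]mul1mx -(mulVmx uM) -mulmxA e mulmx1.
have -> : rational_gauge = (M' + B%:K) * (t *: G).
  by rewrite /rational_gauge -/M' invM /M' subrK.
rewrite mulrDl M'G; congr (_ + _).
rewrite /fps_eval big_ord_recl /= raddf0 scaler0 add0r.
rewrite /G big_ord_recr /= scalerDr mulrDr [B%:K * (t *: (t *: E) ^+ m)](_ : _ = 0) ?addr0.
  rewrite scaler_sumr mulr_sumr; apply: eq_bigr => i _; rewrite /bump leq0n add1n /=.
  rewrite -[B *m _]/(B * _) rmorphM rmorphXn /= -scalerAr exprZn -scalerAr scalerA.
  by rewrite -exprS.
apply: (@band_full _ _ (1 + m)) => //; apply: bandM; first exact: band_emb.
by apply: bandZ; apply: bandX.
Qed.

Lemma mexp_gauge_log : mexp gauge_log = rational_gauge.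
Proof.
rewrite rational_gauge_fps -mlog_fps_eval mexp_mlog //.
  by move=> n; rewrite unitfE char0_ext.
rewrite addrC addKr; apply: band_sum => -[[|n] nm] _ /=.
  by rewrite raddf0 scaler0; apply: band0.
by apply: bandZ; apply: band_emb; apply: band_le (band_Bseries n.+1).
Qed.

End GaugeMatrix.

(** * Polynomial functions on a unipotent group *)

Section UnipotentGroup.
Variables (F : fieldType) (m : nat).
Hypothesis char0 : forall n, n.+1%:R != 0 :> F.
Variable g : set 'M[F]_m.+1.
Hypotheses (g_lie : lie_subalgebra g) (g_band : forall x, g x -> band 1 x).

Definition exp_group : set 'M[F]_m.+1 := [set mexp v | v in g]%classic.

Lemma exp_group_mexp v : g v -> exp_group (mexp v).
Proof. by move=> gv; exists v. Qed.

Lemma exp_groupM x y : exp_group x -> exp_group y -> exp_group (x * y).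
Proof.
move=> [v gv <-] [w gw <-].
have [V [gV _ /(_ 1)]] := campbell_hausdorff char0 g_lie g_band gv gw.
by rewrite !scale1r => ->; apply: exp_group_mexp; apply: lie_hornmx.
Qed.

Lemma exp_group1 : exp_group 1.
Proof. by exists 0; [exact: (lie0 g_lie) | exact: mexp0]. Qed.

Lemma exp_group_unip x : exp_group x -> band 1 (x - 1).
Proof. by move=> [v gv <-]; apply: band_mexp; apply: g_band. Qed.

End UnipotentGroup.

Section PolynomialFunctions.
Variables (K : fieldType) (m : nat).

Inductive matpoly : ('M[K]_m.+1 -> K) -> Prop :=
| matpoly_cst a : matpoly (fun=> a)
| matpoly_coord i j : matpoly (fun x => x i j)
| matpolyD f h : matpoly f -> matpoly h -> matpoly (fun x => f x + h x)
| matpolyM f h : matpoly f -> matpoly h -> matpoly (fun x => f x * h x).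

Lemma matpoly_sum I (r : seq I) (f : I -> 'M[K]_m.+1 -> K) :
  (forall i, matpoly (f i)) -> matpoly (fun x => \sum_(i <- r) f i x).
Proof.
move=> hf; elim: r => [|i r IH].
  by under eq_fun do rewrite big_nil; constructor.
by under eq_fun do rewrite big_cons; constructor.
Qed.

(** Polynomial functions restrict to polynomials in one variable along curves, so
    that an identity needs to be checked at positive integers only. *)
Lemma matpoly_path f : matpoly f -> forall V : 'M[{poly K}]_m.+1,
  exists p : {poly K}, forall t, f (hornmx t V) = p.[t].
Proof.
move=> hf V; elim: hf => [a|i j|f1 f2 _ [p1 e1] _ [p2 e2]|f1 f2 _ [p1 e1] _ [p2 e2]].
- by exists a%:P => t; rewrite hornerC.
- by exists (V i j) => t; rewrite mxE.
- by exists (p1 + p2) => t; rewrite hornerD e1 e2.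
- by exists (p1 * p2) => t; rewrite hornerM e1 e2.
Qed.

Lemma matpoly_mulmx f (c1 c2 : 'M[K]_m.+1) : matpoly f -> matpoly (fun x => f (c1 * x * c2)).
Proof.
elim=> [a|i j|f1 f2 _ h1 _ h2|f1 f2 _ h1 _ h2]; try by constructor.
under eq_fun do rewrite mxE.
apply: matpoly_sum => l; apply: matpolyM; last by constructor.
under eq_fun do rewrite mxE.
by apply: matpoly_sum => l'; apply: matpolyM; constructor.
Qed.

Lemma matpoly_twist f (s s' : {rmorphism K -> K}) : cancel s' s ->
  matpoly f -> matpoly (fun x => s (f (map_mx s' x))).
Proof.
move=> s'K; elim=> [a|i j|f1 f2 _ h1 _ h2|f1 f2 _ h1 _ h2].
- by constructor.
- by under eq_fun do rewrite mxE s'K; constructor.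
- by under eq_fun do rewrite rmorphD; constructor.
- by under eq_fun do rewrite rmorphM; constructor.
Qed.

Hypothesis char0 : forall n, n.+1%:R != 0 :> K.

Lemma poly_eq_nat (p q : {poly K}) :
  (forall n, p.[n.+1%:R] = q.[n.+1%:R]) -> p = q.
Proof.
move=> e; apply/eqP; rewrite -subr_eq0; apply/eqP.
apply: (@poly_many_roots _ (fun n => n.+1%:R)) => [i j /(nat_inj char0) []|n] //.
by rewrite hornerD hornerN e subrr.
Qed.

Lemma matpoly_exp_path f (u v : 'M[K]_m.+1) : matpoly f ->
  exists p : {poly K}, forall t, f (mexp (t *: u + v)) = p.[t].
Proof.
move=> hf; have [p hp] := matpoly_path hf (mexp ('X *: map_mx polyC u + map_mx polyC v)).
exists p => t; rewrite -hp /hornmx map_mexp; last exact: char0_poly_unit.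
congr (f (mexp _)); apply/matrixP => i j.
by rewrite !mxE rmorphD rmorphM /= /horner_eval hornerX !hornerC.
Qed.

Lemma matpoly_exp_affine f u v (a b : K) : matpoly f ->
  (forall n, f (mexp (n.+1%:R *: u + v)) = a + n.+1%:R * b) ->
  forall t, f (mexp (t *: u + v)) = a + t * b.
Proof.
move=> hf e t; have [p hp] := matpoly_exp_path u v hf.
rewrite hp (_ : p = a%:P + 'X * b%:P); first by rewrite !hornerE.
by apply: poly_eq_nat => n; rewrite -hp e !hornerE.
Qed.

End PolynomialFunctions.

Section AdditivePolynomial.
Variables (k K : fieldType) (iota : {rmorphism k -> K}) (m : nat).
Hypothesis char0 : forall n, n.+1%:R != 0 :> k.
Local Notation "x %:K" := (map_mx iota x) (at level 2, format "x %:K").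
Variable g : set 'M[k]_m.+1.
Hypotheses (g_lie : lie_subalgebra g) (g_band : forall x, g x -> band 1 x).

Let char0K := char0_ext iota char0.
Let gK := scalar_ext iota g.
Let gK_lie : lie_subalgebra gK := scalar_ext_lie iota g_lie.
Let gK_band v : gK v -> band 1 v := scalar_ext_band g_band.

Variables (f : 'M[K]_m.+1 -> K) (phi : 'M[k]_m.+1 -> k).
Hypothesis f_poly : matpoly f.
Hypothesis f_tr : forall y, g y -> forall x, exp_group gK x ->
  f (x * mexp y%:K) = f x + iota (phi y).

(** For a positive integer [t] this is an iteration of [f_tr], and both sides are
    polynomials in [t]. *)
Lemma additive_line x : g x -> forall t, f (mexp (t *: x%:K)) = f 1 + t * iota (phi x).
Proof.
move=> gx t; rewrite -[_ *: _]addr0.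
apply: matpoly_exp_affine => // n; rewrite addr0.
have bx : band 1 x%:K by apply: band_emb; apply: g_band.
have QK := char0_unit char0K.
have gKx c : gK (c *: x%:K) by apply/scalar_ext_scale/scalar_ext_emb.
elim: n => [|n IH].
  by rewrite scale1r mul1r -[mexp _]mul1r f_tr //; apply: exp_group1.
rewrite -natr1 scalerDl scale1r mexpD //; first last.
- by rewrite -scalerAl -scalerAr.
- exact: bandZ.
by rewrite f_tr ?IH //; [rewrite mulrDl mul1r addrA|apply: exp_group_mexp].
Qed.

Lemma additive_exp x : g x -> f (mexp x%:K) = f 1 + iota (phi x).
Proof. by move=> gx; rewrite -[x%:K]scale1r additive_line // mul1r. Qed.

Lemma additive_scale c x : g x -> phi (c *: x) = c * phi x.
Proof.
move=> gx; apply: (fmorph_inj iota); apply: (addrI (f 1)).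
rewrite -additive_exp; last exact: lieZ.
by rewrite map_mxZ additive_line // rmorphM.
Qed.

Lemma additive_mul x y : g x -> g y ->
  f (mexp x%:K * mexp y%:K) = f 1 + iota (phi x) + iota (phi y).
Proof.
move=> gx gy; rewrite f_tr // ?additive_exp //.
by apply/exp_group_mexp/scalar_ext_emb.
Qed.

(** [exp (t x) exp (t y) = exp (t V(t))] with [V(0) = x + y]; the polynomial
    [phi (V(t))] is constant away from [0], hence everywhere. *)
Lemma additive_add x y : g x -> g y -> phi (x + y) = phi x + phi y.
Proof.
move=> gx gy; have Qk := char0_unit char0.
have [V [gV V0 hV]] := campbell_hausdorff char0 g_lie g_band gx gy.
pose VK : 'M[{poly K}]_m.+1 := map_mx (map_poly iota) V.
have VKt t : hornmx (iota t) VK = (hornmx t V)%:K.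
  by apply/matrixP => i j; rewrite !mxE /horner_eval horner_map.
have [p hp] := matpoly_path f_poly (mexp VK).
have {}hp t : f (mexp (hornmx t VK)) = p.[t].
  rewrite -hp /hornmx map_mexp //; exact: char0_poly_unit.
have phiV (n : nat) : phi (hornmx n.+1%:R V) = phi x + phi y.
  apply: (mulfI (char0 n)).
  rewrite -additive_scale; last exact: lie_hornmx.
  apply: (fmorph_inj iota); apply: (addrI (f 1)).
  rewrite -additive_exp; last by apply: lieZ => //; apply: lie_hornmx.
  rewrite -map_mexp // -hV rmorphM /= !map_mexp //.
  rewrite additive_mul; try by apply: lieZ.
  by rewrite !additive_scale // mulrDr rmorphD addrA.
have pE : p = (f 1 + iota (phi x + phi y))%:P.
  apply: (poly_eq_nat char0K) => n; rewrite -hp -(rmorph_nat iota) VKt hornerC.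
  by rewrite additive_exp ?phiV //; apply: lie_hornmx.
apply: (fmorph_inj iota); apply: (addrI (f 1)).
rewrite -additive_exp; last exact: lieD.
by rewrite -V0 -hornmx0 -VKt rmorph0 hp pE hornerC.
Qed.

Lemma additive_sum I (r : seq I) (c : I -> 'M[k]_m.+1) : (forall i, g (c i)) ->
  phi (\sum_(i <- r) c i) = \sum_(i <- r) phi (c i).
Proof.
move=> gc; elim: r => [|i r IH]; last first.
  by rewrite !big_cons additive_add ?IH //; apply: lie_sum.
rewrite !big_nil -[0 in LHS](scale0r (0 : 'M[k]_m.+1)) additive_scale ?mul0r //.
exact: lie0.
Qed.

Lemma mexp_conj (x y : 'M[k]_m.+1) : band 1 x -> band 1 y ->
  mexp (- y) * mexp x * mexp y =
  mexp (\sum_(a < m.+1) ((-1) ^+ a * (a`!%:R)^-1) *: iter a (ad y) x).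
Proof.
move=> bx by_; have Qk := char0_unit char0; set W := \sum_(a < _) _.
have eW : x * mexp y = mexp y * W := mul_mexp_ad Qk bx by_.
apply: (mexpI Qk by_); rewrite !mulrA mexpN // mul1r.
rewrite /mexp mulr_suml mulr_sumr; apply: eq_bigr => n _.
rewrite -scalerAl -scalerAr -/(mexp y); congr (_ *: _).
elim: (val n) => [|i IH]; first by rewrite !expr0 mul1r mulr1.
by rewrite exprSr -mulrA eW mulrA IH -mulrA -exprSr.
Qed.

(** [phi] is invariant under conjugation by [exp (t y)], whose first order term
    in [t] is the bracket with [y]. *)
Lemma additive_ad x y : g x -> g y -> phi (ad y x) = 0.
Proof.
move=> gx gy; have Qk := char0_unit char0.
have giter a : g (iter a (ad y) x).
  by elim: a => //= a IH; apply: lie_ad.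
pose c a : k := (-1) ^+ a * (a`!%:R)^-1.
pose p := \poly_(a < m.+1) (c a * phi (iter a (ad y) x)).
have pt t : p.[t] = phi x.
  pose W := \sum_(a < m.+1) (c a * t ^+ a) *: iter a (ad y) x.
  have pW : p.[t] = phi W.
    rewrite additive_sum => [|a]; last exact: lieZ.
    rewrite horner_poly; apply: eq_bigr => a _; rewrite additive_scale //.
    by rewrite mulrAC.
  have WE : W = \sum_(a < m.+1) c a *: iter a (ad (t *: y)) x.
    apply: eq_bigr => a _; rewrite -scalerA; congr (_ *: _).
    elim: (val a) => [|i IH]; first by rewrite expr0 scale1r.
    by rewrite /= -IH adZl adZr scalerA -exprS.
  have gt : g (t *: y) by apply: lieZ.
  have eW := mexp_conj (g_band gx) (g_band gt); rewrite -WE in eW.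
  rewrite pW; apply: (fmorph_inj iota); apply: (addrI (f 1)).
  rewrite -additive_exp; last by apply: (lie_sum g_lie) => a _; apply: lieZ.
  rewrite -map_mexp // -eW !rmorphM /= !map_mexp //.
  rewrite f_tr // ?additive_mul //; try exact: lieN.
    rewrite -scaleN1r additive_scale // mulN1r rmorphN.
    by ring.
  by apply: exp_groupM => //; apply/exp_group_mexp/scalar_ext_emb => //; apply: lieN.
have pC : p = (phi x)%:P.
  by apply: (poly_eq_nat char0) => n; rewrite pt hornerC.
have := congr1 (fun q : {poly k} => q`_1) pC; rewrite coefC coef_poly /=.
case: ltnP => [_|m1] /eqP.
  by rewrite /c expr1 invr1 mulr1 mulN1r oppr_eq0 => /eqP.
move=> _; rewrite (_ : ad y x = 0); last first.
  exact: (band_full (leqW m1) (band_ad (g_band gy) (g_band gx))).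
by rewrite -(scale0r (0 : 'M[k]_m.+1)) additive_scale ?mul0r //; apply: lie0.
Qed.

(** The hypothesis concerns translations by [k]-points only; that [f] is
    polynomial extends its consequence to [K]-linear combinations. *)
Lemma additive_scalar_ext v x a : g x -> gK v ->
  f (mexp (a *: x%:K + v)) = f (mexp v) + a * iota (phi x).
Proof.
move=> gx gv; elim: gv x gx a => [|b y w gy gw IH] x gx a.
  by rewrite addr0 additive_line // mexp0.
suff H a' b' : f (mexp (a' *: x%:K + (b' *: y%:K + w))) =
    f (mexp w) + b' * iota (phi y) + a' * iota (phi x) by rewrite H IH.
apply: matpoly_exp_affine => // n.
rewrite addrCA addrAC; apply: matpoly_exp_affine => // n'.
rewrite addrA -!(rmorph_nat iota) -!map_mxZ -map_mxD -[map_mx _ _]scale1r.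
rewrite IH ?mul1r; last by apply: (lieD g_lie); apply: (lieZ g_lie).
rewrite additive_add; try exact: lieZ.
by rewrite !additive_scale // rmorphD !rmorphM addrAC addrA.
Qed.

End AdditivePolynomial.

(** * Unipotent operators *)

Section Flags.
Variables (K : fieldType) (V : comPzRingType) (c : {rmorphism K -> V}).
Implicit Types (f h : V) (ms : seq V).

(** The span over [K], by recursion on the list in the same order as [flag]. *)
Fixpoint kspan ms f : Prop :=
  if ms is h :: ms' then exists a, kspan ms' (f - c a * h) else f = 0.

Lemma kspan0 ms : kspan ms 0.
Proof. by elim: ms => //= h ms IH; exists 0; rewrite rmorph0 mul0r subr0. Qed.

Lemma kspan_lin ms a f h : kspan ms f -> kspan ms h -> kspan ms (c a * f + h).
Proof.
elim: ms f h => [f h -> ->|u ms IH f h [b hf] [b' hh]] /=.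
  by rewrite mulr0 addr0.
exists (a * b + b'); rewrite (_ : _ - _ = c a * (f - c b * u) + (h - c b' * u)).
  exact: IH.
by rewrite rmorphD rmorphM; ring.
Qed.

Lemma kspanD ms f h : kspan ms f -> kspan ms h -> kspan ms (f + h).
Proof. by move=> hf hh; rewrite -[f]mul1r -(rmorph1 c); apply: kspan_lin. Qed.

Lemma kspanZ ms a f : kspan ms f -> kspan ms (c a * f).
Proof. by move=> hf; rewrite -[_ * _]addr0; apply: kspan_lin => //; apply: kspan0. Qed.

Lemma kspanB ms f h : kspan ms f -> kspan ms h -> kspan ms (f - h).
Proof.
move=> hf hh; rewrite -mulN1r -(rmorph1 c) -rmorphN.
by apply: kspanD => //; apply: kspanZ.
Qed.

Lemma kspan_cons ms u f : kspan ms f -> kspan (u :: ms) f.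
Proof. by move=> hf; exists 0; rewrite rmorph0 mul0r subr0. Qed.

Lemma kspan_head ms u : kspan (u :: ms) u.
Proof. by exists 1; rewrite rmorph1 mul1r subrr; apply: kspan0. Qed.

Lemma kspan_catr ms ms' f : kspan ms' f -> kspan (ms ++ ms') f.
Proof. by elim: ms => //= u ms IH /IH; apply: kspan_cons. Qed.

Lemma kspan_catl ms ms' f : kspan ms f -> kspan (ms ++ ms') f.
Proof.
elim: ms f => [f -> |u ms IH f [a hf]] /=; first exact: kspan0.
by exists a; apply: IH.
Qed.

(** Every element of a flag is fixed, modulo the span of the later ones, by all
    operators considered. *)
Fixpoint flag (Th : set (V -> V)) ms : Prop :=
  if ms is h :: ms' then
    (forall th, Th th -> kspan ms' (th h - h)) /\ flag Th ms'
  else True.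

Definition semilinear_endo (th : V -> V) :=
  [/\ {morph th : f h / f + h}, {morph th : f h / f * h}, th 1 = 1
    & forall a, exists b, th (c a) = c b].

Section Endo.
Variable th : V -> V.
Hypothesis hth : semilinear_endo th.

Lemma endo0 : th 0 = 0.
Proof. by case: hth => thD _ _ _; apply: (addrI (th 0)); rewrite -thD !addr0. Qed.

Lemma endoB f h : th (f - h) = th f - th h.
Proof. by case: hth => thD _ _ _; apply: (addIr (th h)); rewrite -thD !subrK. Qed.

End Endo.

Variable Th : set (V -> V).
Hypothesis Th_endo : forall th, Th th -> semilinear_endo th.

Lemma kspan_endo th ms f : Th th -> flag Th ms -> kspan ms f -> kspan ms (th f).
Proof.
move=> hth; have [_ thM _ thc] := Th_endo hth.
elim: ms f => [f _ ->|h ms IH f [fh fms] [a hf]] /=; first exact/endo0/Th_endo.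
have [b thb] := thc a; exists b.
rewrite (_ : th f - c b * h = th (f - c a * h) + c b * (th h - h)).
  by apply: kspanD; [apply: IH | apply/kspanZ/fh].
by rewrite (endoB (Th_endo hth)) thM thb mulrBr addrA subrK.
Qed.

Lemma flag_cat ms ms' : flag Th ms -> flag Th ms' -> flag Th (ms ++ ms').
Proof.
elim: ms => //= h ms IH [fh fms] fms'; split; last exact: IH.
by move=> th hth; apply/kspan_catl/fh.
Qed.

Definition has_flag f := exists2 ms, flag Th ms & kspan ms f.

Fixpoint mul_seq ms ms' : seq V :=
  if ms is h :: ms1 then [seq h * h' | h' <- ms'] ++ mul_seq ms1 ms' else [::].

Lemma kspan_mull ms h f : kspan ms f -> kspan [seq h * h' | h' <- ms] (h * f).
Proof.
elim: ms f => [f ->|u ms IH f [a hf]] /=; first by rewrite mulr0.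
by exists a; have := IH _ hf; rewrite mulrBr mulrCA.
Qed.

Lemma kspan_mul ms ms' f h : kspan ms f -> kspan ms' h -> kspan (mul_seq ms ms') (f * h).
Proof.
elim: ms f => [f ->|u ms IH f [a hf]] hh /=; first by rewrite mul0r.
rewrite -[f](subrK (c a * u)) mulrDl -mulrA; apply: kspanD.
  by apply/kspan_catr/IH.
by apply/kspanZ/kspan_catl/kspan_mull.
Qed.

(** Products [h * h'] in lexicographic order form a flag, as
    [th (h h') - h h' = h (th h' - h') + (th h - h) th h']. *)
Lemma flag_mul ms ms' : flag Th ms -> flag Th ms' -> flag Th (mul_seq ms ms').
Proof.
move=> fms fms'; elim: ms fms => //= h ms IH [fh fms].
suff H ms1 : flag Th ms1 -> (forall u, kspan ms1 u -> kspan ms' u) ->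
  flag Th ([seq h * h' | h' <- ms1] ++ mul_seq ms ms') by apply: H.
elim: ms1 => [|u ms1 IH1] /=; first by move=> _ _; apply: IH.
move=> [fu fms1] sub; split; last first.
  by apply: IH1 => // v hv; apply: sub; apply: kspan_cons.
move=> th hth; have [_ thM _ _] := Th_endo hth.
rewrite (_ : _ - _ = h * (th u - u) + (th h - h) * th u).
  apply: kspanD; first by apply/kspan_catl/kspan_mull/fu.
  apply: kspan_catr; apply: kspan_mul; first exact: fh.
  by apply: kspan_endo => //; apply/sub/kspan_head.
by rewrite thM; ring.
Qed.

Lemma has_flagD f h : has_flag f -> has_flag h -> has_flag (f + h).
Proof.
move=> [ms fms hf] [ms' fms' hh]; exists (ms ++ ms'); first exact: flag_cat.
by apply: kspanD; [apply: kspan_catl | apply: kspan_catr].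
Qed.

Lemma has_flagM f h : has_flag f -> has_flag h -> has_flag (f * h).
Proof.
move=> [ms fms hf] [ms' fms' hh]; exists (mul_seq ms ms'); first exact: flag_mul.
exact: kspan_mul.
Qed.

Lemma has_flag_scalar a : has_flag (c a).
Proof.
exists [:: 1]; last by rewrite -[c a]mulr1; apply/kspanZ/kspan_head.
by split=> // th /Th_endo[_ _ th1 _] /=; rewrite th1 subrr.
Qed.

(** Each operator may move [f] by its own combination of the [h i]. *)
Lemma has_flag_step (I : finType) (p : pred I) (h : I -> V) f :
  (forall i, p i -> has_flag (h i)) ->
  (forall th, Th th -> exists a, th f - f = \sum_(i | p i) c (a i) * h i) ->
  has_flag f.
Proof.
move=> hh hf.
have [ms fms hms] : exists2 ms, flag Th ms & forall i, p i -> kspan ms (h i).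
  suff [ms fms hms] : exists2 ms, flag Th ms &
      forall i, i \in enum I -> p i -> kspan ms (h i).
    by exists ms => // i; apply: hms; rewrite mem_enum.
  elim: (enum I) => [|i r [ms fms IH]]; first by exists [::].
  have [pi|npi] := boolP (p i); last first.
    exists ms => // j; rewrite inE => /orP[/eqP->|/IH //] pj.
    by rewrite pj in npi.
  have [ms' fms' hi] := hh i pi; exists (ms' ++ ms); first exact: flag_cat.
  move=> j; rewrite inE => /orP[/eqP-> _|/IH jr pj]; first exact: kspan_catl.
  by apply: kspan_catr; apply: jr.
exists (f :: ms); last exact: kspan_head.
split=> // th /hf[a ->].
rewrite big_mkcond; elim/big_rec: _ => [|i u _ hu]; first exact: kspan0.
by case: ifP => pi; apply: kspanD => //; [apply/kspanZ/hms | apply: kspan0].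
Qed.

End Flags.

Section FlagMinimum.
Variables (K : fieldType) (V : comPzRingType) (c : {rmorphism K -> V}).

(** The first step of the flag that meets [J] does so in a line, which contains
    a vector that the operator fixes. *)
Lemma flag_fixed_vector (th : V -> V) (J : set V) f :
  semilinear_endo c th -> (forall a u v, J u -> J v -> J (c a * u + v)) ->
  (forall u, J u -> J (th u)) ->
  has_flag c [set th]%classic f -> J f -> f <> 0 ->
  exists v, [/\ J v, v <> 0 & th v = v].
Proof.
move=> hth Jlin Jth [ms fms hf] Jf f0.
have Th_endo th' : [set th]%classic th' -> semilinear_endo c th' by move->.
have JB u v : J u -> J v -> J (u - v).
  by move=> Ju Jv; rewrite addrC -mulN1r -(rmorph1 c) -rmorphN; apply: Jlin.
have J0 : J 0 by rewrite -(subrr f); apply: JB.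
elim: ms fms f hf Jf f0 => [_ f -> //|h ms IH [fh fms] f [a hf] Jf f0].
have [[u [Ju hu u0]]|nu] := pselect (exists u, [/\ J u, kspan c ms u & u <> 0]).
  exact: (IH fms u hu Ju u0).
have a0 : a != 0.
  apply/eqP => a0; apply: nu; exists f; split => //.
  by rewrite a0 rmorph0 mul0r subr0 in hf.
pose v := c a^-1 * f; have vE : v = h + c a^-1 * (f - c a * h).
  by rewrite mulrBr mulrA -rmorphM mulVf // rmorph1 mul1r addrC subrK.
have Jv : J v by rewrite -[v]addr0; apply: Jlin.
have hl : kspan c ms (c a^-1 * (f - c a * h)) by apply: kspanZ.
exists v; split=> //.
  move=> v0; apply: f0; rewrite -[f]mul1r -(rmorph1 c) -(mulfV a0) rmorphM.
  by rewrite -mulrA -/v v0 mulr0.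
apply/eqP; rewrite -subr_eq0; apply/eqP; apply: contrapT => nz.
apply: nu; exists (th v - v); split=> //; first by apply: JB => //; apply: Jth.
rewrite vE; have [thD _ _ _] := hth; rewrite thD.
rewrite (_ : _ - _ = (th h - h) + (th (c a^-1 * (f - c a * h)) - c a^-1 * (f - c a * h))).
  apply: kspanD; first exact: fh.
  by apply: kspanB => //; apply: (@kspan_endo _ _ _ [set th]%classic).
by rewrite opprD addrACA.
Qed.

(** A vector outside [C] in the first step of the flag that contains one is
    moved into [C] by all operators. *)
Lemma flag_affine_vector (Th : set (V -> V)) (N C : set V) f :
  (forall th, Th th -> semilinear_endo c th) ->
  (forall th a, Th th -> th (c a) = c a) ->
  (forall u v, N u -> N v -> N (u - v)) ->
  (forall th u, Th th -> N u -> N (th u)) ->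
  has_flag c Th f -> N f -> ~ C f -> C 0 ->
  exists v, [/\ N v, ~ C v & forall th, Th th -> C (th v - v)].
Proof.
move=> Th_endo thc NB Nth [ms fms hf] Nf Cf C0.
elim: ms fms f hf Nf Cf => [_ f -> //|h ms IH [fh fms] f [a hf] Nf Cf].
have [[u [Nu hu Cu]]|nu] := pselect (exists u, [/\ N u, kspan c ms u & ~ C u]).
  exact: (IH fms u hu Nu Cu).
exists f; split=> // th hth; apply: contrapT => nC; apply: nu.
exists (th f - f); split=> //; first by apply: NB => //; apply: Nth.
have [thD thM _ _] := Th_endo th hth.
rewrite (_ : th f - f = c a * (th h - h) + (th (f - c a * h) - (f - c a * h))).
  apply: kspanD; first by apply/kspanZ/fh.
  by apply: kspanB => //; apply: (@kspan_endo _ _ _ Th).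
by rewrite (endoB (Th_endo th hth)) thM thc //; ring.
Qed.

End FlagMinimum.

(** * Points of finitely generated algebras *)

Section Nullstellensatz.
Variables (k : closedFieldType) (T : comNzRingType) (j : {rmorphism k -> T}).

(** An ideal maximal among the proper ones, given by Zorn's lemma. *)
Lemma exists_prime_ideal : exists p : set T,
  [/\ forall x y, p x -> p y -> p (x + y), forall a x, p x -> p (a * x), ~ p 1
    & p 0 /\ forall x y, p (x * y) -> p x \/ p y].
Proof.
pose P (I : set T) := [/\ forall x y, I x -> I y -> I (x + y),
  forall a x, I x -> I (a * x) & ~ I 1].
have [I [[ID IM I1] Imax]] : exists I, P I /\ forall J, (I `<` J)%classic -> ~ P J.
  apply: Zorn_bigcup => F FP tot; split.
  - move=> x y [X FX Xx] [Y FY Yy].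
    have [XY|YX] := tot X Y FX FY.
      by exists Y => //; have [YD _ _] := FP Y FY; apply: YD => //; apply: XY.
    by exists X => //; have [XD _ _] := FP X FX; apply: XD => //; apply: YX.
  - by move=> a x [X FX Xx]; exists X => //; have [_ XM _] := FP X FX; apply: XM.
  - by move=> [X FX X1]; have [_ _] := FP X FX.
have I0 : I 0.
  apply: contrapT => nI0; apply: (Imax [set 0]%classic).
    split; last by move=> h; apply: nI0; apply: h.
    by move=> x Ix; exfalso; apply: nI0; rewrite -(mul0r x); apply: IM.
  split=> [x y -> ->|a x ->|/eqP]; rewrite ?addr0 ?mulr0 //.
  by rewrite oner_eq0.
have adj x : ~ I x -> exists2 a, I a & exists t, 1 = a + t * x.
  move=> nx; apply: contrapT => n1.
  apply: (Imax [set u | exists2 a, I a & exists t, u = a + t * x]%classic).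
    split; first by move=> u Iu; exists u => //; exists 0; rewrite mul0r addr0.
    move=> h; apply: nx; apply: h; exists 0 => //; exists 1; rewrite mul1r add0r //.
  split=> //.
    move=> _ _ [a Ia [t ->]] [b Ib [u ->]]; exists (a + b); first exact: ID.
    by exists (t + u); rewrite mulrDl addrACA.
  move=> c _ [a Ia [t ->]]; exists (c * a); first exact: IM.
  by exists (c * t); rewrite mulrDr mulrA.
exists I; split=> //; split=> // x y Ixy; apply: contrapT => nxy; apply: I1.
have [a Ia [t ea]] : exists2 a, I a & exists t, 1 = a + t * x.
  by apply: adj => Ix; apply: nxy; left.
have [b Ib [u eb]] : exists2 a, I a & exists t, 1 = a + t * y.
  by apply: adj => Iy; apply: nxy; right.
have -> : 1 = (b + u * y) * a + (t * x * b + t * u * (x * y)) :> T.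
  by rewrite -[LHS]mulr1 {1}ea eb; ring.
exact: (ID _ _ (IM _ _ Ia) (ID _ _ (IM _ _ Ib) (IM _ _ Ixy))).
Qed.

Section PrimeIdeal.
Variable p : set T.
Hypotheses (pD : forall x y, p x -> p y -> p (x + y))
  (pM : forall a x, p x -> p (a * x)) (p1 : ~ p 1)
  (pprime : forall x y, p (x * y) -> p x \/ p y) (p0 : p 0).

Lemma pN x : p x -> p (- x).
Proof. by move=> px; rewrite -mulN1r; apply: pM. Qed.

Lemma pB x y : p x -> p y -> p (x - y).
Proof. by move=> px py; apply: pD => //; apply: pN. Qed.

Lemma pB_iff x y : p (x - y) -> (p x <-> p y).
Proof.
move=> h; split=> [px|py]; last by rewrite -[x](subrK y); apply: pD.
by rewrite -[y](subKr x); apply: pB.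
Qed.

Lemma p_sum I (r : seq I) (f : I -> T) : (forall i, p (f i)) -> p (\sum_(i <- r) f i).
Proof. by move=> h; elim/big_rec: _ => // i x _; apply: pD. Qed.

Lemma npM x y : ~ p x -> ~ p y -> ~ p (x * y).
Proof. by move=> px py /pprime[]. Qed.

Lemma npX x n : ~ p x -> ~ p (x ^+ n).
Proof. by move=> px; elim: n => [|n IH]; rewrite ?expr0 // exprS; apply: npM. Qed.

Lemma p_horner (F : {poly T}) x : (forall i, p F`_i) -> p F.[x].
Proof. by move=> h; rewrite horner_coef; apply: p_sum => i; rewrite mulrC; apply: pM. Qed.

Definition subalgebra (A : set T) := [/\ forall c, A (j c),
  forall x y, A x -> A y -> A (x + y) & forall x y, A x -> A y -> A (x * y)].

Definition is_point (A : set T) (e : T -> k) := [/\ forall c, e (j c) = c,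
  forall x y, A x -> A y -> e (x + y) = e x + e y,
  forall x y, A x -> A y -> e (x * y) = e x * e y
  & forall x, A x -> p x -> e x = 0].

Section Adjoin.
Variable A : set T.
Hypothesis Asub : subalgebra A.

Lemma sub_cst c : A (j c). Proof. by case: Asub. Qed.
Lemma subD x y : A x -> A y -> A (x + y). Proof. by case: Asub => _ h _; apply: h. Qed.
Lemma subM x y : A x -> A y -> A (x * y). Proof. by case: Asub => _ _ h; apply: h. Qed.
Lemma sub0 : A 0. Proof. by rewrite -(rmorph0 j); apply: sub_cst. Qed.
Lemma sub1 : A 1. Proof. by rewrite -(rmorph1 j); apply: sub_cst. Qed.
Lemma subN x : A x -> A (- x).
Proof.
by move=> Ax; rewrite -mulN1r -(rmorph1 j) -rmorphN; apply: subM => //; apply: sub_cst.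
Qed.
Lemma sub_sum I (r : seq I) (f : I -> T) : (forall i, A (f i)) -> A (\sum_(i <- r) f i).
Proof. by move=> h; elim/big_rec: _ => [|i x _]; [apply: sub0|apply: subD]. Qed.
Lemma subX x n : A x -> A (x ^+ n).
Proof. by move=> Ax; elim: n => [|n IH]; rewrite ?expr0 ?exprS; [apply: sub1|apply: subM]. Qed.

Definition coefs_in (F : {poly T}) := forall i, A F`_i.

Lemma coefs_inD F H : coefs_in F -> coefs_in H -> coefs_in (F + H).
Proof. by move=> hF hH i; rewrite coefD; apply: subD. Qed.

Lemma coefs_inM F H : coefs_in F -> coefs_in H -> coefs_in (F * H).
Proof. by move=> hF hH i; rewrite coefM; apply: sub_sum => l; apply: subM. Qed.

Lemma coefs_inC a : A a -> coefs_in a%:P.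
Proof. by move=> Aa i; rewrite coefC; case: eqP => // _; apply: sub0. Qed.

Lemma coefs_inXn n : coefs_in 'X^n.
Proof. by move=> i; rewrite coefXn; case: eqP => _; [apply: sub1|apply: sub0]. Qed.

Lemma coefs_inN F : coefs_in F -> coefs_in (- F).
Proof. by move=> hF i; rewrite coefN; apply: subN. Qed.

(** Division by [G] after multiplication by a power of its leading coefficient,
    without leaving the subalgebra [A] of coefficients. *)
Lemma pseudo_division (H G : {poly T}) : coefs_in H -> coefs_in G -> G != 0 ->
  exists e S R, [/\ coefs_in S, coefs_in R,
    (lead_coef G ^+ e)%:P * H = S * G + R, (size R < size G)%N
    & (size S <= (size H - size G).+1)%N].
Proof.
move=> AH AG G0; have Alead : A (lead_coef G) by apply: AG.
have [n nH] := ubnP (size H); elim: n H nH AH => // n IH H nH AH.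
have [HG|GH] := ltnP (size H) (size G).
  exists 0%N, 0, H; split=> //; first by move=> i; rewrite coef0; apply: sub0.
    by rewrite expr0 mul0r add0r mul1r.
  by rewrite size_poly0.
set q := (size H - size G)%N; set h := lead_coef H.
pose U : {poly T} := h%:P * 'X^q.
have AU : coefs_in U by apply: coefs_inM; [apply: coefs_inC; apply: AH|apply: coefs_inXn].
pose H1 := (lead_coef G)%:P * H - U * G.
have AH1 : coefs_in H1.
  apply: coefs_inD; first by apply: coefs_inM => //; apply: coefs_inC.
  by apply: coefs_inN; apply: coefs_inM.
have sG : (0 < size G)%N by rewrite size_poly_gt0.
have sH1 : (size H1 < size H)%N.
  rewrite -(prednK (leq_trans sG GH)) ltnS; apply/leq_sizeP => i Hi.
  have qi : (q <= i)%N.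
    by rewrite (leq_trans _ Hi) // -ltnS (prednK (leq_trans sG GH)) ltn_subrL sG (leq_trans sG GH).
  rewrite coefB -mulrA !coefCM coefXnM ltnNge qi /=.
  move: Hi; rewrite leq_eqVlt => /orP[/eqP <-|Hi].
    rewrite [(_ - q)%N](_ : _ = (size G).-1); first by rewrite mulrC subrr.
    by rewrite -subn1 subnAC subKn // subn1.
  rewrite nth_default; last by rewrite -(prednK (leq_trans sG GH)).
  rewrite nth_default ?mulr0 ?subrr //.
  rewrite -(leq_add2l q) subnKC // /q subnK //.
  by rewrite -(prednK (leq_trans sG GH)).
have [|e [S [R [AS AR eR sR sS]]]] := IH H1 _ AH1; first by rewrite (leq_trans sH1).
exists e.+1, ((lead_coef G ^+ e)%:P * U + S), R; split=> //.
- by apply: coefs_inD => //; apply: coefs_inM => //; apply/coefs_inC/subX.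
- rewrite exprSr polyCM -mulrA.
  have -> : (lead_coef G)%:P * H = H1 + U * G by rewrite subrK.
  by rewrite mulrDr eR; ring.
- rewrite (leq_trans (size_polyD _ _)) // geq_max; apply/andP; split.
    by rewrite mulrA -polyCM mul_polyC (leq_trans (size_scale_leq _ _)) // size_polyXn.
  by rewrite (leq_trans sS) // ltnS leq_sub2r // ltnW.
Qed.

Definition adjoin x : set T := fun b => exists2 F, coefs_in F & b = F.[x].

Lemma adjoin_sub x : subalgebra (adjoin x).
Proof.
split=> [c|_ _ [F AF ->] [H AH ->]|_ _ [F AF ->] [H AH ->]].
- by exists (j c)%:P; rewrite ?hornerC //; apply/coefs_inC/sub_cst.
- by exists (F + H); rewrite ?hornerD //; apply: coefs_inD.
- by exists (F * H); rewrite ?hornerM //; apply: coefs_inM.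
Qed.

Lemma adjoin_base x a : A a -> adjoin x a.
Proof. by move=> Aa; exists a%:P; rewrite ?hornerC //; apply: coefs_inC. Qed.

Lemma adjoin_gen x : adjoin x x.
Proof. by exists 'X; rewrite ?hornerX //; rewrite -['X]expr1; apply: coefs_inXn. Qed.

Section PointMap.
Variable e : T -> k.
Hypothesis he : is_point A e.

Lemma point0 : e 0 = 0. Proof. by case: he => ec _ _ _; rewrite -(rmorph0 j) ec. Qed.

Lemma point_sum I (r : seq I) (f : I -> T) : (forall i, A (f i)) ->
  e (\sum_(i <- r) f i) = \sum_(i <- r) e (f i).
Proof.
move=> hf; elim: r => [|i r IH]; first by rewrite !big_nil point0.
by rewrite !big_cons; case: he => _ eD _ _; rewrite eD ?IH //; apply: sub_sum.
Qed.

Lemma pointX a n : A a -> e (a ^+ n) = e a ^+ n.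
Proof.
move=> Aa; case: he => ec _ eM _.
elim: n => [|n IH]; first by rewrite !expr0 -(rmorph1 j) ec.
by rewrite !exprS eM ?IH //; apply: subX.
Qed.

Lemma coef_point F i : (map_poly e F)`_i = e F`_i.
Proof. by rewrite coef_map_id0 // point0. Qed.

Lemma point_polyD F H : coefs_in F -> coefs_in H ->
  map_poly e (F + H) = map_poly e F + map_poly e H.
Proof.
move=> AF AH; apply/polyP => i; rewrite coefD !coef_point coefD.
by case: he => _ -> //.
Qed.

Lemma point_polyM F H : coefs_in F -> coefs_in H ->
  map_poly e (F * H) = map_poly e F * map_poly e H.
Proof.
move=> AF AH; apply/polyP => i; rewrite coef_point !coefM point_sum => [|l]; last exact: subM.
by apply: eq_bigr => l _; rewrite !coef_point; case: he => _ _ -> //.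
Qed.

Lemma point_polyC a : map_poly e a%:P = (e a)%:P.
Proof. by apply/polyP => i; rewrite coef_point !coefC; case: ifP => // _; apply: point0. Qed.

Lemma point_poly_p F : coefs_in F -> (forall i, p F`_i) -> map_poly e F = 0.
Proof.
by move=> AF pF; apply/polyP => i; rewrite coef_point coef0; case: he => _ _ _; apply.
Qed.

(** A value for the new generator that respects all its relations extends the
    point. *)
Lemma point_extend x v :
  (forall H, coefs_in H -> p H.[x] -> (map_poly e H).[v] = 0) ->
  exists e', is_point (adjoin x) e' /\
    forall H, coefs_in H -> e' H.[x] = (map_poly e H).[v].
Proof.
move=> hv; have uniq F H : coefs_in F -> coefs_in H -> p (F.[x] - H.[x]) ->
    (map_poly e F).[v] = (map_poly e H).[v].
  move=> AF AH pFH; have AN := coefs_inN AH.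
  have : (map_poly e (F - H)).[v] = 0.
    by apply: hv; [apply: coefs_inD | rewrite hornerD hornerN].
  rewrite point_polyD // hornerD => /eqP; rewrite addr_eq0 => /eqP ->.
  have : map_poly e (- H) + map_poly e H = 0.
    by rewrite -point_polyD // addNr -[0]/(0%:P) point_polyC point0.
  by move=> /eqP; rewrite addr_eq0 => /eqP ->; rewrite hornerN opprK.
have /choice[e' he'] b : exists c, forall F, coefs_in F -> b = F.[x] -> c = (map_poly e F).[v].
  have [[F AF ->]|nb] := pselect (adjoin x b).
    by exists (map_poly e F).[v] => H AH FH; apply: uniq => //; rewrite FH subrr.
  by exists 0 => F AF bF; exfalso; apply: nb; exists F.
have e'E H : coefs_in H -> e' H.[x] = (map_poly e H).[v] by move=> AH; apply: he'.
have [ec _ _ _] := he.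
exists e'; split=> //; split=> [c|_ _ [F AF ->] [H AH ->]|_ _ [F AF ->] [H AH ->]|_ [F AF ->] pF].
- rewrite (he' _ (j c)%:P) ?hornerC //; last exact/coefs_inC/sub_cst.
  by rewrite point_polyC hornerC ec.
- by rewrite -hornerD !e'E ?point_polyD ?hornerD //; apply: coefs_inD.
- by rewrite -hornerM !e'E ?point_polyM ?hornerM //; apply: coefs_inM.
- by rewrite e'E // hv.
Qed.

End PointMap.

(** Density is what passes from [A] to [A[x]], where the existence of a single
    point would not suffice: leading coefficients have to be avoided. *)
Definition dense_points (B : set T) :=
  forall a, B a -> ~ p a -> exists2 e, is_point B e & e a <> 0.

Lemma min_size (P : set {poly T}) F : P F ->
  exists2 F : {poly T}, P F & forall H : {poly T}, (size H < size F)%N -> ~ P H.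
Proof.
have [n nF] := ubnP (size F); elim: n F nF => // n IH F nF PF.
have [[H [sH PH]]|nH] := pselect (exists H : {poly T}, (size H < size F)%N /\ P H).
  by apply: (IH H) => //; rewrite (leq_trans sH).
by exists F => // H sH PH; apply: nH; exists H.
Qed.

(** Dropping a leading coefficient in [p] does not change values modulo [p]. *)
Lemma drop_lead (F : {poly T}) : coefs_in F -> F != 0 -> p (lead_coef F) ->
  exists F', [/\ coefs_in F', (size F' < size F)%N, forall x, p (F.[x] - F'.[x])
    & forall i, p F`_i <-> p F'`_i].
Proof.
move=> AF F0 pl; have sF : (0 < size F)%N by rewrite size_poly_gt0.
pose U : {poly T} := (lead_coef F)%:P * 'X^((size F).-1).
have pU i : p U`_i by rewrite coefCM mulrC; apply: pM.
have AU : coefs_in U by apply: coefs_inM; [apply/coefs_inC/AF|apply: coefs_inXn].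
exists (F - U); split.
- by apply: coefs_inD => //; apply: coefs_inN.
- rewrite -[X in (_ < X)%N](prednK sF) ltnS; apply/leq_sizeP => i.
  rewrite leq_eqVlt coefB coefCM coefXn => /orP[/eqP<-|Fi].
    by rewrite eqxx mulr1 subrr.
  rewrite gtn_eqF // mulr0 subr0 nth_default //; by rewrite -(prednK sF).
- by move=> x; rewrite hornerD hornerN opprB addrC subrK; apply: p_horner.
- move=> i; rewrite coefB; apply: pB_iff; rewrite opprB addrC subrK; exact: pU.
Qed.

(** Let the element to be avoided be [b = Q.[x]].  If [x] is transcendental over
    [A / p], a point of [A] that does not kill [Q] extends by any value of [x]
    that is not a root of the image of [Q].  Otherwise let [F] be a relation of
    least degree, with leading coefficient [f].  Some multiple of [b] is an
    element [r] of [A] outside [p], and a point of [A] not killing [f r] extends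
    by any root of the image of [F], since every relation is, up to powers of
    [f], a multiple of [F]. *)
Lemma dense_adjoin x : dense_points A -> dense_points (adjoin x).
Proof.
move=> dA b [Q AQ bQ] pb.
pose rel : set {poly T} := fun F => [/\ coefs_in F, p F.[x] & exists i, ~ p F`_i].
have [[F0 hF0]|trans] := pselect (exists F, rel F); last first.
  have free H : coefs_in H -> p H.[x] -> forall i, p H`_i.
    by move=> AH pH i; apply: contrapT => nH; apply: trans; exists H; split=> //; exists i.
  have [i Qi] : exists i, ~ p Q`_i.
    apply: contrapT => h; apply: pb; rewrite bQ; apply: p_horner => i.
    by apply: contrapT => nQ; apply: h; exists i.
  have [e he ei] := dA _ (AQ i) Qi.
  have eQ : map_poly e Q != 0.
    by apply/eqP => /(congr1 (fun q : {poly k} => q`_i)); rewrite (coef_point he) coef0.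
  have [v /rootP ev] := closed_nonrootP _ eQ.
  have [|e' [he' e'E]] := @point_extend e he x v.
    by move=> H AH pH; rewrite (point_poly_p he AH) ?horner0 //; apply: free.
  by exists e' => //; rewrite bQ e'E.
have {F0 hF0} [F [AF pF [i0 Fi0]] Fmin] := min_size hF0.
have F0 : F != 0 by apply/eqP => F0; apply: Fi0; rewrite F0 coef0.
have Fmin' H : coefs_in H -> p H.[x] -> (size H < size F)%N -> forall i, p H`_i.
  by move=> AH pH sH i; apply: contrapT => nH; apply: (Fmin H sH); split=> //; exists i.
have pf : ~ p (lead_coef F).
  move=> /(drop_lead AF F0)[F' [AF' sF' vF' cF']]; apply: (Fmin F' sF'); split=> //.
    exact/(pB_iff (vF' x)).
  by exists i0; rewrite -cF'.
have Af : A (lead_coef F) by apply: AF.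
have red H : coefs_in H -> exists e S R, [/\ coefs_in S, coefs_in R, (size R < size F)%N &
    (lead_coef F ^+ e)%:P * H = S * F + R].
  move=> AH; have [e [S [R [AS AR eR sR _]]]] := pseudo_division AH AF F0.
  by exists e, S, R.
(* A multiple of b outside p of least degree in x has degree 0: otherwise the
   pseudo-division of F by it would give a smaller one, or a relation of degree
   less than that of F. *)
pose mult : set {poly T} := fun H => [/\ coefs_in H, ~ p H.[x] &
  exists2 V, coefs_in V & p (H.[x] - V.[x] * b)].
have [r [Ar pr [V AV prV]]] : exists r, [/\ A r, ~ p r &
    exists2 V, coefs_in V & p (r - V.[x] * b)].
  have hQ : mult Q.
    split=> //; first by rewrite -bQ.
    exists 1; last by rewrite hornerE mul1r bQ subrr.
    by rewrite -[1]/(1%:P); apply/coefs_inC/sub1.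
  have [H [AH pH [V AV pV]] Hmin] := min_size hQ.
  have H0 : H != 0 by apply/eqP => H0; apply: pH; rewrite H0 horner0.
  have Ah : A (lead_coef H) by apply: AH.
  have ph : ~ p (lead_coef H).
    move=> /(drop_lead AH H0)[H' [AH' sH' vH' _]]; apply: (Hmin H' sH'); split=> //.
      by rewrite -(pB_iff (vH' x)).
    exists V => //; rewrite (_ : _ - _ = (H.[x] - V.[x] * b) - (H.[x] - H'.[x])); last ring.
    exact: pB.
  have HF : (size H < size F)%N.
    have [e [S [R [AS AR sR eR]]]] := red H AH.
    have eRx : lead_coef F ^+ e * H.[x] = S.[x] * F.[x] + R.[x].
      by rewrite -hornerM -hornerD -eR hornerM hornerC.
    have [RH|] := leqP (size H) (size R); first exact: leq_ltn_trans sR.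
    move=> /Hmin[]; split=> //.
      move=> pR; apply: (npM (@npX _ e pf) pH).
      by rewrite eRx; apply: pD => //; apply: pM.
    exists ((lead_coef F ^+ e)%:P * V); first by apply: coefs_inM => //; apply/coefs_inC/subX.
    rewrite (_ : _ - _ = lead_coef F ^+ e * (H.[x] - V.[x] * b) - S.[x] * F.[x]).
      by apply: pB; apply: pM.
    by rewrite mulrBr eRx hornerM hornerC; ring.
  have [H1|H1] := leqP (size H) 1.
    have HC := size1_polyC H1; exists H`_0; split; first exact: AH.
      by move: pH; rewrite {1}HC hornerC.
    by exists V => //; move: pV; rewrite {1}HC hornerC.
  exfalso.
  have [e [S [R [AS AR eR sR sS]]]] := pseudo_division AF AH H0.
  have eRx : lead_coef H ^+ e * F.[x] = S.[x] * H.[x] + R.[x].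
    by rewrite -hornerM -hornerD -eR hornerM hornerC.
  have pR : p R.[x].
    apply: contrapT => pR; apply: (Hmin R sR); split=> //.
    exists (- S * V); first by apply: coefs_inM => //; apply: coefs_inN.
    rewrite (_ : _ - _ = lead_coef H ^+ e * F.[x] - S.[x] * (H.[x] - V.[x] * b)).
      by apply: pB; apply: pM.
    by rewrite eRx hornerM hornerN; ring.
  have pS : p S.[x].
    have : p (S.[x] * H.[x]).
      by rewrite -[_ * _](addrK R.[x]) -eRx; apply: pB => //; apply: pM.
    by case/pprime.
  have cS := Fmin' S AS pS; have cR := Fmin' R AR pR (ltn_trans sR HF).
  have {}cS : forall i, p S`_i.
    apply: cS; rewrite (leq_ltn_trans sS) //.
    have := ltn_sub2l (ltn_trans H1 HF) H1.
    by rewrite subn1 -ltnS prednK // (ltn_trans _ HF) // ltnW.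
  apply: (npM (@npX _ e ph) pf).
  have := congr1 (fun q : {poly T} => q`_(size F).-1) eR.
  rewrite /= coefCM => ->; rewrite coefD; apply: pD; last exact: cR.
  by rewrite coefM; apply: p_sum => i; rewrite mulrC; apply: pM.
have [e he efr] := dA _ (subM Af Ar) (npM pf pr).
have [_ _ eM ep] := he.
have ef : e (lead_coef F) <> 0 by move=> ef; apply: efr; rewrite eM // ef mul0r.
have er : e r <> 0 by move=> er; apply: efr; rewrite eM // er mulr0.
have sF1 : (1 < size F)%N.
  rewrite ltnNge; apply/negP => F1; apply: pf; move: pF; rewrite (size1_polyC F1).
  by rewrite hornerC lead_coefC.
have sizeF : (1 < size (map_poly e F))%N.
  rewrite (leq_trans sF1) // -(prednK (ltnW sF1)) ltnNge; apply/negP => /leq_sizeP/(_ _ (leqnn _)).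
  by rewrite (coef_point he).
have [|v /rootP Fv] := closed_rootP (map_poly e F) _.
  by rewrite gtn_eqF.
have [|e' [he' e'E]] := @point_extend e he x v.
  move=> H AH pH; have [n [S [R [AS AR sR eR]]]] := red H AH.
  have eRx : lead_coef F ^+ n * H.[x] = S.[x] * F.[x] + R.[x].
    by rewrite -hornerM -hornerD -eR hornerM hornerC.
  have pR : p R.[x].
    by rewrite -[_.[x]](addKr (S.[x] * F.[x])) -eRx addrC; apply: pB; apply: pM.
  have := congr1 (fun q => (map_poly e q).[v]) eR.
  have AC : coefs_in (lead_coef F ^+ n)%:P by apply/coefs_inC/subX.
  rewrite (point_polyM he) // (point_polyD he) ?(point_polyM he) //; last exact: coefs_inM.
  rewrite (point_poly_p he AR (Fmin' _ AR pR sR)) addr0 !hornerM Fv mulr0.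
  rewrite (point_polyC he) hornerC (pointX he) // => /eqP.
  by rewrite mulf_eq0 expf_eq0 => /orP[/andP[_ /eqP /ef //]|/eqP].
exists e' => // eb; apply: er.
have [_ e'D e'M e'p] := he'.
have e'r : e' r = e r.
  by have := e'E r%:P (coefs_inC Ar); rewrite hornerC (point_polyC he) hornerC.
have Ab : adjoin x b by exists Q.
have AVx : adjoin x V.[x] by exists V.
have AVb : adjoin x (V.[x] * b) by have [_ _] := adjoin_sub x; apply.
have Arr : adjoin x (r - V.[x] * b).
  have [c1 D1 M1] := adjoin_sub x; apply: D1; first exact: adjoin_base.
  by rewrite -mulN1r -(rmorph1 j) -rmorphN; apply: M1.
by rewrite -e'r -[r](subrK (V.[x] * b)) e'D // e'p // add0r e'M // eb mulr0.
Qed.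

End Adjoin.
End PrimeIdeal.

(** Points are dense in [k] itself, and density is preserved by adjoining the
    elements of [ws] one at a time, inside the domain [T / p].  The morphism
    is given as a function on [T], whose values outside [A] are arbitrary. *)
Theorem nullstellensatz (ws : seq T) : exists A e,
  [/\ subalgebra A, forall w, w \in ws -> A w, forall c, e (j c) = c,
      forall x y, A x -> A y -> e (x + y) = e x + e y
    & forall x y, A x -> A y -> e (x * y) = e x * e y].
Proof.
have [p [pD pM p1 [p0 pprime]]] := exists_prime_ideal.
suff [A [Asub Aws dA]] : exists A, [/\ subalgebra A, forall w, w \in ws -> A w &
    dense_points p A].
  have [e [ec eD eM _] _] := dA 1 (sub1 Asub) p1.
  by exists A, e.
elim: ws => [|w ws [A [Asub Aws dA]]].
  exists [set j c | c in setT]%classic; split=> //.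
    split=> [c|_ _ [c _ <-] [c' _ <-]|_ _ [c _ <-] [c' _ <-]]; first by exists c.
      by exists (c + c'); rewrite ?rmorphD.
    by exists (c * c'); rewrite ?rmorphM.
  have pj c : p (j c) -> c = 0.
    move=> pc; apply/eqP; apply: contrapT => /negP c0; apply: p1.
    by rewrite -(rmorph1 j) -(mulVf c0) rmorphM; apply: pM.
  have /choice[e he] x : exists c, forall c', x = j c' -> c = c'.
    have [[c ->]|nx] := pselect (exists c, x = j c); last first.
      by exists 0 => c xc; exfalso; apply: nx; exists c.
    exists c => c' cc'; apply/eqP; rewrite -subr_eq0; apply/eqP/pj.
    by rewrite rmorphB /= cc' subrr.
  have ej c : e (j c) = c by apply: he.
  move=> _ [c _ <-] pc; exists e; last by rewrite ej => c0; apply: pc; rewrite c0 rmorph0.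
  split=> // [_ _ [u _ <-] [v _ <-]|_ _ [u _ <-] [v _ <-]|_ [u _ <-] /pj ->].
  - by rewrite -rmorphD !ej.
  - by rewrite -rmorphM !ej.
  - exact: ej.
exists (adjoin A w); split; first exact: adjoin_sub.
  move=> u; rewrite inE => /orP[/eqP->|/Aws Au]; first exact: adjoin_gen.
  exact: adjoin_base.
exact: dense_adjoin.
Qed.

End Nullstellensatz.

(** * Linear forms vanishing on a space of matrices *)

(** Among the matrices whose row space consists of flattened elements of [U], one
    of maximal rank has all of them; its cokernel supplies the linear forms. *)
Lemma separating_form (F : fieldType) n (U : set 'M[F]_n) (x : 'M[F]_n) :
  U 0 -> (forall a u v, U u -> U v -> U (a *: u + v)) -> ~ U x ->
  exists2 lam : 'M[F]_n, forall u, U u -> \sum_i \sum_j lam i j * u i j = 0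
    & \sum_i \sum_j lam i j * x i j <> 0.
Proof.
move=> U0 UL nx; pose N := (n * n)%N.
pose good r := `[< exists M : 'M[F]_N, \rank M = r /\
  forall v : 'rV_N, (v <= M)%MS -> U (vec_mx v) >].
have good0 : exists r, good r.
  exists 0%N; apply/asboolP; exists 0; rewrite mxrank0; split=> // v.
  by rewrite submx0 => /eqP ->; rewrite linear0.
have goodN r : good r -> (r <= N)%N by move=> /asboolP[M [<- _]]; apply: rank_leq_row.
case: (ex_maxnP good0 goodN) => r /asboolP[M [rM MU]] rmax.
have UM u : U u -> (mxvec u <= M)%MS.
  move=> Uu; apply: contrapT => /negP nu.
  suff : good (\rank (M + mxvec u)%MS).
    move=> /rmax; rewrite leqNgt -rM ltn_neqAle mxrankS ?addsmxSl // andbT.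
    case: eqP => // e _; case/negP: nu; rewrite (submx_trans (addsmxSr M _)) //.
    by have := mxrank_leqif_sup (addsmxSl M (mxvec u)); rewrite /leqif e eqxx => -[_ <-].
  apply/asboolP; exists (M + mxvec u)%MS; split=> // v /sub_addsmxP[[a b] /= ->].
  rewrite linearD /= addrC (mx11_scalar b) mul_scalar_mx linearZ /= mxvecK.
  by apply: UL => //; apply: MU; apply: submxMl.
have nxM : ~~ (mxvec x <= M)%MS.
  by apply/negP => /MU; rewrite mxvecK.
have [q hq] : exists q, (mxvec x *m cokermx M) 0 q != 0.
  move: nxM; rewrite submxE => /eqP h; apply: contrapT => h'; apply: h.
  apply/matrixP => i j; rewrite [RHS]mxE ord1; apply: contrapT => /eqP nz.
  by apply: h'; exists j.
pose lam : 'M[F]_n := \matrix_(i, j) (cokermx M) (mxvec_index i j) q.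
have lamE (u : 'M[F]_n) : \sum_i \sum_j lam i j * u i j = (mxvec u *m cokermx M) 0 q.
  rewrite mxE pair_bigA (reindex _ (curry_mxvec_bij _ _)) /=.
  by apply: eq_bigr => -[i j] _; rewrite /= mxvecE mxE mulrC.
exists lam; last by rewrite lamE; apply/eqP.
by move=> u /UM; rewrite lamE submxE => /eqP ->; rewrite mxE.
Qed.

(** * The coordinate ring of the group as a difference ring *)

Definition cstf (X : Type) (R : Type) (a : R) : X -> R := fun=> a.
Arguments cstf X {R} a.

Section ConstantFunctions.
Variables (X : Type) (R : pzRingType).

Lemma cstf_zmod_morphism : zmod_morphism (@cstf X R).
Proof. by []. Qed.

Lemma cstf_monoid_morphism : monoid_morphism (@cstf X R).
Proof. by []. Qed.

HB.instance Definition _ :=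
  GRing.isZmodMorphism.Build R (X -> R) (@cstf X R) cstf_zmod_morphism.
HB.instance Definition _ :=
  GRing.isMonoidMorphism.Build R (X -> R) (@cstf X R) cstf_monoid_morphism.

Definition evf (x : X) (f : X -> R) : R := f x.

Lemma evf_zmod_morphism x : zmod_morphism (evf x).
Proof. by []. Qed.

Lemma evf_monoid_morphism x : monoid_morphism (evf x).
Proof. by []. Qed.

HB.instance Definition _ x :=
  GRing.isZmodMorphism.Build (X -> R) R (evf x) (evf_zmod_morphism x).
HB.instance Definition _ x :=
  GRing.isMonoidMorphism.Build (X -> R) R (evf x) (evf_monoid_morphism x).

End ConstantFunctions.

(** The points of [G]; the identity, which belongs to every [G] considered, is
    added in order to have a canonical point. *)
Definition pts (K : pzRingType) n (G : set 'M[K]_n) : Type := {x | x = 1 \/ G x}.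

HB.instance Definition _ (K : pzRingType) n (G : set 'M[K]_n) := gen_eqMixin (pts G).
HB.instance Definition _ (K : pzRingType) n (G : set 'M[K]_n) := gen_choiceMixin (pts G).
HB.instance Definition _ (K : pzRingType) n (G : set 'M[K]_n) :=
  isPointed.Build (pts G) (exist _ 1 (or_introl erefl)).

Definition mat (K : pzRingType) n (G : set 'M[K]_n) (o : pts G) : 'M[K]_n := proj1_sig o.

Lemma mat_inj (K : pzRingType) n (G : set 'M[K]_n) : injective (@mat K n G).
Proof.
move=> [x hx] [y hy] /= e; move: e hx hy; rewrite /mat /= => <- hx hy.
by congr exist; apply: Prop_irrelevance.
Qed.

Definition mkpt (K : pzRingType) n (G : set 'M[K]_n) x (hx : G x) : pts G :=
  exist _ x (or_intror hx).

Section UnipotentSums.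
Variables (S : comNzRingType) (m : nat) (u : 'M[S]_m.+1).
Hypothesis bu : band 1 (u - 1).

Lemma unip_entry (i j : 'I_m.+1) : (j <= i)%N -> u i j = (i == j)%:R.
Proof.
move=> ij; have /bandP/(_ i j) := bu; rewrite addn1 ltnS => /(_ ij).
by rewrite !mxE => /eqP; rewrite subr_eq0 => /eqP.
Qed.

Lemma unip_row_sum (y : 'I_m.+1 -> S) i :
  \sum_l u i l * y l = y i + \sum_(l : 'I_m.+1 | (i < l)%N) u i l * y l.
Proof.
rewrite (bigD1 i) //= unip_entry // eqxx mul1r; congr (_ + _).
rewrite [LHS]big_mkcond [RHS]big_mkcond; apply: eq_bigr => l _.
case: (ltngtP i l) => [il|li|/val_inj->].
- by rewrite -val_eqE /= gtn_eqF.
- by rewrite -val_eqE /= ltn_eqF //= unip_entry ?(ltnW li) // -val_eqE /= gtn_eqF // mul0r.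
- by rewrite eqxx.
Qed.

Lemma unip_col_sum (y : 'I_m.+1 -> S) j :
  \sum_l y l * u l j = y j + \sum_(l : 'I_m.+1 | (l < j)%N) u l j * y l.
Proof.
rewrite (bigD1 j) //= unip_entry // eqxx mulr1; congr (_ + _).
rewrite [LHS]big_mkcond [RHS]big_mkcond; apply: eq_bigr => l _; rewrite mulrC.
case: (ltngtP l j) => [il|li|/val_inj->].
- by rewrite -val_eqE /= ltn_eqF.
- by rewrite -val_eqE /= gtn_eqF //= unip_entry ?(ltnW li) // -val_eqE /= gtn_eqF // mul0r.
- by rewrite eqxx.
Qed.

End UnipotentSums.

Section CoordinateRing.
Variables (k : closedFieldType) (K : fieldType) (iota : {rmorphism k -> K}) (sh sh' : {rmorphism K -> K}).
Hypothesis char0 : forall n, n.+1%:R != 0 :> k.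
Hypotheses (shK : cancel sh sh') (sh'K : cancel sh' sh).
Hypothesis sh_iota : forall c, sh (iota c) = iota c.
Hypothesis sh_fixed : forall a, sh a = a -> exists c, a = iota c.
Variables (m : nat) (A B : 'M[k]_m.+1) (s : K).
Hypotheses (bA : band 1 A) (bB : band 1 B) (s0 : s != 0).
Hypothesis sh_pole : forall (a : K) N (c : nat -> k),
  sh a - a = \sum_(i < N) iota (c i) * s^-1 ^+ i.+1 -> forall i, (i < N)%N -> c i = 0.
Local Notation "x %:K" := (map_mx iota x) (at level 2, format "x %:K").

Let char0K := char0_ext iota char0.
Let g := lie_alg A B.
Let g_lie : lie_subalgebra g := lie_alg_lie A B.
Let g_band x : g x -> band 1 x := lie_alg_band bA bB (x := x).
Let gK := scalar_ext iota g.
Let gK_lie : lie_subalgebra gK := scalar_ext_lie iota g_lie.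
Let gK_band v : gK v -> band 1 v := scalar_ext_band g_band.
Let G := exp_group gK.
Let D := rational_gauge iota A B s.

Lemma gauge_log_ext : gK (gauge_log iota A B s).
Proof.
apply: (lie_sum gK_lie) => i _; apply/scalar_ext_scale/scalar_ext_emb => //.
exact: lie_alg_gen.
Qed.

Lemma gauge_mexp : D = mexp (gauge_log iota A B s).
Proof. by rewrite mexp_gauge_log. Qed.

Lemma gauge_group : G D.
Proof. by rewrite gauge_mexp; apply/exp_group_mexp/gauge_log_ext. Qed.

Lemma groupM x y : G x -> G y -> G (x * y).
Proof. exact: exp_groupM. Qed.

Lemma group_mat (o : pts G) : G (mat o).
Proof. by case: o => x []// x1; rewrite /mat /= x1; apply: exp_group1. Qed.

Lemma sh'_iota c : sh' (iota c) = iota c.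
Proof. by rewrite -{1}sh_iota shK. Qed.

Lemma map_sh'_iota (y : 'M[k]_m.+1) : map_mx sh' (mexp y%:K) = mexp y%:K.
Proof.
rewrite map_mexp; last exact: char0_unit.
by congr mexp; apply/matrixP => i j; rewrite !mxE sh'_iota.
Qed.

Lemma group_map_sh' x : G x -> G (map_mx sh' x).
Proof.
move=> [v gv <-]; rewrite map_mexp; last exact: char0_unit.
by apply: exp_group_mexp; apply: scalar_ext_map => //; apply: sh'_iota.
Qed.

Lemma group_const y : g y -> G (mexp y%:K).
Proof. by move=> gy; apply/exp_group_mexp/scalar_ext_emb. Qed.

Lemma theta_subproof (o : pts G) : G (map_mx sh' (D * mat o)).
Proof. by apply/group_map_sh'/groupM; [apply: gauge_group | apply: group_mat]. Qed.

Definition theta (o : pts G) : pts G := mkpt (theta_subproof o).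

Definition transl (w o : pts G) : pts G := mkpt (groupM (group_mat o) (group_mat w)).

(** With [sg] the automorphism of the ring of values, the identity function [Y]
    on the group satisfies [twist sg Y = D Y]. *)
Definition twist (R : Type) (sg : R -> R) (f : pts G -> R) : pts G -> R :=
  fun o => sg (f (theta o)).

Definition polyfun (f : pts G -> K) : Prop :=
  exists2 P, matpoly P & f = P \o @mat _ _ _.

Lemma polyfun_cst a : polyfun (cstf _ a).
Proof. by exists (fun=> a) => //; constructor. Qed.

Definition coord i j : pts G -> K := fun o => mat o i j.

Lemma polyfun_coord i j : polyfun (coord i j).
Proof. by exists (fun x => x i j) => //; constructor. Qed.

Lemma polyfunD f h : polyfun f -> polyfun h -> polyfun (f + h).
Proof. by move=> [P hP ->] [Q hQ ->]; exists (fun x => P x + Q x) => //; constructor. Qed.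

Lemma polyfunM f h : polyfun f -> polyfun h -> polyfun (f * h).
Proof. by move=> [P hP ->] [Q hQ ->]; exists (fun x => P x * Q x) => //; constructor. Qed.

Lemma polyfun_lin a f h : polyfun f -> polyfun h -> polyfun (cstf _ a * f + h).
Proof. by move=> hf hh; apply: polyfunD => //; apply: polyfunM => //; apply: polyfun_cst. Qed.

Lemma polyfunB f h : polyfun f -> polyfun h -> polyfun (f - h).
Proof.
move=> hf hh; rewrite addrC -mulN1r -(rmorph1 (cstf (pts G))) -rmorphN.
exact: polyfun_lin.
Qed.

Lemma polyfun_twist f : polyfun f -> polyfun (twist sh f).
Proof.
move=> [P hP ->]; exists (fun x => sh (P (map_mx sh' (D * x)))) => //.
have h := matpoly_twist sh'K hP.
by have := matpoly_mulmx D 1 h; under eq_fun do rewrite mulr1.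
Qed.

Lemma polyfun_transl w f : polyfun f -> polyfun (f \o transl w).
Proof.
move=> [P hP ->]; exists (fun x => P (x * mat w)) => //.
by have := matpoly_mulmx 1 (mat w) hP; under eq_fun do rewrite mul1r.
Qed.

Lemma theta_transl w o :
  map_mx sh' (mat w) = mat w -> theta (transl w o) = transl w (theta o).
Proof.
by move=> ew; apply: mat_inj; rewrite /= /mat /= !rmorphM /= -/(mat w) ew mulrA.
Qed.

(** Left multiplication by [D] commutes with right translations, and [sh'] with
    the translations by points that it fixes. *)
Lemma twist_transl (R : Type) (sg : R -> R) (f : pts G -> R) (w : pts G) :
  map_mx sh' (mat w) = mat w -> twist sg (f \o transl w) = twist sg f \o transl w.
Proof. by move=> ew; apply: funext => o; rewrite /twist /= theta_transl. Qed.

Lemma twist_endo : semilinear_endo (cstf (pts G)) (twist sh).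
Proof.
split=> [f h|f h| |a]; try by apply: funext => o; rewrite /twist /= ?rmorphD ?rmorphM ?rmorph1.
by exists (sh a).
Qed.

Lemma transl_endo w : semilinear_endo (cstf (pts G)) (fun f : pts G -> K => f \o transl w).
Proof. by split=> // a; exists a. Qed.

Lemma has_flag_poly (Th : set ((pts G -> K) -> pts G -> K)) f :
  (forall th, Th th -> semilinear_endo (cstf (pts G)) th) ->
  (forall i j, has_flag (cstf (pts G)) Th (coord i j)) ->
  polyfun f -> has_flag (cstf (pts G)) Th f.
Proof.
move=> hTh hco [P hP ->].
elim: hP => [a|i j|P1 P2 _ h1 _ h2|P1 P2 _ h1 _ h2].
- exact: (has_flag_scalar hTh a).
- exact: hco.
- exact: (has_flagD h1 h2).
- exact: (has_flagM hTh h1 h2).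
Qed.

(** The twist adds to row [i] of the coordinates a combination of rows of larger
    index. *)
Lemma has_flag_twist f : polyfun f -> has_flag (cstf (pts G)) [set twist sh]%classic f.
Proof.
have hTh th : [set twist sh]%classic th -> semilinear_endo (cstf (pts G)) th.
  by move->; apply: twist_endo.
apply: has_flag_poly => // i j.
have [n ni] := ubnP (m - i); elim: n i ni => // n IH i ni.
apply: (@has_flag_step _ _ _ _ _ (fun l : 'I_m.+1 => (i < l)%N) (fun l => coord l j)).
  move=> l il; apply: IH; rewrite -ltnS (leq_trans _ ni) // ltnS ltn_sub2l //.
  by rewrite (leq_trans il) // -ltnS.
move=> th ->; exists (D i); apply: funext => o.
rewrite fct_sumE -[LHS]/(sh (map_mx sh' (D * mat o) i j) - mat o i j).
rewrite mxE sh'K mxE.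
rewrite (unip_row_sum (exp_group_unip gK_band gauge_group) (fun l => mat o l j)).
by rewrite addrC addKr.
Qed.

Definition const_transl : set ((pts G -> K) -> pts G -> K) :=
  fun th => exists y (gy : g y),
    th = fun f : pts G -> K => f \o transl (mkpt (group_const gy)).

(** A translation adds to column [j] of the coordinates a combination of columns
    of smaller index. *)
Lemma has_flag_transl f : polyfun f -> has_flag (cstf (pts G)) const_transl f.
Proof.
have hTh th : const_transl th -> semilinear_endo (cstf (pts G)) th.
  by move=> [y [gy ->]]; apply: transl_endo.
apply: has_flag_poly => // i j.
have [n nj] := ubnP (nat_of_ord j); elim: n j nj => // n IH j nj.
apply: (@has_flag_step _ _ _ _ _ (fun l : 'I_m.+1 => (l < j)%N) (fun l => coord i l)).
  by move=> l lj; apply: IH; rewrite (leq_trans lj).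
move=> _ [y [gy ->]]; set w := mkpt _.
exists (fun l => mat w l j); apply: funext => o.
rewrite fct_sumE -[LHS]/((mat o * mat w) i j - mat o i j) mxE.
rewrite (unip_col_sum (exp_group_unip gK_band (group_mat w)) (fun l => mat o i l)).
by rewrite addrC addKr.
Qed.

(** The functional equation for a general element of the extended Lie algebra,
    in the form needed for [log D]. *)
Lemma additive_comb (f : 'M[K]_m.+1 -> K) phi I (r : seq I) (a : I -> K) (x : I -> 'M[k]_m.+1) :
  matpoly f ->
  (forall y, g y -> forall x, G x -> f (x * mexp y%:K) = f x + iota (phi y)) ->
  (forall i, g (x i)) ->
  f (mexp (\sum_(i <- r) a i *: (x i)%:K)) = f 1 + \sum_(i <- r) a i * iota (phi (x i)).
Proof.
move=> hf ftr gx; elim: r => [|i r IH]; first by rewrite !big_nil mexp0 addr0.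
rewrite !big_cons (additive_scalar_ext char0 g_lie g_band hf ftr) //.
  by rewrite IH addrAC addrA.
by apply: (lie_sum gK_lie) => j _; apply/scalar_ext_scale/scalar_ext_emb.
Qed.

(** An invariant function of least height in the flag of the translations is,
    up to a constant, a homomorphism from the group to the additive group, given
    by a linear form [phi] that vanishes on brackets.  Its invariance reads
    [sh a - a = - phi (log D)] for a rational [a], which forces [phi] to vanish
    on the generators. *)
Theorem twist_fixed f : polyfun f -> twist sh f = f -> exists c, f = cstf _ (iota c).
Proof.
move=> pf ff; apply: contrapT => nC.
pose N : set (pts G -> K) := fun u => polyfun u /\ twist sh u = u.
pose C : set (pts G -> K) := fun u => exists c, u = cstf _ (iota c).
have hTh th : const_transl th -> semilinear_endo (cstf (pts G)) th.
  by move=> [y [gy ->]]; apply: transl_endo.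
have NB u v : N u -> N v -> N (u - v).
  move=> [pu eu] [pv ev]; split; first exact: polyfunB.
  by rewrite (endoB twist_endo) eu ev.
have Nth th u : const_transl th -> N u -> N (th u).
  move=> [y [gy ->]] [pu eu]; split; first exact: polyfun_transl.
  by rewrite twist_transl ?eu // /mat /= map_sh'_iota.
have C0 : C 0 by exists 0; rewrite rmorph0.
have thc th a : const_transl th -> th (cstf (pts G) a) = cstf (pts G) a.
  by move=> [y [gy ->]].
have [v [[[P hP vP] vfix] nCv vtr]] :=
  flag_affine_vector hTh thc NB Nth (has_flag_transl pf) (conj pf ff) nC C0.
have /choice[phi hphi] y : exists c, forall gy : g y,
    forall o, v (transl (mkpt (group_const gy)) o) = v o + iota c.
  have [gy|ngy] := pselect (g y); last by exists 0.
  have [c ec] := vtr _ (ex_intro _ y (ex_intro _ gy erefl)).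
  exists c => gy' o; rewrite (Prop_irrelevance gy' gy).
  by move/(congr1 (fun u : pts G -> K => u o)): ec => /= /eqP; rewrite subr_eq addrC => /eqP.
have ftr y : g y -> forall x, G x -> P (x * mexp y%:K) = P x + iota (phi y).
  by move=> gy x hx; have := hphi y gy (mkpt hx); rewrite vP.
have gauge_eq : sh (P 1) - P 1 =
    \sum_(i < m) iota (- phi (L_series A B i.+1)) * s^-1 ^+ i.+1.
  pose l := gauge_log iota A B s.
  have gl : gK (- l) by apply: (lieN gK_lie); apply: gauge_log_ext.
  have : v (mkpt (exp_group_mexp gl)) = sh (P 1).
    rewrite -vfix /twist vP /=; congr (sh (P _)).
    rewrite /mat /= gauge_mexp mexpN ?rmorph1 //; first exact: char0_unit.
    by apply: gK_band; apply: gauge_log_ext.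
  rewrite vP /= /l /gauge_log -sumrN => <-.
  rewrite (eq_bigr (fun i : 'I_m => - s^-1 ^+ i.+1 *: (L_series A B i.+1)%:K)).
    2: by move=> i _; rewrite scaleNr.
  rewrite (additive_comb _ _ hP ftr) => [|i]; last exact: lie_alg_gen.
  rewrite addrC addKr; apply: eq_bigr => i _.
  by rewrite rmorphN mulrC mulrN mulNr.
have phiL i : (i < m)%N -> phi (L_series A B i.+1) = 0.
  move=> im; have /(_ i im)/eqP := @sh_pole _ m (fun i => - phi (L_series A B i.+1)) gauge_eq.
  by rewrite oppr_eq0 => /eqP.
pose h : set 'M[k]_m.+1 := fun x => g x /\ phi x = 0.
have h_lie : lie_subalgebra h.
  have Z := additive_scale char0 g_lie g_band hP ftr.
  split=> [|a x y [gx x0] [gy y0]|x y [gx x0] [gy y0]].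
  - by split; [exact: (lie0 g_lie)|rewrite -(scale0r (0 : 'M[k]_m.+1)) Z ?mul0r //; apply: lie0].
  - split; first by case: g_lie => _ gL _; apply: gL.
    rewrite (additive_add char0 g_lie g_band hP ftr) ?Z ?x0 ?y0 ?mulr0 ?addr0 //.
    exact: (lieZ g_lie).
  - split; first exact: (lie_ad g_lie gx gy).
    exact: (additive_ad char0 g_lie g_band hP ftr gy gx).
have phi0 x : g x -> phi x = 0.
  have hL i : (i < m)%N -> h (L_series A B i.+1).
    by move=> im; split; [apply: lie_alg_gen | apply: phiL].
  by case/(lie_alg_ind h_lie hL).
have Pc w : gK w -> P (mexp w) = P 1.
  elim=> [|a x u gx gu IH]; first by rewrite mexp0.
  by rewrite (additive_scalar_ext char0 g_lie g_band hP ftr) // phi0 // rmorph0 mulr0 addr0.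
have [c Pc1] : exists c, P 1 = iota c.
  apply: sh_fixed; apply/eqP; rewrite -subr_eq0 gauge_eq big1 // => i _.
  by rewrite phiL // oppr0 rmorph0 mul0r.
apply: nCv; exists c; rewrite vP; apply: funext => o /=.
by have [w gw <-] := group_mat o; rewrite Pc.
Qed.

(** The first vector of the flag of the twist that meets [J] gives an invariant
    function in [J], which is a constant. *)
Corollary twist_simple (J : set (pts G -> K)) f :
  (forall u, J u -> polyfun u) ->
  (forall a u v, J u -> J v -> J (cstf _ a * u + v)) ->
  (forall u, J u -> J (twist sh u)) -> J f -> f <> 0 -> J 1.
Proof.
move=> Jp Jlin Jtw Jf f0.
have [v [Jv v0 ev]] := flag_fixed_vector twist_endo Jlin Jtw (has_flag_twist (Jp _ Jf)) Jf f0.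
have [c vc] := twist_fixed (Jp _ Jv) ev.
have c0 : iota c != 0 by apply/eqP => c0; apply: v0; rewrite vc c0 rmorph0.
have J0 : J 0.
  by have := Jlin (- 1) _ _ Jv Jv; rewrite rmorphN rmorph1 mulN1r addNr.
have := Jlin (iota c)^-1 _ _ Jv J0.
by rewrite addr0 vc -rmorphM mulVf // rmorph1.
Qed.

(** * Specialization of a Picard-Vessiot ring *)

Section TwistMorphism.
Variables (S : pzRingType) (f : {rmorphism S -> S}).
Implicit Types t u : pts G -> S.

Lemma twist0 : twist f 0 = 0.
Proof. by apply: funext => o; exact: (rmorph0 f). Qed.

Lemma twistD t u : twist f (t + u) = twist f t + twist f u.
Proof. by apply: funext => o; exact: (rmorphD f). Qed.

Lemma twistN t : twist f (- t) = - twist f t.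
Proof. by apply: funext => o; exact: (rmorphN f). Qed.

Lemma twistB t u : twist f (t - u) = twist f t - twist f u.
Proof. by rewrite twistD twistN. Qed.

Lemma twistM t u : twist f (t * u) = twist f t * twist f u.
Proof. by apply: funext => o; exact: (rmorphM f). Qed.

End TwistMorphism.

Section PicardVessiotRing.
Variables (R : comUnitAlgType K) (sg : {rmorphism R -> R}).
Hypothesis sg_ext : forall a : K, sg a%:A = (sh a)%:A.
Hypothesis sg_simple : forall I : {pred R}, idealr_closed I ->
  (forall x, x \in I -> sg x \in I) -> forall x, x \in I -> x = 0.

Local Notation al := (in_alg R).
Local Notation T := (pts G -> R).
Local Notation T0 := (pts G -> K).
Local Notation sgT := (twist sg).
Local Notation shT := (twist sh).
Local Notation cst := (cstf (pts G)).

Definition emb (f : T0) : T := fun o => al (f o).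

Lemma embD f h : emb (f + h) = emb f + emb h.
Proof. by apply: funext => o; rewrite /emb rmorphD. Qed.

Lemma embB f h : emb (f - h) = emb f - emb h.
Proof. by apply: funext => o; rewrite /emb rmorphB. Qed.

Lemma embM f h : emb (f * h) = emb f * emb h.
Proof. by apply: funext => o; rewrite /emb rmorphM. Qed.

Lemma emb1 : emb 1 = 1.
Proof. by apply: funext => o; rewrite /emb rmorph1. Qed.

Lemma emb0 : emb 0 = 0.
Proof. by apply: funext => o; rewrite /emb rmorph0. Qed.

Lemma emb_twist f : sgT (emb f) = emb (shT f).
Proof. by apply: funext => o; rewrite /twist /emb /= sg_ext. Qed.

Definition jT : {rmorphism k -> T} := cst \o (al \o iota).

Lemma jT_emb c : jT c = emb (cst (iota c)).
Proof. by []. Qed.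

Lemma sgT_jT c : sgT (jT c) = jT c.
Proof. by rewrite jT_emb emb_twist; apply: funext => o; rewrite /emb /twist /cstf sh_iota. Qed.

Section LinearDisjointness.
Variables (C : set T) (eps : T -> k).
Hypotheses (C_sub : subalgebra jT C) (C_inv : forall w, C w -> sgT w = w)
  (eps_j : forall c, eps (jT c) = c)
  (epsD : forall x y, C x -> C y -> eps (x + y) = eps x + eps y)
  (epsM : forall x y, C x -> C y -> eps (x * y) = eps x * eps y).

Definition sp (w : T) : T0 := cst (iota (eps w)).

Lemma twist_sp w : shT (sp w) = sp w.
Proof. by apply: funext => o; rewrite /twist /sp /cstf sh_iota. Qed.

(** [t] is a combination of [vs] over the coordinate ring, and [h] is the same
    combination of their specializations. *)
Fixpoint comb (vs : seq T) (t : T) (h : T0) : Prop :=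
  if vs is v :: vs' then
    exists2 f, polyfun f & comb vs' (t - emb f * v) (h - f * sp v)
  else t = 0 /\ h = 0.

Fixpoint indep (vs : seq T) : Prop :=
  if vs is v :: vs' then [/\ C v, ~ kspan jT vs' v & indep vs'] else True.

Lemma comb_lin vs a t h u l : polyfun a -> comb vs t h -> comb vs u l ->
  comb vs (emb a * t + u) (a * h + l).
Proof.
move=> pa; elim: vs t h u l => [t h u l [-> ->] [-> ->]|v vs IH t h u l [f pf cf] [f' pf' cf']] /=.
  by rewrite !mulr0 !addr0.
exists (a * f + f'); first by apply: polyfunD => //; apply: polyfunM.
have := IH _ _ _ _ cf cf'; congr comb; rewrite ?embD ?embM; ring.
Qed.

Lemma combB vs t h u l : comb vs t h -> comb vs u l -> comb vs (t - u) (h - l).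
Proof.
move=> ct cu; have := comb_lin (polyfun_cst (- 1)) cu ct.
have -> : emb (cst (- 1)) = - 1.
  by apply: funext => o; rewrite /emb /cstf rmorphN rmorph1.
have -> : cst (- 1) = - 1 by [].
by rewrite !mulN1r ![- _ + _]addrC.
Qed.

Lemma comb_twist vs t h : indep vs -> comb vs t h -> comb vs (sgT t) (shT h).
Proof.
elim: vs t h => [t h _ [-> ->]|v vs IH t h [Cv _ iv] [f pf cf]] /=.
  by rewrite !twist0.
exists (shT f); first exact: polyfun_twist.
have := IH _ _ iv cf; rewrite twistB twistM emb_twist (C_inv Cv).
by rewrite twistB twistM twist_sp.
Qed.

(** Twist-invariant elements that are independent over [k] stay independent over
    the coordinate ring, since the coefficients of relations form twist-stable
    subspaces. *)
Lemma comb_head_eq0 v vs f h : (forall t h', comb vs t h' -> sgT t = t -> kspan jT vs t) ->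
  indep (v :: vs) -> polyfun f -> comb vs (- (emb f * v)) h -> f = 0.
Proof.
move=> inv_span [Cv nv iv] pf cf; apply: contrapT => f0.
pose J : set T0 := fun u => polyfun u /\ exists l, comb vs (- (emb u * v)) l.
have [||//|_ [l cl]] := @twist_simple J f _ _ _ (conj pf (ex_intro _ h cf)) f0.
- by move=> u [].
- move=> a u w [pu [l cl]] [pw [l' cl']]; split; first exact: polyfun_lin.
  exists (cst a * l + l'); have := comb_lin (polyfun_cst a) cl cl'; congr comb.
  by rewrite embD embM; ring.
- move=> u [pu [l cl]]; split; first exact: polyfun_twist.
  exists (shT l); have := comb_twist iv cl; congr comb.
  by rewrite twistN twistM emb_twist (C_inv Cv).
- apply: nv; have : kspan jT vs (- v).
    apply: (inv_span _ l); first by move: cl; rewrite emb1 mul1r.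
    by rewrite twistN (C_inv Cv).
  by move=> /(kspanZ (- 1)); rewrite rmorphN rmorph1 mulN1r opprK.
Qed.

(** Comparing an invariant combination with its twist gives a relation whose
    coefficients are the [shT f - f]; these vanish, so the coefficients lie in
    [k]. *)
Lemma comb_inv_span vs t h : indep vs -> comb vs t h -> sgT t = t -> kspan jT vs t.
Proof.
elim: vs t h => [t h _ [-> _]|v vs IH t h] //= [Cv nv iv] [f pf cf] et.
have IH' := fun t h => IH t h iv.
have ff : shT f = f.
  have := combB (comb_twist iv cf) cf.
  rewrite twistB twistM emb_twist et (C_inv Cv) => cd.
  have := @comb_head_eq0 v vs (shT f - f) _ IH' (And3 Cv nv iv) (polyfunB (polyfun_twist pf) pf).
  move=> H; apply/eqP; rewrite -subr_eq0; apply/eqP; apply: H.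
  by move: cd; congr comb; rewrite embB; ring.
have [c fc] := twist_fixed pf ff.
exists c; apply: (IH' _ (h - f * sp v)); first by have := cf; rewrite {1}fc.
by rewrite twistB twistM sgT_jT (C_inv Cv) et.
Qed.

Lemma comb_eq0 vs h : indep vs -> comb vs 0 h -> h = 0.
Proof.
elim: vs h => [h _ []|v vs IH h] //= [Cv nv iv] [f pf cf].
have f0 : f = 0.
  apply: (@comb_head_eq0 v vs f (h - f * sp v)) => //; last by move: cf; rewrite sub0r.
  by move=> t h'; apply: comb_inv_span.
by move: cf; rewrite f0 emb0 !mul0r !subr0; apply: IH.
Qed.

Lemma indep_C vs w : indep vs -> kspan jT vs w -> C w.
Proof.
have [C1 CD CM] := C_sub.
elim: vs w => [w _ ->|v vs IH w [Cv _ iv] [c hw]]; first by rewrite -(rmorph0 jT).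
by rewrite -[w](subrK (jT c * v)); apply: CD; [apply: IH hw|apply: CM].
Qed.

Lemma comb_span vs w f t h : indep vs -> kspan jT vs w -> polyfun f -> comb vs t h ->
  comb vs (emb f * w + t) (f * sp w + h).
Proof.
move=> + + pf; elim: vs w t h => [w t h _ -> [-> ->]|v vs IH w t h [Cv nv iv] [c hw] [f0 pf0 cf0]] /=.
  have -> : sp 0 = 0 by rewrite /sp -(rmorph0 jT) eps_j rmorph0.
  by rewrite !mulr0 !addr0.
have Cw := indep_C iv hw.
have [C1 CD CM] := C_sub.
have spw : sp w = sp (w - jT c * v) + cst (iota c) * sp v.
  rewrite {1}/sp -{1}[w](subrK (jT c * v)) epsD //; last exact: CM.
  by rewrite epsM // eps_j rmorphD rmorphM.
exists (f0 + f * cst (iota c)).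
  by apply: polyfunD => //; apply: polyfunM => //; apply: polyfun_cst.
have := IH _ _ _ iv hw cf0; rewrite spw embD embM -jT_emb; congr comb; ring.
Qed.

(** The graph of the specialization along [eps] of the subring generated by the
    coordinate ring and [C]. *)
Inductive spec : T -> T0 -> Prop :=
| spec0 : spec 0 0
| spec_step f w t h : polyfun f -> C w -> spec t h ->
    spec (emb f * w + t) (f * sp w + h).

(** Elements of [C] are rewritten in a family independent over [k], where
    coefficients, hence specializations, are unique. *)
Lemma spec_comb t h : spec t h -> exists2 vs, indep vs & comb vs t h.
Proof.
elim=> [|f w {}t {}h pf Cw _ [vs iv cv]]; first by exists [::].
have [sw|nw] := pselect (kspan jT vs w).
  by exists vs => //; apply: comb_span.
exists (w :: vs) => //=; exists f => //.
by move: cv; congr comb; ring.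
Qed.

Lemma spec_eq0 h : spec 0 h -> h = 0.
Proof. by move/spec_comb => [vs iv /(comb_eq0 iv)]. Qed.

Lemma specD t h u l : spec t h -> spec u l -> spec (t + u) (h + l).
Proof.
by move=> st su; elim: st => [|f w t' h' pf Cw _ IH]; rewrite ?add0r // -!addrA; constructor.
Qed.

Lemma spec_mul f w t h : polyfun f -> C w -> spec t h -> spec (emb f * w * t) (f * sp w * h).
Proof.
have [C1 CD CM] := C_sub.
move=> pf Cw; elim=> [|f' w' t' h' pf' Cw' _ IH]; first by rewrite !mulr0; constructor.
have := spec_step (polyfunM pf pf') (CM _ _ Cw Cw') IH.
rewrite embM {1}/sp epsM // rmorphM rmorphM -/(sp w) -/(sp w'); congr spec; ring.
Qed.

Lemma specM t h u l : spec t h -> spec u l -> spec (t * u) (h * l).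
Proof.
move=> st su; elim: st => [|f w t' h' pf Cw _ IH]; first by rewrite !mul0r; constructor.
by rewrite !mulrDl; apply: specD => //; apply: spec_mul.
Qed.

Lemma spec_emb f : polyfun f -> spec (emb f) f.
Proof.
have [C1 _ _] := C_sub; move=> pf; have := spec_step pf (C1 1) spec0.
by rewrite /sp eps_j !rmorph1 !mulr1 !addr0.
Qed.

Lemma spec_C w : C w -> spec w (sp w).
Proof.
move=> Cw; have := spec_step (polyfun_cst 1) Cw spec0.
by rewrite (_ : emb _ = 1) ?emb1 // (_ : cst 1 = 1) // !mul1r !addr0.
Qed.

Lemma specN t h : spec t h -> spec (- t) (- h).
Proof.
move=> st; have := specM (spec_emb (polyfun_cst (- 1))) st.
have -> : emb (cst (- 1)) = - 1.
  by apply: funext => o; rewrite /emb /cstf rmorphN rmorph1.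
by have -> : cst (- 1) = - 1 by []; rewrite !mulN1r.
Qed.

Lemma spec_fun t h l : spec t h -> spec t l -> h = l.
Proof.
move=> sh1 sh2; have := specD sh1 (specN sh2); rewrite subrr => /spec_eq0 /eqP.
by rewrite subr_eq0 => /eqP.
Qed.

Lemma spec_twist t h : spec t h -> spec (sgT t) (shT h).
Proof.
elim=> [|f w t' h' pf Cw _ IH].
  by rewrite !twist0; constructor.
have := spec_step (polyfun_twist pf) Cw IH.
by rewrite !twistD !twistM emb_twist (C_inv Cw) twist_sp.
Qed.

End LinearDisjointness.

Variable Z : 'M[R]_m.+1.
Hypotheses (Zu : Z \in unitmx) (Zeq : map_mx sg Z = map_mx al D *m Z)
  (Zgen : forall S : {pred R}, GRing.subalg_closed S ->
     (forall i j, Z i j \in S) -> (\det Z)^-1 \in S -> forall x, x \in S).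

Lemma mat_unit (o : pts G) : mat o \in unitmx.
Proof. by have [v gv <-] := group_mat o; apply/mexp_unit/gK_band => //; apply: char0_unit. Qed.

Lemma D_unit : D \in unitmx.
Proof.
by rewrite gauge_mexp; apply/mexp_unit/gK_band/gauge_log_ext; apply: char0_unit.
Qed.

Lemma map_sg_al (M : 'M[K]_m.+1) : map_mx sg (map_mx al M) = map_mx al (map_mx sh M).
Proof. by apply/matrixP => i j; rewrite !mxE /= sg_ext. Qed.

Lemma map_shK (M : 'M[K]_m.+1) : map_mx sh (map_mx sh' M) = M.
Proof. by apply/matrixP => i j; rewrite !mxE sh'K. Qed.

(** The quotient of the two solutions [mat o] and [Z] of the same system. *)
Definition Wmx (o : pts G) : 'M[R]_m.+1 := map_mx al (invmx (mat o)) *m Z.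
Definition W'mx (o : pts G) : 'M[R]_m.+1 := invmx Z *m map_mx al (mat o).
Definition W i j : T := fun o => Wmx o i j.
Definition W' i j : T := fun o => W'mx o i j.

Lemma mul_Wmx o : map_mx al (mat o) *m Wmx o = Z.
Proof. by rewrite mulmxA -map_mxM mulmxV ?mat_unit // map_mx1 mul1mx. Qed.

Lemma Wmx_W' o : Wmx o *m W'mx o = 1%:M.
Proof.
rewrite /W'mx /Wmx mulmxA -[_ *m Z *m _]mulmxA mulmxV // mulmx1 -map_mxM.
by rewrite mulVmx ?mat_unit // map_mx1.
Qed.

Lemma invZ_W' o : W'mx o *m map_mx al (invmx (mat o)) = invmx Z.
Proof. by rewrite -mulmxA -map_mxM mulmxV ?mat_unit // map_mx1 mulmx1. Qed.

Lemma sg_Wmx o : map_mx sg (Wmx (theta o)) = Wmx o.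
Proof.
have e := congr1 (map_mx sg) (mul_Wmx (theta o)).
rewrite map_mxM map_sg_al /mat /= map_shK Zeq -/(mat o) in e.
have u : map_mx al (D * mat o) \in unitmx.
  by rewrite map_unitmx unitmx_mul D_unit mat_unit.
have eD : map_mx al D *m Z = map_mx al (D * mat o) *m Wmx o.
  by rewrite -{1}(mul_Wmx o) mulmxA -map_mxM.
by rewrite -[LHS]mul1mx -(mulVmx u) -mulmxA e eD mulmxA mulVmx // mul1mx.
Qed.

Lemma W_inv i j : sgT (W i j) = W i j.
Proof.
by apply: funext => o; rewrite /twist /W -[in RHS]sg_Wmx [RHS]mxE.
Qed.

Lemma W'_inv i j : sgT (W' i j) = W' i j.
Proof.
apply: funext => o; rewrite /twist /W'; suff -> : W'mx o = map_mx sg (W'mx (theta o)) by rewrite [RHS]mxE.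
have u : Wmx o \in unitmx by case: (mulmx1_unit (Wmx_W' o)).
have e := congr1 (map_mx sg) (Wmx_W' (theta o)).
rewrite map_mxM sg_Wmx map_mx1 in e.
by rewrite -[LHS]mul1mx -(mulVmx u) -mulmxA Wmx_W' -e mulmxA mulVmx // mul1mx.
Qed.

Lemma matpoly_unip_inv i j : matpoly (fun x : 'M[K]_m.+1 => (\sum_(n < m.+1) (1 - x) ^+ n) i j).
Proof.
under eq_fun do rewrite summxE; apply: matpoly_sum => n.
elim: (nat_of_ord n) i j => [|l IH] i j.
  by under eq_fun do rewrite expr0; constructor.
under eq_fun do rewrite exprS mxE; apply: matpoly_sum => q.
apply: matpolyM; last exact: IH.
under eq_fun do rewrite !mxE -mulN1r.
by constructor; [constructor|apply: matpolyM; constructor].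
Qed.

(** The entries of the inverse are polynomial because the geometric series is
    finite. *)
Lemma unip_inv (x : 'M[K]_m.+1) : band 1 (x - 1) -> invmx x = \sum_(n < m.+1) (1 - x) ^+ n.
Proof.
move=> bx; have e : x * (\sum_(n < m.+1) (1 - x) ^+ n) = 1.
  have b : band 1 (1 - x) by rewrite -opprB; apply: bandN.
  rewrite -{1}[x](subKr 1) -opprB mulNr -subrX1 band1_nilp // sub0r opprK //.
have [u _] := mulmx1_unit e.
have e' : x *m (\sum_(n < m.+1) (1 - x) ^+ n) = 1%:M := e.
by rewrite -[RHS]mul1mx -(mulVmx u) -mulmxA e' mulmx1.
Qed.

Lemma polyfun_inv i j : polyfun (fun o => invmx (mat o) i j).
Proof.
exists (fun x : 'M[K]_m.+1 => (\sum_(n < m.+1) (1 - x) ^+ n) i j); first exact: matpoly_unip_inv.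
apply: funext => o /=; rewrite unip_inv //.
exact: (exp_group_unip gK_band (group_mat o)).
Qed.

Lemma subalg_closed_det (S : {pred R}) n (M : 'M[R]_n) : GRing.subalg_closed S ->
  (forall i j, M i j \in S) -> \det M \in S.
Proof.
move=> [S1 SL SM] hM.
have S0 : 0 \in S by rewrite -(addNr 1) -scaleN1r; apply: SL.
have SD : {in S &, forall u v, u + v \in S} by move=> u v hu hv; rewrite -[u]scale1r; apply: SL.
have SN1 : -1 \in S by rewrite -[-1]addr0 -scaleN1r; apply: SL.
apply: (big_ind (fun x => x \in S)) => [//|u v hu hv|s' _]; first exact: SD.
apply: (SM); first by case: (perm.odd_perm s'); rewrite ?expr0 ?expr1.
apply: (big_ind (fun x => x \in S)) => [//|u v hu hv|i _]; last exact: hM.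
exact: SM.
Qed.

Lemma eps_sum (C : set T) (eps : T -> k) n (f : 'I_n -> T) :
  subalgebra jT C -> (forall c, eps (jT c) = c) ->
  (forall x y, C x -> C y -> eps (x + y) = eps x + eps y) ->
  (forall i, C (f i)) -> C (\sum_i f i) /\ eps (\sum_i f i) = \sum_i eps (f i).
Proof.
move=> [C1 CD _] ej eD hf; elim/big_ind2: _ => [|x1 x2 y1 y2 [c1 e1] [c2 e2]|i _] //.
  by split; [rewrite -(rmorph0 jT); apply: C1|rewrite -[0 in LHS](rmorph0 jT) ej].
by split; [apply: CD|rewrite eD // e1 e2].
Qed.

(** Every element of [R], as a constant function on the group, lies in the subring
    generated by the coordinate ring and the invariants [W], [W'], because
    [Z = Y W] and [Z^-1 = W' Y^-1] have their entries there.  The specialization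
    at a rational point thus restricts to [R]; its kernel is a difference ideal,
    hence zero. *)
Theorem specialization : exists (rho : R -> T0) (P : 'M[k]_m.+1),
  [/\ P \in unitmx,
      (forall x y, rho (x + y) = rho x + rho y) /\
      (forall x y, rho (x * y) = rho x * rho y),
      forall a, rho a%:A = cst a,
      (forall x, rho (sg x) = shT (rho x)) /\ (forall x, rho x = 0 -> x = 0)
    & forall i j o, rho (Z i j) o = (mat o *m map_mx iota P) i j].
Proof.
pose ws : seq T := [seq W ij.1 ij.2 | ij <- enum {: 'I_m.+1 * 'I_m.+1}] ++
  [seq W' ij.1 ij.2 | ij <- enum {: 'I_m.+1 * 'I_m.+1}].
have [Al [eps [[A1 AD AM] Aws ej eD eM]]] := nullstellensatz jT ws.
have AW i j : Al (W i j).
  apply: Aws; rewrite mem_cat; apply/orP; left.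
  by apply/mapP; exists (i, j); rewrite ?mem_enum.
have AW' i j : Al (W' i j).
  apply: Aws; rewrite mem_cat; apply/orP; right.
  by apply/mapP; exists (i, j); rewrite ?mem_enum.
pose C : set T := fun w => Al w /\ sgT w = w.
have Csub : subalgebra jT C.
  split=> [c|x y [Ax ex] [Ay ey]|x y [Ax ex] [Ay ey]].
  - by split; [apply: A1|apply: sgT_jT].
  - by split; [apply: AD|rewrite twistD ex ey].
  - by split; [apply: AM|rewrite twistM ex ey].
have Cinv w : C w -> sgT w = w by case.
have CW i j : C (W i j) by split; [apply: AW|apply: W_inv].
have CW' i j : C (W' i j) by split; [apply: AW'|apply: W'_inv].
have eDC x y : C x -> C y -> eps (x + y) = eps x + eps y.
  by move=> [Ax _] [Ay _]; apply: eD.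
have eMC x y : C x -> C y -> eps (x * y) = eps x * eps y.
  by move=> [Ax _] [Ay _]; apply: eM.
pose sp1 := spec C eps.
have spec_sum n (t : 'I_n -> T) (h : 'I_n -> T0) :
    (forall i, sp1 (t i) (h i)) -> sp1 (\sum_i t i) (\sum_i h i).
  by move=> th; elim/big_ind2: _ => // *; [constructor|apply: specD].
have spZ i j : sp1 (cstf _ (Z i j)) (\sum_l coord i l * sp eps (W l j)).
  have -> : cstf (pts G) (Z i j) = \sum_l emb (coord i l) * W l j.
    apply: funext => o; rewrite fct_sumE /cstf -{1}(mul_Wmx o) mxE.
    by apply: eq_bigr => l _; rewrite mxE.
  apply: spec_sum => l; apply: (specM Csub eMC).
    exact: (spec_emb Csub ej (polyfun_coord i l)).
  exact: spec_C.
have total x : exists h, sp1 (cstf _ x) h.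
  pose S : {pred R} := [pred x | `[< exists h, sp1 (cstf _ x) h >]].
  have SP y : reflect (exists h, sp1 (cstf _ y) h) (y \in S) by exact: asboolP.
  have Scl : GRing.subalg_closed S.
    split=> [|a u v /SP[h hu] /SP[l hv]|u v /SP[h hu] /SP[l hv]]; apply/SP.
    - exists 1; have := spec_emb Csub ej (polyfun_cst 1).
      by rewrite (_ : cst 1 = 1) // emb1.
    - exists (cst a * h + l).
      have := specD (specM Csub eMC (spec_emb Csub ej (polyfun_cst a)) hu) hv.
      congr spec; apply: funext => o; rewrite /cstf /emb.
      by rewrite -[LHS]/(a%:A * u + v) mulr_algl.
    - by exists (h * l); exact: (specM Csub eMC hu hv).
  apply/SP; apply: Zgen => // [i j|]; first by apply/SP; exists (\sum_l coord i l * sp eps (W l j)).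
  rewrite -det_inv; apply: subalg_closed_det => // i j; apply/SP.
  exists (\sum_l sp eps (W' i l) * (fun o => invmx (mat o) l j)).
  have -> : cstf (pts G) (invmx Z i j) = \sum_l W' i l * emb (fun o => invmx (mat o) l j).
    apply: funext => o; rewrite fct_sumE /cstf -{1}(invZ_W' o) mxE.
    by apply: eq_bigr => l _; rewrite [X in _ * X]mxE.
  apply: spec_sum => l; apply: (specM Csub eMC); first exact: spec_C.
  exact: (spec_emb Csub ej (polyfun_inv l j)).
have [rho hrho] := choice total.
have uniq x h : sp1 (cstf _ x) h -> rho x = h.
  by move=> hx; apply: (spec_fun Csub Cinv ej eDC eMC (hrho x) hx).
pose P : 'M[k]_m.+1 := \matrix_(i, j) eps (W i j).
pose P' : 'M[k]_m.+1 := \matrix_(i, j) eps (W' i j).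
have PP' : P *m P' = 1%:M.
  apply/matrixP => i j; rewrite !mxE.
  have -> : \sum_l P i l * P' l j = \sum_l eps (W i l * W' l j).
    by apply: eq_bigr => l _; rewrite !mxE eMC.
  have [|_ <-] := eps_sum Csub ej eDC (f := fun l => W i l * W' l j).
    by move=> l; have [_ _ CM] := Csub; apply: CM.
  rewrite -[RHS]ej; congr eps; apply: funext => o; rewrite fct_sumE.
  have /matrixP/(_ i j) := Wmx_W' o; rewrite !mxE => e.
  by rewrite -[LHS]/(\sum_l Wmx o i l * W'mx o l j) e /jT /= rmorph_nat /cstf; exact: esym (rmorph_nat al _).
exists rho, P; split.
- by case: (mulmx1_unit PP').
- split=> x y; apply: uniq.
    exact: (specD (hrho x) (hrho y)).
  exact: (specM Csub eMC (hrho x) (hrho y)).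
- by move=> a; apply: uniq; exact: (spec_emb Csub ej (polyfun_cst a)).
- have rhoM x y : rho (x * y) = rho x * rho y.
    by apply: uniq; exact: (specM Csub eMC (hrho x) (hrho y)).
  have rhoD x y : rho (x + y) = rho x + rho y.
    by apply: uniq; exact: (specD (hrho x) (hrho y)).
  have rhosg x : rho (sg x) = shT (rho x).
    by apply: uniq; exact: (spec_twist Cinv (hrho x)).
  have rho1 : rho 1 = 1.
    apply: uniq; have := spec_emb Csub ej (polyfun_cst 1).
    by rewrite (_ : cst 1 = 1) // emb1.
  have rho0 : rho 0 = 0 by apply: (addrI (rho 0)); rewrite -rhoD !addr0.
  split=> // x x0; pose I : {pred R} := [pred y | `[< rho y = 0 >]].
  have IP y : reflect (rho y = 0) (y \in I) by exact: asboolP.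
  apply: (sg_simple (I := I)).
  + split; first exact/IP.
      apply/IP; rewrite rho1 => /(congr1 (fun h : T0 => h point)) /eqP.
      by rewrite oner_eq0.
    by move=> a u v /IP u0 /IP v0; apply/IP; rewrite rhoD rhoM u0 v0 mulr0 addr0.
  + by move=> y /IP y0; apply/IP; rewrite rhosg y0 twist0.
  + exact/IP.
- move=> i j o; rewrite (uniq _ _ (spZ i j)) fct_sumE mxE.
  by apply: eq_bigr => l _; rewrite !mxE.
Qed.

(** * The Galois group as a group of translations *)

Section Automorphisms.
Variables (rho : {rmorphism R -> T0}) (P : 'M[k]_m.+1).
Hypotheses (Pu : P \in unitmx) (rhoA : forall a, rho a%:A = cst a)
  (rho_sg : forall x, rho (sg x) = shT (rho x)) (rho_inj : injective rho)
  (rhoZ : forall i j o, rho (Z i j) o = (mat o *m map_mx iota P) i j).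

Local Notation alk := (al \o iota).

(** Evaluation at points of the group; jointly these morphisms are injective on
    [R] and replace computations in the coordinate ring. *)
Definition er (o : pts G) : {rmorphism R -> K} := @evf (pts G) K o \o rho.

Lemma er_inj x y : (forall o, er o x = er o y) -> x = y.
Proof. by move=> e; apply: rho_inj; apply: funext => o; apply: e. Qed.

Lemma erA o a : er o a%:A = a.
Proof. by rewrite /er /= rhoA. Qed.

Lemma er_alk o (M : 'M[k]_m.+1) : map_mx (er o) (map_mx alk M) = M%:K.
Proof. by apply/matrixP => i j; rewrite !mxE; apply: erA. Qed.

Lemma er_Z o : map_mx (er o) Z = mat o *m P%:K.
Proof. by apply/matrixP => i j; rewrite mxE; apply: rhoZ. Qed.

Definition Z1 := Z *m map_mx alk (invmx P).

Lemma er_Z1 o : map_mx (er o) Z1 = mat o.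
Proof.
by rewrite map_mxM er_Z er_alk -mulmxA -map_mxM mulmxV // map_mx1 mulmx1.
Qed.

Definition kpt y (gy : g y) : pts G := mkpt (group_const gy).

(** The translate of the coordinates [Z] is [Z] times a constant matrix, hence the
    image of [R] in the coordinate ring is stable under the translation. *)
Lemma translation_automorphism y (gy : g y) :
  exists f : {lrmorphism R -> R}, forall x o, er o (f x) = er (transl (kpt gy) o) x.
Proof.
set w := kpt gy; pose M := Z1 *m map_mx alk (mexp y) *m map_mx alk P.
have matw : mat w = (mexp y)%:K by rewrite map_mexp //; exact: char0_unit.
have erM o : map_mx (er o) M = map_mx (er (transl w o)) Z.
  by rewrite er_Z /M map_mxM map_mxM er_Z1 !er_alk /= -matw.
have Mu : M \in unitmx.
  have by_ : band 1 y by apply: g_band.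
  rewrite !unitmx_mul Zu !map_unitmx unitmx_inv Pu !andbT.
  by apply: mexp_unit => //; apply: char0_unit.
have /choice[f hf] x : exists x', forall o, er o x' = er (transl w o) x.
  pose S : {pred R} := [pred x | `[< exists x', forall o, er o x' = er (transl w o) x >]].
  have SP z : reflect (exists x', forall o, er o x' = er (transl w o) z) (z \in S) by exact: asboolP.
  apply/SP; apply: Zgen.
  - split=> [|a u v /SP[u' hu] /SP[v' hv]|u v /SP[u' hu] /SP[v' hv]]; apply/SP.
    + by exists 1 => o; rewrite !rmorph1.
    + by exists (a%:A * u' + v') => o; rewrite -[a *: u]mulr_algl !rmorphD !rmorphM hu hv !erA.
    + by exists (u' * v') => o; rewrite !rmorphM hu hv.
  - move=> i j; apply/SP; exists (M i j) => o.
    by have /matrixP/(_ i j) := erM o; rewrite !mxE.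
  - apply/SP; exists (\det M)^-1 => o.
    by rewrite !rmorphV -?unitmxE // -!det_map_mx erM.
have fB : zmod_morphism f.
  by move=> x z; apply: er_inj => o; rewrite rmorphB !hf rmorphB.
have fM : monoid_morphism f.
  split=> [|x z]; apply: er_inj => o; first by rewrite hf !rmorph1.
  by rewrite rmorphM !hf rmorphM.
have fZ : scalable f.
  by move=> a x; apply: er_inj => o; rewrite hf -[a *: x]mulr_algl -[a *: f x]mulr_algl !rmorphM !erA hf.
pose fl : {lrmorphism R -> R} := HB.pack f (GRing.isZmodMorphism.Build R R f fB)
  (GRing.isMonoidMorphism.Build R R f fM) (GRing.isScalable.Build K R R *:%R f fZ).
by exists fl.
Qed.

Lemma transl_opp y y' (gy : g y) (gy' : g y') o : y' = - y ->
  transl (kpt gy') (transl (kpt gy) o) = o.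
Proof.
move=> e; apply: mat_inj; rewrite /mat /= -/(mat o) -mulrA e map_mxN mexpN ?mulr1 //.
  exact: char0_unit.
by apply: band_emb; apply: g_band.
Qed.

Lemma exp_in_galois y : g y -> mexp y \in unitmx /\
  exists f : {lrmorphism R -> R}, (bijective f /\ forall x, f (sg x) = sg (f x)) /\
    map_mx f Z1 = Z1 *m map_mx alk (mexp y).
Proof.
move=> gy; have gN : g (- y) by apply: (lieN g_lie).
have by_ : band 1 y by apply: g_band.
split; first by apply: mexp_unit => //; apply: char0_unit.
have [f hf] := translation_automorphism gy.
have [f' hf'] := translation_automorphism gN.
have er_sg o x : er o (sg x) = sh (er (theta o) x).
  by rewrite /er /= rho_sg.
exists f; split; first split.
- exists f' => x; apply: er_inj => o.
    by rewrite hf' hf transl_opp // opprK.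
  by rewrite hf hf' transl_opp.
- move=> x; apply: er_inj => o; rewrite hf !er_sg hf theta_transl //.
  exact: map_sh'_iota.
- have matw : mat (kpt gy) = (mexp y)%:K by rewrite map_mexp //; exact: char0_unit.
  apply/matrixP => i j; rewrite mxE; apply: er_inj => o; rewrite hf.
  have /matrixP/(_ i j) := er_Z1 (transl (kpt gy) o); rewrite mxE => ->.
  have /matrixP/(_ i j) : map_mx (er o) (Z1 *m map_mx alk (mexp y)) = mat (transl (kpt gy) o).
    by rewrite map_mxM er_Z1 er_alk -matw.
  by rewrite mxE => ->.
Qed.

Lemma charR n : n.+1%:R \is a @GRing.unit R.
Proof.
by rewrite -(rmorph_nat al) rmorph_unit // unitfE; apply: char0K.
Qed.

(** The linear equations of [g] hold for [mlog Z1], as they do at every point of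
    the group.  They have coefficients in [k], so [f] preserves them, and at the
    identity the value of [mlog (f Z1)] is [mlog c]. *)
Lemma galois_in_exp (f : {lrmorphism R -> R}) (c : 'M[k]_m.+1) :
  map_mx f Z1 = Z1 *m map_mx alk c -> exists2 y, g y & mexp y = c.
Proof.
move=> ef; pose o1 : pts G := mkpt (exp_group1 gK_lie).
pose e : {rmorphism R -> K} := er o1 \o f.
have eZ : map_mx e Z1 = c%:K.
  have -> : map_mx e Z1 = map_mx (er o1) (map_mx f Z1) by apply/matrixP => i j; rewrite !mxE.
  by rewrite ef map_mxM er_Z1 er_alk mul1mx.
have eA a : e a%:A = a by rewrite -[e _]/(er o1 (f a%:A)) rmorph_alg erA.
have bc : band 1 (c - 1).
  apply/bandP => i j; rewrite addn1 ltnS => ij; apply: (fmorph_inj iota).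
  have z0 : Z1 i j = (i == j)%:R.
    apply: er_inj => o; rewrite rmorph_nat.
    have /matrixP/(_ i j) := er_Z1 o; rewrite mxE => ->.
    exact: (unip_entry (exp_group_unip gK_band (group_mat o))).
  have /matrixP/(_ i j) := eZ; rewrite mxE z0 rmorph_nat mxE => cij.
  by rewrite !mxE rmorphB -cij rmorph_nat subrr rmorph0.
have Qk := char0_unit char0; have QK := char0_unit char0K.
exists (mlog c); last exact: mexp_mlog.
apply: contrapT => ng.
have [lam lam0 lamc] := separating_form (lie0 g_lie) (fun a u v gu gv => lieD g_lie (lieZ g_lie a gu) gv) ng.
have u0 : \sum_i \sum_j alk (lam i j) * (mlog Z1) i j = 0.
  apply: er_inj => o; rewrite rmorph0 rmorph_sum.
  have -> : \sum_i er o (\sum_j alk (lam i j) * mlog Z1 i j) =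
      \sum_i \sum_j iota (lam i j) * mlog (mat o) i j.
    apply: eq_bigr => i _; rewrite rmorph_sum; apply: eq_bigr => j _.
    rewrite rmorphM [er o (alk _)]erA; congr (_ * _).
    have /matrixP/(_ i j) := map_mlog (er o) charR Z1.
    by rewrite mxE er_Z1.
  have [v gv <-] := group_mat o; rewrite mlog_mexp //; last exact: gK_band.
  elim: gv => [|a x v' gx _ IH].
    by rewrite big1 // => i _; rewrite big1 // => j _; rewrite mxE mulr0.
  transitivity (a * iota (\sum_i \sum_j lam i j * x i j) +
      \sum_i \sum_j iota (lam i j) * v' i j); last by rewrite IH lam0 // rmorph0 mulr0 addr0.
  rewrite rmorph_sum mulr_sumr -big_split; apply: eq_bigr => i _ /=.
  rewrite rmorph_sum mulr_sumr -big_split; apply: eq_bigr => j _ /=.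
  by rewrite !mxE rmorphM mulrDr mulrCA.
have := congr1 e u0; rewrite rmorph0 rmorph_sum.
have -> : \sum_i e (\sum_j alk (lam i j) * mlog Z1 i j) =
    iota (\sum_i \sum_j lam i j * mlog c i j).
  rewrite rmorph_sum; apply: eq_bigr => i _; rewrite !rmorph_sum; apply: eq_bigr => j _.
  rewrite !rmorphM [e (alk _)]eA; congr (_ * _).
  have /matrixP/(_ i j) := map_mlog e charR Z1; rewrite mxE eZ => ->.
  by rewrite -map_mlog // mxE.
by move=> /eqP; rewrite fmorph_eq0 => /eqP.
Qed.

End Automorphisms.

Theorem galois_exp : exists2 Q : 'M[k]_m.+1, Q \in unitmx & forall c : 'M[k]_m.+1,
  (c \in unitmx /\ exists f : {lrmorphism R -> R},
     (bijective f /\ forall x, f (sg x) = sg (f x)) /\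
     map_mx f (Z *m map_mx (al \o iota) Q) =
       (Z *m map_mx (al \o iota) Q) *m map_mx (al \o iota) c) <->
  exists2 y, g y & mexp y = c.
Proof.
have [rho0 [P [Pu [rD rM] rA [rsg rinj] rZ]]] := specialization.
have r1 : rho0 1 = 1 by rewrite -[1]scale1r rA.
have rN x : rho0 (- x) = - rho0 x.
  by rewrite -mulN1r rM -[-1]scaleN1r rA; apply: mulN1r.
have rB : zmod_morphism rho0 by move=> x y; rewrite rD rN.
have rMon : monoid_morphism rho0 by split.
pose rho : {rmorphism R -> T0} := HB.pack rho0
  (GRing.isZmodMorphism.Build R T0 rho0 rB) (GRing.isMonoidMorphism.Build R T0 rho0 rMon).
have rho_inj : injective rho.
  move=> x y e; apply/eqP; rewrite -subr_eq0; apply/eqP; apply: rinj.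
  by rewrite rB -/(rho x) -/(rho y) [rho0 x]e subrr.
exists (invmx P); first by rewrite unitmx_inv.
move=> c; split=> [[cu [f [_ ef]]]|[y gy <-]].
  exact: (galois_in_exp Pu (rho := rho) rA rho_inj rZ ef).
exact: (exp_in_galois Pu (rho := rho) rA rsg rho_inj rZ gy).
Qed.

End PicardVessiotRing.
End CoordinateRing.

(** * The two difference systems *)

Section Gauge.
Variables (K : fieldType) (R : comUnitAlgType K) (n : nat).
Local Notation al := (in_alg R).

(** Up to the scalar [s] the matrix is unipotent, hence an exponential. *)
Lemma scalar_nilpotent_unit m (s : K) (N : 'M[K]_m.+1) :
  (forall i, i.+1%:R != 0 :> K) -> s != 0 -> band 1 N -> s%:M + N \in unitmx.
Proof.
move=> char0K s0 bN; have QK := char0_unit char0K.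
have -> : s%:M + N = s *: mexp (mlog (1 + s^-1 *: N)).
  rewrite mexp_mlog //; first by rewrite scalerDr scalerA divff // scale1r scalemx1.
  by rewrite addrC addKr; apply: bandZ.
rewrite unitmxZ ?unitfE //; apply: mexp_unit => //; apply: band_mlog.
by rewrite addrC addKr; apply: bandZ.
Qed.

Variables (S : 'M[K]_n) (Z : 'M[R]_n).
Hypothesis Su : S \in unitmx.

Lemma gauge_generation (X : {pred R}) : GRing.subalg_closed X ->
  (forall i j, (map_mx al S *m Z) i j \in X) ->
  (\det (map_mx al S *m Z))^-1 \in X -> Z \in unitmx ->
  (forall i j, Z i j \in X) /\ (\det Z)^-1 \in X.
Proof.
move=> [X1 XL XM] hZ hd Zu.
have X0 : 0 \in X by rewrite -(addNr 1) -scaleN1r; apply: XL.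
have XZ a x : x \in X -> a *: x \in X by move=> hx; rewrite -[_ *: _]addr0; apply: XL.
have Sau : map_mx al S \in unitmx by rewrite map_unitmx.
split=> [i j|].
  have -> : Z = map_mx al (invmx S) *m (map_mx al S *m Z).
    by rewrite mulmxA -map_mxM mulVmx // map_mx1 mul1mx.
  rewrite mxE; apply: (big_ind (fun x => x \in X)) => // [u v hu hv|l _].
    by rewrite -[u]scale1r; apply: XL.
  by rewrite mxE mulr_algl; apply: XZ.
have -> : (\det Z)^-1 = \det S *: (\det (map_mx al S *m Z))^-1.
  have S0 : \det S \is a GRing.unit by rewrite -unitmxE.
  rewrite det_mulmx invrM -?unitmxE // det_map_mx scalerAr -(rmorphV al) //.
  by rewrite /= scalerA divrr // scale1r mulr1.
exact: XZ.
Qed.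

Lemma gauge_automorphism (f : {lrmorphism R -> R}) (C : 'M[R]_n) :
  map_mx f (map_mx al S *m Z) = map_mx al S *m Z *m C <-> map_mx f Z = Z *m C.
Proof.
have Sau : map_mx al S \in unitmx by rewrite map_unitmx.
have fS : map_mx f (map_mx al S) = map_mx al S.
  by apply/matrixP => i j; rewrite !mxE /= rmorph_alg.
rewrite map_mxM fS -mulmxA; split=> [|->] //.
by move=> /(congr1 (mulmx (invmx (map_mx al S)))); rewrite !mulmxA mulVmx // !mul1mx.
Qed.

Lemma gauge_solution (sh : {rmorphism K -> K}) (sg : {rmorphism R -> R})
  (M D : 'M[K]_n) : (forall a, sg a%:A = (sh a)%:A) ->
  map_mx sh S *m M = D *m S -> map_mx sg Z = map_mx al M *m Z ->
  map_mx sg (map_mx al S *m Z) = map_mx al D *m (map_mx al S *m Z).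
Proof.
move=> ext eqMD eqZ; rewrite map_mxM eqZ !mulmxA -map_mxM -eqMD map_mxM.
by congr (_ *m _ *m _); apply/matrixP => i j; rewrite !mxE /= ext.
Qed.

End Gauge.

Local Open Scope classical_set_scope.

Section Systems.
Variables (k : closedFieldType) (char0 : [pchar k] =i pred0) (m : nat).
Variables A B : 'M[k]_m.+1.
Hypotheses (bA : band 1 A) (bB : band 1 B).

Lemma galois_group_system_U : has_galois_group (system_U A B)
  [set nilp_exp x | x in lie_alg A B].
Proof.
move=> R sigma Z [[bs ext] simple [Zu Zeq] gen].
have [Q Qu hQ] := @galois_exp k (ratfun k) (@ratC k) (@shift k) (@unshift k)
  (natS_neq0 char0) (@shiftK k) (@unshiftK k) (@shift_ratC k) (shift_fixed char0)
  m A B (ratX k + 1) bA bB (ratX1_neq0 k) (shift_sub_pole char0)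
  R sigma ext simple Z Zu Zeq gen.
exists Q; first exact: Qu.
have emb_const (M : 'M[k]_m.+1) :
    map_mx (in_alg R \o @ratC k) M = const_mx_in R M.
  by apply/matrixP => i j; rewrite !mxE.
apply/seteqP; split=> c.
  move=> [cu [f [fa fZ]]].
  have [y gy ey] : exists2 y, lie_alg A B y & mexp y = c.
    apply/hQ; split; first exact: cu.
    by exists f; split; [exact: fa|rewrite !emb_const; exact: fZ].
  exists y; first exact: gy.
  exact: ey.
move=> [y gy ey].
have /hQ[cu [f [fa fZ]]] : exists2 y, lie_alg A B y & mexp y = c.
  by exists y; [exact: gy|exact: ey].
split; first exact: cu.
by exists f; split; [exact: fa|rewrite -!emb_const; exact: fZ].
Qed.

(** The gauge transformation by [s + A] takes solutions of the first system to
    solutions of the second one, without changing their constants. *)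
Lemma galois_group_system_F : has_galois_group (system_F A B)
  [set nilp_exp x | x in lie_alg A B].
Proof.
move=> R sigma Z [[bs ext] simple [Zu Zeq] gen].
pose S : 'M[ratfun k]_m.+1 := (ratX k)%:M + ratC_mx A.
have X0 : ratX k != 0.
  by rewrite -(inj_eq (can_inj (@shiftK k))) rmorph0 shift_ratX; exact: ratX1_neq0.
have Su : S \in unitmx.
  exact: (scalar_nilpotent_unit (ratnatS_neq0 char0) X0 (band_emb (@ratC k) bA)).
have shS : map_mx (@shift k) S = (ratX k + 1)%:M + ratC_mx A.
  rewrite /S map_mxD map_scalar_mx /= shift_ratX; congr (_ + _).
  by apply/matrixP => i j; rewrite !mxE; exact: shift_ratC.
have eqD : map_mx (@shift k) S *m system_F A B = system_U A B *m S.
  by rewrite shS /system_F /system_U mulmxA.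
have Sau : map_mx (in_alg R) S \in unitmx by rewrite map_unitmx.
have pvZ' : picard_vessiot sigma (system_U A B) (map_mx (in_alg R) S *m Z).
  split=> //.
  - split; first by rewrite unitmx_mul Sau.
    exact: (gauge_solution ext eqD Zeq).
  - move=> X subX hZ hd; have [hZ1 hd1] := gauge_generation Su subX hZ hd Zu.
    exact: gen.
have [P Pu hP] := galois_group_system_U pvZ'.
exists P; first exact: Pu.
set Y := Z *m const_mx_in R P.
have gaugeY := @gauge_automorphism _ _ _ S Y Su.
rewrite -hP -mulmxA -/Y.
apply/seteqP; split=> c [cu [f [fa fZ]]]; split; first exact: cu.
  by exists f; split; [exact: fa|exact: (proj2 (gaugeY f _) fZ)].
exact: cu.
by exists f; split; [exact: fa|exact: (proj1 (gaugeY f _) fZ)].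
Qed.

End Systems.

Lemma nilp_exp_dim0 (k : fieldType) (A B c : 'M[k]_0) :
  [set nilp_exp x | x in lie_alg A B] c.
Proof.
exists 0; first by move=> g [[g0 _ _] _]; exact: g0.
by apply/matrixP=> [[]].
Qed.

Lemma galois_group_dim0 (k : fieldType) (M : 'M[ratfun k]_0) (A B : 'M[k]_0) :
  has_galois_group M [set nilp_exp x | x in lie_alg A B].
Proof.
move=> R sigma Z _; exists 1%:M; first exact: unitmx1.
apply/seteqP; split=> c _; first exact: nilp_exp_dim0.
split; first by rewrite unitmxE det_mx00 unitr1.
exists idfun; split; last by apply/matrixP=> [[]].
by split=> //; exists id.
Qed.

Theorem theorem3 (k : closedFieldType) (char0 : [pchar k] =i pred0)
    (d : nat) (A B : 'M[k]_d)
    (A_upper : strictly_upper_triangular A)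
    (B_upper : strictly_upper_triangular B) :
  has_galois_group (system_F A B)
    [set nilp_exp x | x in lie_alg A B] /\
  has_galois_group (system_U A B)
    [set nilp_exp x | x in lie_alg A B].
Proof.
case: d A B A_upper B_upper => [|m] A B A_upper B_upper.
  by split; apply: galois_group_dim0.
have bA := proj1 (strictly_upper_band A) A_upper.
have bB := proj1 (strictly_upper_band B) B_upper.
split.
  exact: galois_group_system_F char0 _ _ _ bA bB.
exact: galois_group_system_U char0 _ _ _ bA bB.
Qed.
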